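(* Let $\mathbb K$ be an algebraically closed field of characteristic zero, let $n\geq 2$, and let $g(z_1,\ldots,z_n)\in\mathbb K[z_1,\ldots,z_n]_d$ be a reduced irreducible homogeneous polynomial of degree $d$ such that the hypersurface $Y^*=V(g)\subset\mathbb P^{n-1}_{\mathbf z}$ is not a cone; equivalently its dual variety $Y=\overline{\nabla_g(V(g))}\subset\mathbb P^{n-1}_{\mathbf z'}$ is non-degenerate. On $\mathbb P^{2n+1}$ with homogeneous coordinates $(u:v:x_1:\cdots:x_n:y_1:\cdots:y_n)$ let $$f(u,v,\mathbf x,\mathbf y)=g(ux_1-vy_1,\ldots,ux_n-vy_n)\in\mathbb K[u,v,\mathbf x,\mathbf y]_{2d},\qquad X=V(f)\subset\mathbb P^{2n+1}.$$ Let $Z_{Y^*}=\overline{\nabla_g(\mathbb P^{n-1}_{\mathbf z})}\subseteq\mathbb P^{n-1}_{\mathbf z'}$. Then: (i) $Z_X=\overline{\nabla_f(\mathbb P^{2n+1})}$ equals the cone $S(L',\mathbb P^1\times Z_{Y^*})=\{(u':v':\alpha\mathbf z':\beta\mathbf z')\;:\;(u',v')\in\mathbb K^2,\ (\alpha:\beta)\in\mathbb P^1,\ [\mathbf z']\in Z_{Y^*}\}^{-}\subset(\mathbb P^{2n+1})^*$, i.e. the cone with vertex the line $L'=V(x'_1,\ldots,x'_n,y'_1,\ldots,y'_n)$ over the Segre embedding of $\mathbb P^1\times Z_{Y^*}$ in $V(u',v')=\mathbb P^{2n-1}$ given by $((\alpha:\beta),\mathbf z')\mapsto(0:0:\alpha\mathbf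 z':\beta\mathbf z')$; (ii) $X^*=\mathbb P^1\times\widetilde Y\subset(\mathbb P^{2n+1})^*$, Segre embedded via $((\alpha:\beta),(w_0:w_1:\cdots:w_n))\mapsto(u':v':\mathbf x':\mathbf y')=(\beta w_0:\alpha w_0:\alpha w_1:\cdots:\alpha w_n:\beta w_1:\cdots:\beta w_n)$ (so that its image lies in the Segre variety $\mathbb P^1\times\mathbb P^n$ defined by $\operatorname{rk}\begin{pmatrix}v'&x'_1&\cdots&x'_n\\ u'&y'_1&\cdots&y'_n\end{pmatrix}=1$); (iii) $\operatorname{codim}(X^*,Z_X)=\operatorname{codim}(Y,Z_{Y^*})+1$. In particular, if $g$ has non-vanishing hessian determinant, then $Z_{Y^*}=\mathbb P^{n-1}_{\mathbf z'}$ and $\operatorname{codim}(X^*,Z_X)=\operatorname{codim}(Y,\mathbb P^{n-1})+1$.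
   Context: For a homogeneous polynomial $h$ in variables $t_0,\ldots,t_M$, the polar map is $\nabla_h:\mathbb P^M\dashrightarrow(\mathbb P^M)^*$, $p\mapsto(\partial h/\partial t_0(p):\cdots:\partial h/\partial t_M(p))$; the polar image of $V(h)$ is $\overline{\nabla_h(\mathbb P^M)}$ and the dual variety of $V(h)$ is $\overline{\nabla_h(V(h))}$. Here $\mathbb P^{n-1}_{\mathbf z'}$ with coordinates $(z'_1:\cdots:z'_n)$ is the dual of $\mathbb P^{n-1}_{\mathbf z}$; $(u':v':x'_1:\cdots:x'_n:y'_1:\cdots:y'_n)$ are the coordinates on $(\mathbb P^{2n+1})^*$ dual to those of $\mathbb P^{2n+1}$. $\mathbb P^n_{\mathbf z'}$ has coordinates $(z'_0:z'_1:\cdots:z'_n)$, containing $\mathbb P^{n-1}_{\mathbf z'}$ as the hyperplane $z'_0=0$, and $\widetilde Y\subset\mathbb P^n_{\mathbf z'}$ is the cone over $Y$ with vertex $(1:0:\cdots:0)$. $Z_X=\overline{\nabla_f(\mathbb P^{2n+1})}$ and $X^*=\overline{\nabla_f(X)}$. *)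

(* Defs.v *)
From HB Require Import structures.
From mathcomp Require Import all_boot all_order all_algebra.
From mathcomp Require Import mpoly.
Set Implicit Arguments. Unset Strict Implicit. Unset Printing Implicit Defensive.
Import Order.TTheory GRing.Theory Num.Theory.
Local Open Scope ring_scope.

Section Proj.
Variable K : fieldType.

(* A point of P^(N-1) is represented by a nonzero vector of K^N; a subset of
   P^(N-1) by the set of all nonzero representatives of its points. *)
Definition vec (N : nat) := 'I_N -> K.
Definition pset (N : nat) := vec N -> Prop.

Definition nonzero {N} (x : vec N) : Prop := exists i, x i != 0.

Definition is_homog {N} (p : {mpoly K[N]}) : Prop := exists d : nat, p \is d.-homog.

Definition zclosure {N} (S : pset N) : pset N := fun x =>
  nonzero x /\ forall p : {mpoly K[N]}, is_homog p ->
     (forall s, S s -> p.@[s] = 0) -> p.@[x] = 0.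

Definition zclosed {N} (S : pset N) : Prop := forall x, zclosure S x <-> S x.

Definition psubset {N} (A B : pset N) : Prop := forall x, A x -> B x.
Definition pproper {N} (A B : pset N) : Prop := psubset A B /\ exists x, B x /\ ~ A x.

Definition pirreducible {N} (Z : pset N) : Prop :=
  (exists x, Z x) /\ forall A B : pset N, zclosed A -> zclosed B ->
    psubset Z (fun x => A x \/ B x) -> psubset Z A \/ psubset Z B.

Definition has_chain {N} (X : pset N) (k : nat) : Prop :=
  exists Z : nat -> pset N,
    (forall i, (i <= k)%N -> zclosed (Z i) /\ pirreducible (Z i) /\ psubset (Z i) X) /\
    (forall i, (i < k)%N -> pproper (Z i) (Z i.+1)).

Definition has_dim {N} (X : pset N) (k : nat) : Prop :=
  has_chain X k /\ ~ has_chain X k.+1.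

Definition V {N} (h : {mpoly K[N]}) : pset N := fun x => nonzero x /\ h.@[x] = 0.

Definition grad {N} (h : {mpoly K[N]}) (x : vec N) : vec N :=
  fun i => (mderiv i h).@[x].

Definition polar_image {N} (h : {mpoly K[N]}) : pset N :=
  zclosure (fun y => exists x, nonzero x /\ nonzero (grad h x) /\ y = grad h x).

Definition dual_variety {N} (h : {mpoly K[N]}) : pset N :=
  zclosure (fun y => exists x, V h x /\ nonzero (grad h x) /\ y = grad h x).

Definition is_cone {N} (h : {mpoly K[N]}) : Prop :=
  exists p : vec N, nonzero p /\ forall y, V h y -> forall a b : K,
     nonzero (fun i => a * p i + b * y i) -> V h (fun i => a * p i + b * y i).

Definition mirreducible {N} (g : {mpoly K[N]}) : Prop :=
  (1 < msize g)%N /\ forall a b : {mpoly K[N]}, g = a * b ->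
     (msize a <= 1)%N \/ (msize b <= 1)%N.

Definition hessian_det {N} (g : {mpoly K[N]}) : {mpoly K[N]} :=
  \det (\matrix_(i < N, j < N) mderiv j (mderiv i g)).

Definition iu n : 'I_((2 * n).+2) := inord 0.
Definition iv n : 'I_((2 * n).+2) := inord 1.
Definition ix n (i : 'I_n) : 'I_((2 * n).+2) := inord (2 + i).
Definition iy n (i : 'I_n) : 'I_((2 * n).+2) := inord (2 + n + i).

Definition fpoly n (g : {mpoly K[n]}) : {mpoly K[(2 * n).+2]} :=
  g \mPo [tuple 'X_(iu n) * 'X_(ix i) - 'X_(iv n) * 'X_(iy i) | i < n].

Definition cone_segre n (Z : pset n) : pset ((2 * n).+2) :=
  zclosure (fun w => exists (u' v' a b : K) (z : vec n),
    (a != 0 \/ b != 0) /\ Z z /\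
    w (iu n) = u' /\ w (iv n) = v' /\
    (forall i, w (ix i) = a * z i) /\ (forall i, w (iy i) = b * z i)).

(* cone over Y in P^n with vertex (1:0:...:0); coordinate 0 is w_0,
   coordinate lift 0 i is w_(i+1) *)
Definition cone_tilde n (Y : pset n) : pset n.+1 := fun w =>
  nonzero w /\ (Y (fun i => w (lift ord0 i)) \/ forall i, w (lift ord0 i) = 0).

Definition segre_tilde n (Y : pset n) : pset ((2 * n).+2) := fun q =>
  exists (a b : K) (w : vec n.+1), (a != 0 \/ b != 0) /\ cone_tilde Y w /\
    q (iu n) = b * w ord0 /\ q (iv n) = a * w ord0 /\
    (forall i, q (ix i) = a * w (lift ord0 i)) /\
    (forall i, q (iy i) = b * w (lift ord0 i)).

Definition whole {N} : pset N := fun x => nonzero x.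

End Proj.

(* Main.v *)
(* Dimension is measured by linear sections.  If k linear forms l have no common zero on a closed
   set X, the projective Nullstellensatz makes K[X] a finite module over K[l], so the number of
   independent forms of degree m on X is O(m^(k-1)); a chain of k+1 irreducible closed sets produces
   independent forms of number growing like m^k, so X has no such chain.  If on the contrary any k
   linear forms meet on X, a minimal closed subset with this property is irreducible, because having
   no common zero on a closed set is an open condition on the forms; a hyperplane section then
   lowers k by one and yields a chain.

   Writing z = ux - vy and w = grad g (z), the gradient of f is (x.w, -y.w, uw, -vw), and Euler's
   relation u(x.w) - v(y.w) = d g(z) is the only constraint on (x.w, y.w).  On V(f) this says that
   (v', x') and (u', y') are proportional; off V(f) it is absorbed by rescaling z.  Antidiagonal
   sums of a rank one 2 x (k+1) matrix give k+2 linear forms without common zero, which bounds the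
   dimension of the Segre cones from above.  That V(g) has a smooth point, hence that Y is non-empty,
   follows from Gauss's lemma: g and dg/dz_n satisfy a Bezout identity with a non-zero right-hand
   side free of z_n. *)
Require Import Defs.
From HB Require Import structures.
From mathcomp Require Import all_boot all_order all_algebra.
From mathcomp Require Import mpoly ring zify.
From Stdlib Require Import Classical ClassicalEpsilon FunctionalExtensionality.
From Stdlib Require Import PropExtensionality.
Set Implicit Arguments. Unset Strict Implicit. Unset Printing Implicit Defensive.
Import Order.TTheory GRing.Theory.
Local Open Scope ring_scope.

(** * Noetherianity of polynomial ideals *)


(** Two obstacles shape the geometric half. Points are non-zero vectors and closures test forms
    only. A row of a Segre point may vanish, so membership is mostly stated on the affine cone
    [orzero]. A form with some arguments fixed becomes an inhomogeneous polynomial, so vanishing is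
    transported to closures component by component ([cone_vanish]). Degenerate parameters are mostly
    reached by density: a polynomial that vanishes wherever another non-zero polynomial does not is
    itself zero. The [+ 1] in (iii) comes from the fibres: the Segre product with the cone over [Y]
    adds 2 to the dimension (the factor P^1 and the cone direction), while the cone over P^1 x Z
    adds 3 (the factor P^1 and the vertex line). Characteristic zero enters three times: a vanishing
    derivative means a missing variable, the degree in Euler's relation is invertible, and a
    polynomial with all derivatives zero is constant. Not being a cone forces degree at least 2, so
    that the gradient of [g] vanishes at the origin. *)

Lemma choice_fun (A B : Type) (P : A -> B -> Prop) :
  (forall a, exists b, P a b) -> exists f : A -> B, forall a, P a (f a).
Proof.
move=> H; exists (fun a => proj1_sig (constructive_indefinite_description _ (H a))).
by move=> a; case: constructive_indefinite_description.
Qed.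

Lemma nat_argmin (T : Type) (P : T -> Prop) (u : T -> nat) :
  (exists i, P i) -> exists j, P j /\ forall i, P i -> (u j <= u i)%N.
Proof.
case=> i0 Pi0.
suff H b : (exists i, P i /\ (u i <= b)%N) ->
   exists j, P j /\ forall i, P i -> (u j <= u i)%N.
  by apply: (H (u i0)); exists i0.
elim: b => [|b IH] [i [Pi ui]].
  by exists i; split=> // k _; move: ui; rewrite leqn0 => /eqP ->.
case: (classic (exists i, P i /\ (u i <= b)%N)) => [/IH //|nex].
exists i; split=> // k Pk; apply: leq_trans ui _.
by rewrite ltnNge; apply/negP => uk; apply: nex; exists k.
Qed.

(** Each chosen index minimises [u] over a whole tail, so no later value can be smaller. *)
Lemma nondecreasing_subseq (u : nat -> nat) :
  exists phi : nat -> nat, (forall i, (phi i < phi i.+1)%N) /\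
    (forall i, (u (phi i) <= u (phi i.+1))%N).
Proof.
have /choice_fun[f fP] k : exists j, (k <= j)%N /\
    forall i, (k <= i)%N -> (u j <= u i)%N.
  by apply: nat_argmin; exists k.
pose phi := fix phi i := if i is j.+1 then f (phi j).+1 else f 0%N.
have phiS i : (phi i < phi i.+1)%N by have [] := fP (phi i).+1.
exists phi; split=> // i.
have [k [Ek lek]] : exists k, phi i = f k /\ (k <= phi i)%N.
  by case: i => [|i]; [exists 0%N | exists (phi i).+1; split => //; exact: phiS].
rewrite Ek; apply: (fP k).2; apply: leq_trans lek _; exact: ltnW.
Qed.

(** Refining the sequence once per variable makes all exponents non-decreasing along a common
    subsequence, whose first two terms are then comparable. *)
Lemma dickson (N : nat) (m : nat -> 'X_{1..N}) :
  exists i j, (i < j)%N /\ (m i <= m j)%MM.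
Proof.
have [phi [phiS mphi]] : exists phi : nat -> nat, (forall i, (phi i < phi i.+1)%N) /\
    forall c, c \in enum 'I_N -> forall i, (m (phi i) c <= m (phi i.+1) c)%N.
  elim: (enum _) => [|c s [phi [phiS IH]]]; first by exists id.
  have [psi [psiS mpsi]] := nondecreasing_subseq (fun i => m (phi i) c).
  have philt : {homo phi : i j / (i < j)%N}.
    by apply: homo_ltn phiS; exact: ltn_trans.
  exists (phi \o psi); split=> [i|c' /[!inE] /orP[/eqP->|c's] i] /=.
  - exact: philt.
  - exact: mpsi.
  - have mono : {homo (fun k => m (phi k) c') : i j / (i <= j)%N}.
      by apply: homo_leq (IH _ c's) => // x y z; exact: leq_trans.
    by apply: mono; exact: ltnW.
exists (phi 0%N), (phi 1%N); split=> //; apply/mnm_lepP => c.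
by apply: mphi; rewrite mem_enum.
Qed.

Section Ideals.
Variables (K : fieldType) (N : nat).
Local Notation R := {mpoly K[N]}.
Implicit Types (I J : R -> Prop) (p q : R).

Definition ideal I : Prop :=
  [/\ I 0, forall p q, I p -> I q -> I (p + q) & forall a p, I p -> I (a * p)].

Lemma ideal0 I : ideal I -> I 0. Proof. by case. Qed.
Lemma idealD I p q : ideal I -> I p -> I q -> I (p + q).
Proof. by case=> _ H _; exact: H. Qed.
Lemma ideal_mull I a p : ideal I -> I p -> I (a * p).
Proof. by case=> _ _; exact. Qed.
Lemma ideal_mulr I a p : ideal I -> I p -> I (p * a).
Proof. by rewrite mulrC; exact: ideal_mull. Qed.
Lemma idealZ I c p : ideal I -> I p -> I (c *: p).
Proof. by rewrite -mul_mpolyC; exact: ideal_mull. Qed.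
Lemma idealN I p : ideal I -> I p -> I (- p).
Proof. by rewrite -mulN1r; exact: ideal_mull. Qed.
Lemma idealB I p q : ideal I -> I p -> I q -> I (p - q).
Proof. by move=> iI Ip Iq; apply: idealD => //; exact: idealN. Qed.
Lemma ideal_sum I (T : Type) (r : seq T) (P : pred T) (F : T -> R) :
  ideal I -> (forall i, P i -> I (F i)) -> I (\sum_(i <- r | P i) F i).
Proof.
move=> iI H; apply: (big_ind I) => //; first exact: ideal0.
by move=> *; exact: idealD.
Qed.

(* Pick p_i in J_(i+1) \ J_i with least leading monomial: by Dickson's lemma some p_i reduces a
   later p_j, against the minimality of the latter. *)
Lemma ideal_acc (J : nat -> R -> Prop) :
  (forall i, ideal (J i)) -> (forall i p, J i p -> J i.+1 p) ->
  ~ (forall i, exists p, J i.+1 p /\ ~ J i p).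
Proof.
move=> iJ Jsub Jprop.
have Jle i j p : (i <= j)%N -> J i p -> J j p.
  by move=> /subnK <-; elim: (j - i)%N => //= k IH /IH; exact: Jsub.
have /choice_fun[f fP] i : exists p, [/\ J i.+1 p, ~ J i p &
     forall q, J i.+1 q -> ~ J i q -> ~~ (mlead q < mlead p)%O].
  have [p0 [Jp0 nJp0]] := Jprop i.
  move: p0 Jp0 nJp0.
  suff H m : forall p, mlead p = m -> J i.+1 p -> ~ J i p -> exists p, [/\ J i.+1 p, ~ J i p &
     forall q, J i.+1 q -> ~ J i q -> ~~ (mlead q < mlead p)%O].
    by move=> p0; exact: (H (mlead p0)).
  elim/(@ltmwf N): m => m IH p pm Jp nJp.
  case: (classic (exists q, [/\ J i.+1 q, ~ J i q & (mlead q < mlead p)%O])).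
    by case=> q [Jq nJq qp]; apply: (IH (mlead q)) Jq nJq; rewrite -?pm.
  move=> nex; exists p; split=> // q Jq nJq; apply/negP => qp.
  by apply: nex; exists q.
have [i [j [ltij le_m]]] := dickson (fun i => mlead (f i)).
have [Ji nJi _] := fP i; have [Jj nJj minj] := fP j.
have fi0 : f i != 0 by apply/eqP => E; apply: nJi; rewrite E; exact: ideal0.
have ci : (f i)@_(mlead (f i)) != 0 by rewrite mleadc_eq0.
pose a := ((f j)@_(mlead (f j)) / (f i)@_(mlead (f i))) *: 'X_[mlead (f j) - mlead (f i)] : R.
have Jai : J j (a * f i).
  by apply: ideal_mull => //; apply: Jle Ji.
have nJq : ~ J j (f j - a * f i).
  by move=> H; apply: nJj; rewrite -(subrK (a * f i) (f j)); exact: idealD.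
have /negP[] := minj (f j - a * f i) (idealB (iJ _) Jj (Jsub _ _ Jai)) nJq.
have q0 : f j - a * f i != 0 by apply/eqP => E; apply: nJq; rewrite E; exact: ideal0.
have fj0 : f j != 0 by apply/eqP => E; apply: nJj; rewrite E; exact: ideal0.
have aE : mlead (a * f i) = mlead (f j).
  rewrite mleadM //; last first.
    rewrite scaler_eq0 mulf_eq0 invr_eq0 mleadc_eq0 (negbTE fj0) (negbTE ci) /=.
    by rewrite -msize_poly_eq0 msizeX.
  rewrite mleadZ ?mleadXm ?submK // mulf_neq0 ?invr_neq0 //.
  by rewrite mleadc_eq0.
rewrite lt_neqAle; apply/andP; split; last first.
  by apply: le_trans (mleadB_le _ _) _; rewrite aE joinxx.
apply/eqP => E.
have Ec : ('X_[mlead (f j) - mlead (f i)] * f i)@_(mlead (f j)) = (f i)@_(mlead (f i)).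
  by rewrite mulrC -[in X in mcoeff X](submK le_m) mcoeffMX.
by move: (q0); rewrite -mleadc_eq0 E mcoeffB -scalerAl mcoeffZ Ec divfK // subrr eqxx.
Qed.

(** Without a maximal member, dependent choice inside [F] would build a strictly increasing sequence
    of ideals, against [ideal_acc]. *)
Lemma ideal_max (F : (R -> Prop) -> Prop) :
  (forall I, F I -> ideal I) -> (exists I, F I) ->
  exists I, F I /\ forall J, F J -> (forall p, I p -> J p) -> forall p, J p -> I p.
Proof.
move=> Fid [I0 FI0]; apply: NNPP => nex.
have /choice_fun[f fP] (I : {I | F I}) : exists J : {I | F I},
    (forall p, sval I p -> sval J p) /\ exists p, sval J p /\ ~ sval I p.
  apply: NNPP => H; apply: nex; exists (sval I); split; first exact: (svalP I).
  move=> J FJ IJ p Jp; apply: NNPP => nIp; apply: H.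
  by exists (exist _ J FJ); split=> //; exists p.
pose s := fix s i := if i is j.+1 then f (s j) else exist _ I0 FI0.
apply: (@ideal_acc (fun i => sval (s i))) => [i|i p|i].
- exact: Fid (svalP _).
- exact: (fP (s i)).1.
- exact: (fP (s i)).2.
Qed.
End Ideals.

(** * Homogeneous ideals and the projective Nullstellensatz *)


Section HomogIdeals.
Variables (K : fieldType) (N : nat).
Local Notation R := {mpoly K[N]}.
Implicit Types (I J : R -> Prop) (p q : R).

(** Both sides are linear in [r], so monomials suffice. The [if] guards the truncated subtraction
    [d - e], which would otherwise produce a spurious component of degree 0. *)
Lemma pihomogMr d e (r a : R) : a \is e.-homog ->
  pihomog mdeg d (r * a) = if (e <= d)%N then pihomog mdeg (d - e) r * a else 0.
Proof.
move=> ha; elim/mpolyind: r => [|c m p _ _ IH].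
  by rewrite mul0r !pihomog0 mul0r if_same.
have hX : 'X_[m] * a \is (mdeg m + e).-homog by rewrite dhomogM // dhomogX.
rewrite mulrDl !linearD /= IH -scalerAl !linearZ /= pihomogX.
case: leqP => led.
  rewrite mulrDl -scalerAl; congr (_ *: _ + _).
  case: eqP => [E|/eqP E]; last first.
    by rewrite mul0r (@pihomog_ne0 _ _ mdeg (mdeg m + e)) //; apply: contra E => /eqP <-; rewrite addnK.
  by rewrite pihomog_dE // -(subnK led) -E.
rewrite (@pihomog_ne0 _ _ mdeg (mdeg m + e)) ?scaler0 ?addr0 //.
by apply/negP => /eqP E; move: led; rewrite -E ltnNge leq_addl.
Qed.

Lemma homogX d (u : 'X_{1..N}) : mdeg u = d -> 'X_[u] \is [in K[N], d.-homog].
Proof. by move=> <-; rewrite dhomogX. Qed.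

Lemma homogXi (i : 'I_N) : 'X_i \is [in K[N], 1.-homog].
Proof. exact/homogX/mdeg1. Qed.

Lemma msize_homog m p : p \is m.-homog -> (msize p <= m.+1)%N.
Proof. by move=> /dhomogP hp; rewrite msizeE; apply/bigmax_leqP_seq => i /hp ->. Qed.

Lemma sum_pihomog p : p = \sum_(d < msize p) pihomog mdeg d p.
Proof. exact: pihomog_partitionE. Qed.

Lemma homog_mpolyE m p : p \is m.-homog ->
  p = \sum_(u <- msupp p | mdeg u == m) p@_u *: 'X_[u].
Proof. by move=> /pihomog_dE E; rewrite -{1}E. Qed.

(** Finiteness of the family is the point: statements about all forms of one degree become
    statements about matrices. *)
Lemma homog_span m : exists D (s : 'I_D -> R), (forall i, s i \is m.-homog) /\
  forall p, p \is m.-homog -> exists c : 'I_D -> K, p = \sum_i c i *: s i.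
Proof.
pose s0 := [seq val u | u <- index_enum 'X_{1..N < m.+1} & mdeg (val u) == m].
exists (size s0), (fun i => 'X_[nth 0%MM s0 i]); split=> [i|p hp].
  have : nth 0%MM s0 i \in s0 by apply: mem_nth.
  by case/mapP=> u; rewrite mem_filter => /andP[/eqP E _] ->; exact: homogX.
exists (fun i => p@_(nth 0%MM s0 i)).
rewrite -{1}(pihomog_dE hp) (pihomogwE _ _ (msize_homog hp)).
rewrite -big_filter -(big_map val xpredT (fun u => p@_u *: 'X_[u])) /=.
by rewrite (big_nth 0%MM) big_mkord.
Qed.

Lemma mnm_split (m m' : nat) (u : 'X_{1..N}) : mdeg u = (m + m')%N ->
  exists u1 u2, [/\ u = (u1 + u2)%MM, mdeg u1 = m & mdeg u2 = m'].
Proof.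
elim: m u => [|m IH] u E; first by exists 0%MM, u; rewrite add0m mdeg0.
have [i ui] : exists i, u i != 0%N.
  apply/existsP; apply/negbNE; rewrite negb_exists; apply/negP => /forallP H.
  by move: E; rewrite mdegE big1 // => i _; apply/eqP; rewrite -[_ == _]negbK.
have Eu : (u - U_(i) + U_(i))%MM = u by rewrite submK // lep1mP.
have [|u1 [u2 [E1 E2 E3]]] := IH (u - U_(i))%MM.
  by have := congr1 (@mdeg _) Eu; rewrite mdegD mdeg1 E addn1 addSn => -[].
exists (U_(i) + u1)%MM, u2; split=> //; last by rewrite mdegD mdeg1 E2.
by rewrite -Eu E1 addmC addmA.
Qed.

Definition hideal I : Prop := ideal I /\ forall d p, I p -> I (pihomog mdeg d p).

(** For an ideal, being [full] in some degree means containing a power of the irrelevant ideal; over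
    an algebraically closed field a homogeneous ideal has this property exactly when it has no
    projective zero. *)
Definition full m I : Prop := forall p, p \is m.-homog -> I p.

Lemma full_mon m I : ideal I -> (forall u, mdeg u = m -> I 'X_[u]) -> full m I.
Proof.
move=> iI H p /homog_mpolyE ->.
by apply: ideal_sum => // u /eqP /H; exact: idealZ.
Qed.

Lemma full_leq m m' I : ideal I -> (m <= m')%N -> full m I -> full m' I.
Proof.
move=> iI /subnK E fI; apply: full_mon => // u.
rewrite -E => /mnm_split[u1 [u2 [-> _ e2]]].
by rewrite mpolyXD; apply: ideal_mull => //; apply: fI; exact: homogX.
Qed.

Definition adjoin I (a : R) p : Prop := exists q r, I q /\ p = q + r * a.

Lemma adjoin_ideal I a : ideal I -> ideal (adjoin I a).
Proof.
move=> iI; split.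
- by exists 0, 0; rewrite mul0r addr0; split=> //; exact: ideal0.
- move=> _ _ [q [r [Iq ->]]] [q' [r' [Iq' ->]]].
  by exists (q + q'), (r + r'); split; [exact: idealD | rewrite mulrDl addrACA].
- move=> b _ [q [r [Iq ->]]]; exists (b * q), (b * r).
  by split; [exact: ideal_mull | rewrite mulrDr mulrA].
Qed.

Lemma adjoin_sub I a p : I p -> adjoin I a p.
Proof. by move=> Ip; exists p, 0; rewrite mul0r addr0. Qed.

Lemma adjoin_mem I a : ideal I -> adjoin I a a.
Proof. by move=> iI; exists 0, 1; rewrite mul1r add0r; split=> //; exact: ideal0. Qed.

Lemma adjoin_hideal I e a : a \is e.-homog -> hideal I -> hideal (adjoin I a).
Proof.
move=> ha [iI hI]; split; first exact: adjoin_ideal.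
move=> d _ [q [r [Iq ->]]].
exists (pihomog mdeg d q), (if (e <= d)%N then pihomog mdeg (d - e) r else 0).
split; first exact: hI.
by rewrite pihomogD (pihomogMr _ _ ha); case: ifP => //; rewrite mul0r.
Qed.

Definition gen I k (l : 'I_k -> R) p : Prop :=
  exists q (r : 'I_k -> R), I q /\ p = q + \sum_j r j * l j.

Lemma gen_ideal I k (l : 'I_k -> R) : ideal I -> ideal (gen I l).
Proof.
move=> iI; split.
- exists 0, (fun=> 0); rewrite big1 ?addr0; last by move=> *; rewrite mul0r.
  by split=> //; exact: ideal0.
- move=> _ _ [q [r [Iq ->]]] [q' [r' [Iq' ->]]].
  exists (q + q'), (fun j => r j + r' j); split; first exact: idealD.
  by rewrite addrACA -big_split; congr (_ + _); apply: eq_bigr => j _; rewrite mulrDl.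
- move=> b _ [q [r [Iq ->]]]; exists (b * q), (fun j => b * r j).
  split; first exact: ideal_mull.
  by rewrite mulrDr mulr_sumr; congr (_ + _); apply: eq_bigr => j _; rewrite mulrA.
Qed.

Lemma gen_sub I k (l : 'I_k -> R) p : I p -> gen I l p.
Proof. by move=> Ip; exists p, (fun=> 0); rewrite big1 ?addr0 // => *; rewrite mul0r. Qed.

Lemma gen_comb I k (l : 'I_k -> R) (r : 'I_k -> R) : ideal I -> gen I l (\sum_j r j * l j).
Proof. by move=> iI; exists 0, r; rewrite add0r; split => //; exact: ideal0. Qed.

Lemma gen_mem I k (l : 'I_k -> R) j : ideal I -> gen I l (l j).
Proof.
move=> iI; rewrite (_ : l j = \sum_i (i == j)%:R * l i); first exact: gen_comb.
by rewrite (bigD1 j) //= eqxx mul1r big1 ?addr0 // => i /negbTE ->; rewrite mul0r.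
Qed.

(** Passing to components of degree [d + e] keeps the relation and gives all coefficients the same
    degree. [full_perturb] can then multiply them by other linear forms without leaving degree
    [m.+1]. *)
Lemma gen_homog_part I e k (l : 'I_k -> R) d p : (forall j, l j \is e.-homog) ->
  hideal I -> p \is (d + e).-homog -> gen I l p ->
  exists q (r : 'I_k -> R), [/\ I q, forall j, r j \is d.-homog &
    p = q + \sum_j r j * l j].
Proof.
move=> hl [iI hI] hp [q [r [Iq E]]].
exists (pihomog mdeg (d + e) q), (fun j => pihomog mdeg d (r j)).
split; [exact: hI | by move=> j; exact: pihomogP|].
rewrite -(pihomog_dE hp) E pihomogD; congr (_ + _); rewrite linear_sum.
by apply: eq_bigr => j _ /=; rewrite (pihomogMr _ _ (hl j)) leq_addl addnK.
Qed.

Lemma gen_hideal I e k (l : 'I_k -> R) : (forall j, l j \is e.-homog) ->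
  hideal I -> hideal (gen I l).
Proof.
move=> hl [iI hI]; split; first exact: gen_ideal.
move=> d _ [q [r [Iq ->]]].
exists (pihomog mdeg d q),
  (fun j => if (e <= d)%N then pihomog mdeg (d - e) (r j) else 0).
split; first exact: hI.
rewrite pihomogD linear_sum; congr (_ + _); apply: eq_bigr => j _ /=.
by rewrite (pihomogMr _ _ (hl j)); case: ifP => //; rewrite mul0r.
Qed.

Lemma gen_recl I k (l : 'I_k.+1 -> R) p : gen I l p ->
  gen (adjoin I (l ord0)) (fun j : 'I_k => l (lift ord0 j)) p.
Proof.
case=> q [r [Iq ->]]; rewrite big_ord_recl addrA.
exists (q + r ord0 * l ord0), (fun j => r (lift ord0 j)); split=> //.
by exists q, (r ord0).
Qed.

End HomogIdeals.

Section Nullstellensatz.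
Variables (K : closedFieldType) (N : nat).
Local Notation R := {mpoly K[N]}.
Implicit Types (I P : R -> Prop) (p q : R).

Definition hprime P : Prop := forall a b d e,
  a \is d.-homog -> b \is e.-homog -> P (a * b) -> P a \/ P b.

(** [P] is maximal among the homogeneous ideals containing [I] that are full in no degree. If [a]
    and [b] were outside [P] with [a * b] inside, adjoining either would fill some degree, and
    products of monomials would fill the sum of the two degrees in [P] itself. The last clause says
    that [P] is the ideal of a single point. *)
Lemma exists_hprime I : hideal I -> (forall m, ~ full m I) ->
  exists P, [/\ hideal P, forall p, I p -> P p, forall m, ~ full m P, hprime P &
    forall a e, a \is e.-homog -> ~ P a -> exists m, full m (adjoin P a)].
Proof.
move=> hI nI.
have [P [[hP IP nP] maxP]] := @ideal_max K N
  (fun J => [/\ hideal J, forall p, I p -> J p & forall m, ~ full m J])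
  (fun J H => let: And3 (conj iJ _) _ _ := H in iJ)
  (ex_intro _ I (And3 hI (fun p Ip => Ip) nI)).
have full_adj a e : a \is e.-homog -> ~ P a -> exists m, full m (adjoin P a).
  move=> ha nPa; apply: NNPP => nf; apply: nPa.
  apply: (maxP (adjoin P a)); last exact: adjoin_mem hP.1.
    split; first exact: adjoin_hideal ha hP.
    - by move=> p /IP; exact: adjoin_sub.
    - by move=> m fm; apply: nf; exists m.
  by move=> p; exact: adjoin_sub.
exists P; split=> // a b d e ha hb Pab; apply: NNPP => nPab.
have [m fm] : exists m, full m (adjoin P a) by apply: full_adj ha _ => ?; apply: nPab; left.
have [m' fm'] : exists m, full m (adjoin P b) by apply: full_adj hb _ => ?; apply: nPab; right.
have iP := hP.1.
apply: (nP (m + m')%N); apply: full_mon => // u /mnm_split[u1 [u2 [-> e1 e2]]].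
have [q1 [r1 [Pq1 E1]]] := fm _ (homogX K e1).
have [q2 [r2 [Pq2 E2]]] := fm' _ (homogX K e2).
rewrite mpolyXD E1 mulrDl; apply: idealD => //; first exact: ideal_mulr.
rewrite E2 mulrDr; apply: idealD => //; first exact: ideal_mull.
by rewrite mulrACA; exact: ideal_mull.
Qed.

Lemma hprime_X P d p : ideal P -> ~ full 0 P -> hprime P ->
  p \is 1.-homog -> P (p ^+ d) -> P p.
Proof.
move=> iP n0 pP hp; elim: d => [|d IH].
  rewrite expr0 => P1; case: n0 => q hq.
  by rewrite -(mulr1 q); exact: ideal_mull.
rewrite exprS => H; case: (pP _ _ 1%N (1 * d)%N hp _ H) => //.
exact: dhomogMn.
Qed.

Lemma mx_split_annihilator D (M : 'M[K]_D) :
  exists rs : seq K, \big[mulmx/1%:M]_(z <- rs) (M - z%:M) = 0.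
Proof.
case: D M => [|D] M; first by exists [::]; rewrite big_nil [1%:M]flatmx0.
have [rs Ers] := closed_field_poly_normal (char_poly M).
exists rs; rewrite -(Cayley_Hamilton M) Ers.
rewrite (monicP (char_poly_monic M)) scale1r rmorph_prod /=.
by apply: eq_bigr => z _; rewrite rmorphB /= horner_mx_X horner_mx_C.
Qed.

(* Modulo P, X_x acts on forms of degree m as X_y times a scalar matrix M.  Apply the factors M - c of
   a split annihilating polynomial of M one after the other to a form outside P: the first one that
   brings it into P gives c. *)
Lemma hprime_linear P (x y : 'I_N) m : hideal P -> hprime P -> ~ full m P ->
  full m.+1 (adjoin P 'X_y) -> exists c : K, P ('X_x - c *: 'X_y).
Proof.
move=> [iP hP] pP nP fP; have [D [s [hs spans]]] := @homog_span K N m.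
pose sg (c : 'rV[K]_D) : R := \sum_i c 0 i *: s i.
have hsg c : sg c \is m.-homog by apply: rpred_sum => i _; apply: rpredZ.
have sgP p : p \is m.-homog -> exists c, p = sg c.
  move=> /spans[c ->]; exists (\row_i c i).
  by apply: eq_bigr => i _; rewrite mxE.
have hX := @homogXi K N.
have /choice_fun[M0 M0P] i : exists c : 'I_D -> K,
    P ('X_x * s i - 'X_y * \sum_j c j *: s j).
  have hxs : 'X_x * s i \is m.+1.-homog by rewrite -add1n dhomogM.
  have [q [r [Pq E]]] := fP _ hxs.
  have [c Ec] := spans _ (pihomogP mdeg m r).
  exists c; rewrite -Ec -(pihomog_dE hxs) E pihomogD (pihomogMr _ _ (hX y)) /= subn1.
  by rewrite mulrC addrK; exact: hP.
pose M := \matrix_(i, j) M0 i j.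
have sgM c : P ('X_x * sg c - 'X_y * sg (c *m M)).
  have -> : 'X_x * sg c - 'X_y * sg (c *m M) =
      \sum_i c 0 i *: ('X_x * s i - 'X_y * \sum_j M0 i j *: s j).
    under [RHS]eq_bigr => i _ do rewrite scalerBr !scalerAr.
    rewrite sumrB -!mulr_sumr; congr (_ - _ * _).
    under [RHS]eq_bigr => i _ do rewrite scaler_sumr.
    rewrite exchange_big; apply: eq_bigr => j _ /=.
    rewrite mxE scaler_suml; apply: eq_bigr => i _.
    by rewrite mxE scalerA.
  by apply: ideal_sum => // i _; apply: idealZ.
have [c0 nPc0] : exists c, ~ P (sg c).
  apply: NNPP => H; apply: nP => p /sgP[c ->].
  by apply: NNPP => nPc; apply: H; exists c.
have step (rs : seq K) : forall c, ~ P (sg c) ->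
    P (sg (c *m \big[mulmx/1%:M]_(z <- rs) (M - z%:M))) ->
    exists z : K, P ('X_x - z *: 'X_y).
  elim: rs => [|z rs IH] c nPc; first by rewrite big_nil mulmx1.
  rewrite big_cons mulmxA.
  case: (classic (P (sg (c *m (M - z%:M))))) => [Pz _|]; last exact: IH.
  exists z; suff: P (('X_x - z *: 'X_y) * sg c).
    case/(pP _ _ 1%N m) => //; apply: rpredB; first exact: hX.
    by apply: rpredZ; exact: hX.
  have -> : ('X_x - z *: 'X_y) * sg c =
      ('X_x * sg c - 'X_y * sg (c *m M)) + 'X_y * sg (c *m (M - z%:M)).
    have -> : sg (c *m (M - z%:M)) = sg (c *m M) - z *: sg c.
      rewrite /sg scaler_sumr -sumrB; apply: eq_bigr => i _.
      by rewrite mulmxBr mul_mx_scalar !mxE scalerBl scalerA.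
    by rewrite mulrBr addrA subrK mulrBl -scalerAl -scalerAr.
  by apply: idealD => //; exact: ideal_mull.
have [rs Ers] := mx_split_annihilator M.
apply: (step rs c0 nPc0); rewrite Ers mulmx0 /sg big1 => [|i _]; first exact: ideal0.
by rewrite mxE scale0r.
Qed.

(** Modulo [P] every variable is a scalar multiple of one variable ['X_y] outside [P]; these scalars
    are the coordinates of the zero. A form [p] of degree [d] is then congruent to [p.@[x] *: 'X_y
    ^+ d], and no power of ['X_y] lies in [P]. *)
Theorem projective_nullstellensatz I : hideal I -> (forall m, ~ full m I) ->
  exists x : vec K N, nonzero x /\ forall p, I p -> p.@[x] = 0.
Proof.
move=> hI nI; have [P [hP IP nP pP adjP]] := exists_hprime hI nI.
have iP := hP.1.
have hX := @homogXi K N.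
have [y nPy] : exists y : 'I_N, ~ P 'X_y.
  apply: NNPP => H; apply: (nP 1%N); apply: full_mon => // u /eqP /mdeg1P[i /eqP ->].
  by apply: NNPP => nPi; apply: H; exists i.
have [m fm] := adjP _ _ (hX y) nPy.
have /choice_fun[x xP] z : exists c : K, P ('X_z - c *: 'X_y).
  apply: (hprime_linear z hP pP (nP m)).
  by apply: full_leq fm => //; exact: adjoin_ideal.
exists x; split.
  exists y; apply/eqP => x0; apply: nPy.
  by have := xP y; rewrite x0 scale0r subr0.
pose E a b := P (a - b).
have EM a b c d : E a b -> E c d -> E (a * c) (b * d).
  move=> Pab Pcd; rewrite /E (_ : a * c - b * d = c * (a - b) + b * (c - d)).
    by apply: idealD => //; exact: ideal_mull.
  by rewrite !mulrBr addrA [c * b]mulrC subrK [c * a]mulrC.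
have Erefl a : E a a by rewrite /E subrr; exact: ideal0.
have EX u : E 'X_[u] (\prod_i x i ^+ u i *: 'X_y ^+ mdeg u).
  rewrite mpolyXE_id mdegE.
  have -> : (\prod_i x i ^+ u i) *: 'X_y ^+ (\sum_i u i) =
     \prod_i ((x i *: 'X_y) ^+ u i) :> R.
    under [RHS]eq_bigr => i _ do rewrite exprZn.
    by rewrite scaler_prod prodrXr.
  apply: (big_ind2 E) => // i _.
  elim: (u i) => [|k IH]; first by rewrite !expr0.
  by rewrite !exprS; apply: EM => //; exact: xP.
have Ehom d p : p \is d.-homog -> E p (p.@[x] *: 'X_y ^+ d).
  move=> hp; have ep := congr1 (meval x) (homog_mpolyE hp).
  rewrite raddf_sum in ep; rewrite /E ep {1}(homog_mpolyE hp).
  rewrite scaler_suml -sumrB; apply: ideal_sum => // u /eqP ud.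
  rewrite /= mevalZ mevalX -scalerA -scalerBr; apply: idealZ => //.
  by rewrite -ud; exact: EX.
have hom0 d p : p \is d.-homog -> P p -> p.@[x] = 0.
  move=> hp Pp; apply/eqP/negP => /negP px; apply: nPy.
  apply: (@hprime_X P d) => //.
  rewrite -[_ ^+ d]scale1r -(mulVf px) -scalerA; apply: idealZ => //.
  rewrite -[_ *: _](subKr p); apply: idealB => //; exact: Ehom.
move=> p /IP Pp; rewrite (sum_pihomog p) raddf_sum big1 // => d _ /=.
by apply: (hom0 d); [exact: pihomogP | exact: hP.2].
Qed.
End Nullstellensatz.

(** * Closed sets and linear sections *)


Section ClosedSets.
Variables (K : fieldType) (N : nat).
Local Notation R := {mpoly K[N]}.
Implicit Types (p q : R) (x : vec K N) (S Z A B X : pset K N).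

Lemma meval_scale d p x (c : K) : p \is d.-homog ->
  p.@[fun i => c * x i] = c ^+ d * p.@[x].
Proof.
move=> hp; rewrite (homog_mpolyE hp) !raddf_sum mulr_sumr; apply: eq_bigr => u /eqP ud /=.
rewrite !mevalZ !mevalX mulrCA; congr (_ * _).
rewrite -ud mdegE -prodrXr -big_split; apply: eq_bigr => i _ /=.
by rewrite exprMn.
Qed.

Lemma zclosure_sub S x : nonzero x -> S x -> zclosure S x.
Proof. by move=> nx Sx; split=> // p _ H; exact: H. Qed.

Lemma zclosure_vanish S p : is_homog p -> (forall s, S s -> p.@[s] = 0) ->
  forall x, zclosure S x -> p.@[x] = 0.
Proof. by move=> hp H x [_]; exact. Qed.

Lemma zclosure_closed S : zclosed (zclosure S).
Proof.
move=> x; split=> [[nx H]|Sx]; last by case: (Sx) => nx _; apply: zclosure_sub.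
split=> // p hp pS; apply: H => // s; exact: zclosure_vanish.
Qed.

Lemma zclosure_min S Z : zclosed Z -> psubset S Z -> psubset (zclosure S) Z.
Proof. by move=> cZ SZ x [nx H]; apply/cZ; split=> // p hp pZ; apply: H => // s /SZ/pZ. Qed.

Lemma zclosed_nonzero Z x : zclosed Z -> Z x -> nonzero x.
Proof. by move=> cZ /cZ[]. Qed.

Lemma zclosed_scale Z x c : zclosed Z -> c != 0 -> Z x -> Z (fun i => c * x i).
Proof.
move=> cZ c0 Zx; apply/cZ; split.
  by have [i xi] := zclosed_nonzero cZ Zx; exists i; rewrite mulf_neq0.
by move=> p [d hp] pZ; rewrite (meval_scale _ _ hp) pZ ?mulr0.
Qed.

Lemma zclosed_separate Z x : zclosed Z -> nonzero x -> ~ Z x ->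
  exists p, [/\ is_homog p, forall s, Z s -> p.@[s] = 0 & p.@[x] != 0].
Proof.
move=> cZ nx nZx; apply: NNPP => H; apply: nZx; apply/cZ; split=> // p hp pZ.
by apply/eqP/negP => /negP px; apply: H; exists p.
Qed.

Lemma zclosedI A B : zclosed A -> zclosed B -> zclosed (fun x => A x /\ B x).
Proof.
move=> cA cB x; split=> [[nx H]|[Ax Bx]].
  by split; [apply/cA | apply/cB]; split=> // p hp pA; apply: H => // s [? ?]; exact: pA.
by apply: zclosure_sub => //; exact: zclosed_nonzero Ax.
Qed.

Lemma zclosedV p : is_homog p -> zclosed (V p).
Proof.
move=> hp x; split=> [[nx H]|[nx px]]; last exact: zclosure_sub.
by split=> //; apply: H => // s [].
Qed.

Lemma irreducible_prime Z p q : zclosed Z -> pirreducible Z -> is_homog p -> is_homog q ->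
  (forall x, Z x -> (p * q).@[x] = 0) ->
  (forall x, Z x -> p.@[x] = 0) \/ (forall x, Z x -> q.@[x] = 0).
Proof.
move=> cZ [_ irr] hp hq H.
have sub : psubset Z (fun x => V p x \/ V q x).
  move=> x Zx; have nx := zclosed_nonzero cZ Zx.
  by have /eqP := H x Zx; rewrite mevalM mulf_eq0 => /orP[] /eqP ?; [left|right].
by have [s|s] := irr _ _ (zclosedV hp) (zclosedV hq) sub; [left|right] => x /s[].
Qed.

(** Vanishing is required of every graded component, so the ideal is homogeneous even when [Z] is
    not stable under scaling. *)
Definition videal Z p : Prop := forall d x, Z x -> (pihomog mdeg d p).@[x] = 0.

Lemma videalP Z p x : videal Z p -> Z x -> p.@[x] = 0.
Proof. by move=> H Zx; rewrite (sum_pihomog p) raddf_sum big1 // => d _; exact: H. Qed.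

Lemma homog_videal Z d p : p \is d.-homog -> (forall x, Z x -> p.@[x] = 0) -> videal Z p.
Proof.
move=> hp H e x Zx; case: (eqVneq e d) => [->|ne]; first by rewrite pihomog_dE ?H.
by rewrite (@pihomog_ne0 _ _ mdeg d) ?meval0 // eq_sym.
Qed.

Lemma videal_hideal Z : hideal (videal Z).
Proof.
split; last first.
  move=> d p H; apply: homog_videal (pihomogP _ _ _) _ => x; exact: H.
split.
- by move=> d x _; rewrite pihomog0 meval0.
- by move=> p q Ip Iq d x Zx; rewrite pihomogD mevalD Ip // Iq // addr0.
- move=> a p Ip d x Zx; rewrite (sum_pihomog p) mulr_sumr [pihomog _ _ _]linear_sum.
  rewrite raddf_sum big1 // => e _ /=.
  rewrite (pihomogMr _ _ (pihomogP _ _ _)); case: ifP => _; last by rewrite meval0.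
  by rewrite mevalM Ip // mulr0.
Qed.

(** Vanishing ideals reverse inclusions, so a maximal ideal from [ideal_max] belongs to a minimal
    closed set. *)
Lemma zclosed_minimal (Q : pset K N -> Prop) : (exists Z, zclosed Z /\ Q Z) ->
  exists Z, [/\ zclosed Z, Q Z & forall Z', zclosed Z' -> Q Z' -> psubset Z' Z -> psubset Z Z'].
Proof.
case=> Z0 [cZ0 QZ0].
have [|I [[Z [cZ QZ IZ]] maxI]] := @ideal_max K N
   (fun I => exists Z, [/\ zclosed Z, Q Z & forall p, I p <-> videal Z p]) _
   (ex_intro _ (videal Z0) (ex_intro _ Z0 (And3 cZ0 QZ0 (fun p => iff_refl _)))).
  move=> I [Z [_ _ H]]; have [[v0 vD vM] _] := videal_hideal Z.
  split; first exact/H.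
  - by move=> p q /H Ip /H Iq; apply/H; exact: vD.
  - by move=> a p /H Ip; apply/H; exact: vM.
exists Z; split=> // Z' cZ' QZ' sZ x Zx.
apply/cZ'; split; first exact: zclosed_nonzero Zx.
move=> p [d hp] pZ'; apply: (@videalP Z) => //; apply/IZ.
apply: (maxI (videal Z')); first by exists Z'.
  by move=> q /IZ Iq e y /sZ; exact: Iq.
exact: homog_videal hp _.
Qed.

Lemma has_chain_sub X X' k : psubset X X' -> has_chain X k -> has_chain X' k.
Proof.
move=> s [Z [H1 H2]]; exists Z; split=> // i ik; have [cZ [iZ ZX]] := H1 i ik.
by split=> //; split=> // x /ZX/s.
Qed.

Lemma has_chain_leq X j k : (j <= k)%N -> has_chain X k -> has_chain X j.
Proof.
move=> jk [Z [H1 H2]]; exists Z; split=> i ij.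
  by apply: H1; exact: leq_trans jk.
by apply: H2; exact: leq_trans jk.
Qed.

Lemma has_chain_extend X A B k : zclosed B -> pirreducible B -> psubset B X ->
  has_chain A k -> psubset A B -> (exists x, B x /\ ~ A x) -> has_chain X k.+1.
Proof.
move=> cB iB BX [Z [H1 H2]] AB [x [Bx nAx]].
exists (fun i => if (i <= k)%N then Z i else B); split=> i ik.
  case: leqP => ik'; last by [].
  by have [cZ [iZ ZA]] := H1 i ik'; split=> //; split=> // y /ZA/AB/BX.
have -> : (i <= k)%N by [].
case: (leqP i.+1 k) => ik'; first exact: H2.
have Ei : i = k by apply/eqP; rewrite eqn_leq -ltnS ik.
rewrite {}Ei; have [_ [_ ZA]] := H1 k (leqnn k); split; first by move=> y /ZA/AB.
by exists x; split=> // /ZA.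
Qed.

Lemma has_dim_uniq X j k : has_dim X j -> has_dim X k -> j = k.
Proof.
move=> [cj nj] [ck nk]; apply/eqP; rewrite eqn_leq.
apply/andP; split; rewrite leqNgt; apply/negP => lt; [apply: nk|apply: nj];
  exact: has_chain_leq lt _.
Qed.

Lemma has_dim_ext X X' k : (forall x, X x <-> X' x) -> has_dim X k -> has_dim X' k.
Proof.
move=> E [c n]; split; first by apply: has_chain_sub c => x /E.
by move=> c'; apply: n; apply: has_chain_sub c' => x /E.
Qed.

End ClosedSets.

(** * Linear forms without common zero on a closed set *)

Section ChainsFromForms.
Variables (K : closedFieldType) (N : nat).
Local Notation R := {mpoly K[N]}.
Implicit Types (p q : R) (Z A B X : pset K N).

Definition linear_forms k (l : 'I_k -> R) : Prop := forall j, l j \is 1.-homog.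

Definition avoids X k (l : 'I_k -> R) : Prop :=
  linear_forms l /\ forall x, X x -> exists j, (l j).@[x] != 0.

(** With its converse [full_avoids], this turns a geometric condition into one on a single graded
    piece, where perturbation is a matter of determinants. *)
Lemma avoids_full Z k (l : 'I_k -> R) : zclosed Z -> avoids Z l ->
  exists m, full m (gen (videal Z) l).
Proof.
move=> cZ [hl H]; apply: NNPP => nf.
have [|x [nx x0]] := projective_nullstellensatz (gen_hideal hl (videal_hideal Z)).
  by move=> m fm; apply: nf; exists m.
have Zx : Z x.
  apply/cZ; split=> // p [d hp] pZ; apply: x0; apply: gen_sub; exact: homog_videal hp _.
have [j] := H x Zx; rewrite x0 ?eqxx //; apply: gen_mem; exact: (videal_hideal Z).1.
Qed.

Lemma full_avoids Z k (l : 'I_k -> R) m : zclosed Z -> linear_forms l ->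
  full m (gen (videal Z) l) -> avoids Z l.
Proof.
move=> cZ hl fm; split=> // x Zx; apply: NNPP => H.
have [i xi] := zclosed_nonzero cZ Zx.
have [|q [r [Iq E]]] := fm ('X_i ^+ m).
  by rewrite -[m in m.-homog]mul1n; apply: dhomogMn; exact: homogXi.
have : ('X_i ^+ m).@[x] = 0.
  rewrite E mevalD (videalP Iq Zx) add0r raddf_sum big1 // => j _ /=.
  rewrite mevalM; case: (eqVneq (l j).@[x] 0) => [->|nz]; first by rewrite mulr0.
  by case: H; exists j.
by rewrite rmorphXn /= mevalXU => /eqP; rewrite expf_eq0 (negbTE xi) andbF.
Qed.

(* For a spanning family s of the forms of degree m+1 written in terms of l, the perturbed ideal
   contains the entries of (1 + t M) s, so P is det (1 + t M). *)
Lemma full_perturb (I : R -> Prop) k (l l' : 'I_k -> R) m : hideal I ->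
  linear_forms l -> linear_forms l' -> full m.+1 (gen I l) ->
  exists P : {poly K}, P != 0 /\ forall t, P.[t] != 0 ->
    full m.+1 (gen I (fun j => l j + t *: (l' j - l j))).
Proof.
move=> hI hl hl' fl; have iI := hI.1.
have [D [s [hs spans]]] := @homog_span K N m.+1.
have /choice_fun[M0 M0P] i : exists M0 : 'I_D -> K, exists q r,
    [/\ I q, s i = q + \sum_j r j * l j & \sum_j r j * (l' j - l j) = \sum_j M0 j *: s j].
  have := hs i; rewrite -addn1 => hsi.
  have [q [r [Iq hr E]]] := gen_homog_part hl hI hsi (fl _ (hs i)).
  have [|c Ec] := spans (\sum_j r j * (l' j - l j)).
    by apply: rpred_sum => j _; rewrite -addn1; apply: dhomogM => //; apply: rpredB; [exact: hl'|exact: hl].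
  by exists c, q, r.
pose M := \matrix_(i, j) M0 i j.
pose P := \det (1%:M + 'X *: map_mx polyC M).
have PE t : P.[t] = \det (1%:M + t *: M).
  rewrite -horner_evalE -det_map_mx; congr (\det _).
  apply/matrixP => i j; rewrite !mxE /= !horner_evalE hornerD hornerM hornerX hornerC.
  by case: eqP => _; rewrite ?hornerC // horner0.
exists P; split.
  apply/eqP => P0; have := PE 0; rewrite P0 horner0 scale0r addr0 det1.
  by move/esym/eqP; rewrite oner_eq0.
move=> t; rewrite PE => dt; set lt := fun j => _.
have iG : ideal (gen I lt) by exact: gen_ideal.
pose T := 1%:M + t *: M.
have row_mem i : gen I lt (\sum_j T i j *: s j).
  have [q [r [Iq Es Er]]] := M0P i.
  have -> : \sum_j T i j *: s j = q + \sum_j r j * lt j.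
    transitivity (s i + t *: \sum_j M0 i j *: s j).
      under eq_bigr => j _ do rewrite !mxE scalerDl.
      rewrite big_split /= scaler_sumr; congr (_ + _).
        rewrite (bigD1 i) //= eqxx scale1r big1 ?addr0 // => j.
        by rewrite eq_sym => /negbTE ->; rewrite scale0r.
      by apply: eq_bigr => j _; rewrite scalerA.
    rewrite -Er {1}Es -addrA; congr (_ + _).
    rewrite scaler_sumr -big_split; apply: eq_bigr => j _ /=.
    by rewrite /lt [in RHS]mulrDr scalerAr.
  by exists q, r.
move=> p /spans[c ->]; apply: ideal_sum => // i _; apply: idealZ => //.
(* Cramer's rule: once the determinant is non-zero, the adjugate recovers each [s i] from the rows
   of [T] applied to [s]. *)
have -> : s i = (\det T)^-1 *: \sum_j (\adj T) i j *: \sum_k T j k *: s k.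
  have adjE k0 : \sum_j (\adj T) i j * T j k0 = \det T * (i == k0)%:R.
    have := congr1 (fun A : 'M_D => A i k0) (mul_adj_mx T).
    by rewrite !mxE mulr_natr.
  under eq_bigr => j _ do rewrite scaler_sumr.
  rewrite exchange_big /=.
  under eq_bigr => k0 _.
    under eq_bigr => j _ do rewrite scalerA.
    rewrite -scaler_suml adjE; over.
  rewrite (bigD1 i) //= eqxx mulr1 big1 ?addr0; last first.
    by move=> j; rewrite eq_sym => /negbTE ->; rewrite mulr0 scale0r.
  by rewrite scalerA mulVf // scale1r.
apply: idealZ => //; apply: ideal_sum => // j _; apply: idealZ => //; exact: row_mem.
Qed.

(** On the pencil joining [lA] to [lB], all but finitely many members avoid [A], and likewise for
    [B]. The polynomial for [B] is taken from the other end of the pencil, hence its parameter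
    [1 - t]. *)
Lemma common_avoids A B k (lA lB : 'I_k -> R) : zclosed A -> zclosed B ->
  avoids A lA -> avoids B lB -> exists l : 'I_k -> R, avoids A l /\ avoids B l.
Proof.
move=> cA cB aA aB; have [hA _] := aA; have [hB _] := aB.
have iA := videal_hideal A; have iB := videal_hideal B.
have [mA /(full_leq (gen_ideal _ iA.1) (leqnSn _)) fA] := avoids_full cA aA.
have [mB /(full_leq (gen_ideal _ iB.1) (leqnSn _)) fB] := avoids_full cB aB.
have [P [P0 HP]] := full_perturb iA hA hB fA.
have [Q [Q0 HQ]] := full_perturb iB hB hA fB.
have /closed_nonrootP[t] : P * (Q \Po (1 - 'X)) != 0.
  rewrite mulf_neq0 // -size_poly_eq0 size_comp_poly2 ?size_poly_eq0 //.
  by rewrite -opprB size_polyN -polyC1 size_XsubC.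
rewrite rootE hornerM mulf_eq0 negb_or horner_comp !hornerE => /andP[Pt Qt].
pose l j := lA j + t *: (lB j - lA j).
have hl : linear_forms l.
  move=> j; apply: rpredD; first exact: hA.
  by apply: rpredZ; apply: rpredB; [exact: hB | exact: hA].
exists l; split; first exact: full_avoids cA hl (HP t Pt).
apply: (full_avoids cB hl); have := HQ _ Qt.
congr (full _ (gen _ _)); apply: functional_extensionality => j.
by rewrite /l scalerBl scale1r addrA [_ + (_ - _)]addrC subrK -scalerN opprB.
Qed.
End ChainsFromForms.

(** * Dimension by linear sections *)


Section LowerBound.
Variables (K : closedFieldType) (N : nat).
Local Notation R := {mpoly K[N]}.
Implicit Types (Z A B X : pset K N).

(** For closed [X] this expresses dimension at least [k]; for [k = 0] it is non-emptiness. *)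
Definition meets_codim k X : Prop := forall l : 'I_k -> R, linear_forms l ->
  exists x, X x /\ forall j, (l j).@[x] = 0.

Lemma meets_codimPn k X : ~ meets_codim k X -> exists l : 'I_k -> R, avoids X l.
Proof.
move=> H; apply: NNPP => nl; apply: H => l hl; apply: NNPP => nx; apply: nl.
exists l; split=> // x Xx; apply: NNPP => nj; apply: nx; exists x; split=> // j.
by apply/eqP/negP => /negP lx; apply: nj; exists j.
Qed.

Lemma minimal_irreducible k Z : zclosed Z -> meets_codim k Z ->
  (forall Z', zclosed Z' -> meets_codim k Z' -> psubset Z' Z -> psubset Z Z') ->
  pirreducible Z.
Proof.
move=> cZ mZ minZ; split.
  have [|x [Zx _]] := mZ (fun=> 0); last by exists x.
  by move=> j; exact: dhomog0.
move=> A B cA cB ZAB; apply: NNPP => nAB.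
have cut C : zclosed C -> ~ psubset Z C ->
    exists l : 'I_k -> R, avoids (fun x => Z x /\ C x) l.
  move=> cC nC; apply: meets_codimPn => mC; apply: nC => x Zx.
  by have [] := minZ _ (zclosedI cZ cC) mC (fun _ H => H.1) x Zx.
have [|lA aA] := cut A cA; first by move=> ?; apply: nAB; left.
have [|lB aB] := cut B cB; first by move=> ?; apply: nAB; right.
have [l [[hl lA0] [_ lB0]]] := common_avoids (zclosedI cZ cA) (zclosedI cZ cB) aA aB.
have [x [Zx lx]] := mZ l hl.
have [Ax|Bx] := ZAB x Zx.
- by have [j] := lA0 x (conj Zx Ax); rewrite lx eqxx.
- by have [j] := lB0 x (conj Zx Bx); rewrite lx eqxx.
Qed.

Theorem has_chain_of_meets k X : zclosed X -> meets_codim k X -> has_chain X k.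
Proof.
elim: k X => [|k IH] X cX mX.
  have [|Z [cZ [ZX mZ] minZ]] := @zclosed_minimal K N
     (fun Z => psubset Z X /\ meets_codim 0 Z); first by exists X; split=> //; split.
  exists (fun=> Z); split=> // i _; split=> //; split=> //.
  apply: (minimal_irreducible cZ mZ) => Z' cZ' mZ' ZZ'.
  by apply: minZ => //; split=> // x /ZZ'/ZX.
have [|Z [cZ [ZX mZ] minZ]] := @zclosed_minimal K N
     (fun Z => psubset Z X /\ meets_codim k.+1 Z); first by exists X; split=> //; split.
have irrZ : pirreducible Z.
  apply: (minimal_irreducible cZ mZ) => Z' cZ' mZ' ZZ'.
  by apply: minZ => //; split=> // x /ZZ'/ZX.
(* A coordinate that is non-zero at some point of [Z] cuts a proper section. Added to any [k] forms
   it still has a common zero with them on [Z], so the section meets every [k] forms. *)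
have [[x0 Zx0] _] := irrZ; have [i xi] := zclosed_nonzero cZ Zx0.
have hXi : is_homog ('X_i : R) by exists 1%N; exact: homogXi.
apply: (@has_chain_extend K N X (fun x => Z x /\ V 'X_i x) Z k cZ irrZ ZX).
- apply: IH; first exact: zclosedI cZ (zclosedV hXi).
  move=> l hl; pose l' (j : 'I_k.+1) := if unlift ord0 j is Some j' then l j' else 'X_i.
  have [|x [Zx lx]] := mZ l'.
    by move=> j; rewrite /l'; case: unliftP => [j' _|_]; [exact: hl | exact: homogXi].
  exists x; split; last by move=> j; have := lx (lift ord0 j); rewrite /l' liftK.
  split=> //; split; first exact: zclosed_nonzero Zx.
  by have := lx ord0; rewrite /l' unlift_none.
- by move=> x [].
- by exists x0; split=> // -[_ [_]]; rewrite mevalXU; apply/eqP.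
Qed.

End LowerBound.

(** * Upper bound on chains: growth of spaces of forms *)

Section UpperBound.
Variables (K : fieldType) (N : nat).
Local Notation R := {mpoly K[N]}.
Implicit Types (Z A B X : pset K N) (I : R -> Prop).

(** [independent_on] bounds the Hilbert function of [Z] from below and [spanned_mod] that of the
    quotient by [I] from above; stating them with families avoids quotient spaces. *)
Definition independent_on Z m c : Prop := exists b : 'I_c -> R,
  (forall i, b i \is m.-homog) /\
  forall a : 'I_c -> K, (forall x, Z x -> (\sum_i a i *: b i).@[x] = 0) -> forall i, a i = 0.

Definition spanned_mod I m c : Prop := exists b : 'I_c -> R,
  forall p, p \is m.-homog -> exists a : 'I_c -> K, I (p - \sum_i a i *: b i).

Lemma independent_leq Z m c c' : (c' <= c)%N -> independent_on Z m c -> independent_on Z m c'.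
Proof.
move=> le [b [hb ib]]; exists (fun i => b (widen_ord le i)); split=> // a Ha i.
pose a' (j : 'I_c) := if insub (val j) is Some i then a i else 0.
have a'E j : a' (widen_ord le j) = a j by rewrite /a' /= valK.
rewrite -a'E; apply: ib => x Zx; rewrite -(Ha x Zx); congr _.@[_].
rewrite (bigID (fun j : 'I_c => (j < c')%N)) /= [X in _ + X]big1 ?addr0; last first.
  by move=> j nj; rewrite /a' insubN ?scale0r.
rewrite (big_ord_narrow le); apply: eq_bigr => j _; by rewrite a'E.
Qed.

Lemma independent_one Z m : zclosed Z -> (exists x, Z x) -> independent_on Z m 1.
Proof.
move=> cZ [x Zx]; have [i xi] := zclosed_nonzero cZ Zx.
exists (fun=> 'X_i ^+ m); split=> [_|a /(_ x Zx)].
  by rewrite -[m in m.-homog]mul1n; apply: dhomogMn; exact: homogXi.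
rewrite big_ord1 mevalZ rmorphXn /= mevalXU => /eqP; rewrite mulf_eq0 expf_eq0.
by rewrite (negbTE xi) andbF orbF => /eqP E j; rewrite ord1.
Qed.

(* Multiplication by F embeds the functions on B into those vanishing on A. *)
Lemma independent_step A B (F : R) f m c c' : zclosed B -> pirreducible B -> psubset A B ->
  F \is f.-homog -> (forall x, A x -> F.@[x] = 0) -> (exists x, B x /\ F.@[x] != 0) ->
  independent_on A (m + f) c -> independent_on B m c' -> independent_on B (m + f) (c + c').
Proof.
move=> cB irrB AB hF FA [y [By Fy]] [b [hb ib]] [b' [hb' ib']].
exists (fun i => match split i with inl j => b j | inr j => b' j * F end); split.
  by move=> i; case: (split i) => j; [exact: hb | apply: dhomogM].
move=> a Ha.
have sumE : \sum_i a i *: match split i with inl j => b j | inr j => b' j * F end =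
    \sum_j a (lshift _ j) *: b j + (\sum_j a (rshift _ j) *: b' j) * F.
  rewrite big_split_ord /= mulr_suml; congr (_ + _); apply: eq_bigr => j _.
    by rewrite (unsplitK (inl j)).
  by rewrite (unsplitK (inr j)) scalerAl.
have a0 j : a (lshift _ j) = 0.
  apply: (ib (fun j => a (lshift _ j))) => x Ax.
  have := Ha x (AB x Ax); rewrite sumE mevalD mevalM FA // mulr0 addr0.
  exact.
have Q0 x : B x -> (\sum_j a (rshift _ j) *: b' j).@[x] = 0.
  have hQ : is_homog (\sum_j a (rshift c j) *: b' j).
    by exists m; apply: rpred_sum => j _; apply: rpredZ; exact: hb'.
  have hF' : is_homog F by exists f.
  have [z Bz||H] := irreducible_prime cB irrB hQ hF'; last by rewrite H ?eqxx in Fy.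
    have := Ha z Bz; rewrite sumE big1 ?add0r // => j _.
    by rewrite a0 scale0r.
  exact.
move=> i; rewrite -(splitK i); case: (split i) => j /=; first exact: a0.
exact: (ib' (fun j => a (rshift _ j)) Q0).
Qed.

(** Each link of the chain adds the functions on the smaller set to a shifted copy of those on the
    larger one; along multiples of [e] this is Pascal's rule. *)
Lemma chain_independent X k : has_chain X k -> exists Z, [/\ zclosed Z, psubset Z X &
  exists e, (0 < e)%N /\ forall m, independent_on Z (e * m) 'C(m + k, k)].
Proof.
case=> Z [HZ HZp]; exists (Z k); have [cZ [irrZ ZX]] := HZ k (leqnn k).
split=> //; clear cZ irrZ ZX.
elim: k => [|k IH] in HZ HZp *.
  have [cZ [[nZ _] _]] := HZ 0%N (leqnn _).
  by exists 1%N; split=> // m; rewrite bin0; exact: independent_one.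
have [||e [e0 indA]] := IH.
  by move=> i ik; apply: HZ; exact: leqW.
  by move=> i ik; apply: HZp; exact: leqW.
have [cA [irrA _]] := HZ k (leqnSn _).
have [cB [irrB _]] := HZ k.+1 (leqnn _).
have [AB [x [Bx nAx]]] := HZp k (leqnn _).
have nx := zclosed_nonzero cB Bx; have [i xi] := nx.
have [p [[d hp] pA px]] := zclosed_separate cA nx nAx.
(* The factor ['X_i] makes the degree positive without killing the form at [x]. The power [e] makes
   the degree of [F] a multiple of [e], the only degrees in which the bound on the smaller set is
   known. *)
pose f := d.+1; pose F := (p * 'X_i) ^+ e.
have hF : F \is (f * e).-homog.
  by apply: dhomogMn; rewrite /f -addn1; apply: dhomogM => //; exact: homogXi.
have FA y : Z k y -> F.@[y] = 0.
  by move=> Ay; rewrite rmorphXn /= mevalM pA // mul0r expr0n -leqn0 leqNgt e0.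
have Fx : F.@[x] != 0.
  by rewrite rmorphXn /= expf_neq0 // mevalM mevalXU mulf_neq0.
exists (f * e)%N; split; first by rewrite muln_gt0.
elim=> [|m IHm]; first by rewrite muln0 add0n binn; apply: independent_one => //; exists x.
have -> : 'C(m.+1 + k.+1, k.+1) = ('C(m.+1 + k, k) + 'C(m + k.+1, k.+1))%N.
  by rewrite [in LHS]addSn binS addnC addSnnS.
rewrite mulnSr.
apply: independent_step hF FA _ _ IHm => //; first by exists x.
have -> : (f * e * m + f * e = e * (m.+1 * f))%N by rewrite -mulnSr [in LHS](mulnC f) -mulnA (mulnC f).
apply: independent_leq (indA _); apply: leq_bin2l.
by rewrite leq_add2r leq_pmulr.
Qed.

(** With [c] larger than [c'], the matrix of coordinates has a left kernel vector, which is a linear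
    relation between the [b i] on [Z]. *)
Lemma independent_leq_spanned Z m c c' :
  independent_on Z m c -> spanned_mod (videal Z) m c' -> (c <= c')%N.
Proof.
move=> [b [hb ib]] [s sP]; rewrite leqNgt; apply/negP => lt.
have /choice_fun[M0 M0P] i := sP _ (hb i).
pose M := \matrix_(i, j) M0 i j : 'M[K]_(c, c').
have : (\rank (kermx M) != 0)%N.
  by rewrite mxrank_ker -lt0n subn_gt0; exact: leq_ltn_trans (rank_leq_col M) lt.
rewrite mxrank_eq0 => /rowV0Pn[v]; rewrite sub_kermx => /eqP vM0 v0.
case/negP: v0; apply/eqP/rowP => i; rewrite mxE; apply: (ib (fun i => v 0 i)) => x Zx.
have -> : \sum_i v 0 i *: b i = \sum_i v 0 i *: (b i - \sum_j M0 i j *: s j).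
  under [RHS]eq_bigr => j _ do rewrite scalerBr scaler_sumr.
  rewrite sumrB [X in _ - X]exchange_big /= [X in _ - X]big1 ?subr0 // => j _.
  have := congr1 (fun A : 'rV_c' => A 0 j) vM0; rewrite !mxE => E.
  under eq_bigr => i0 _ do rewrite scalerA.
  rewrite -scaler_suml (_ : \sum_i0 _ = 0) ?scale0r // -[RHS]E.
  by apply: eq_bigr => i0 _; rewrite mxE.
rewrite raddf_sum big1 // => j _ /=; rewrite mevalZ.
by rewrite (videalP (M0P j) Zx) mulr0.
Qed.

Lemma spanned_zero_ideal I m : ideal I -> exists c, spanned_mod I m c.
Proof.
move=> iI; have [D [s [_ sP]]] := @homog_span K N m; exists D, s => p /sP[c ->].
by exists c; rewrite subrr; exact: ideal0.
Qed.

Lemma pihomog_comb d c (a : 'I_c -> K) (b : 'I_c -> R) :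
  pihomog mdeg d (\sum_i a i *: b i) = \sum_i a i *: pihomog mdeg d (b i).
Proof. by rewrite linear_sum; apply: eq_bigr => i _; rewrite linearZ. Qed.

(** A form of degree [m] is a combination modulo [l] plus [l] times a form of degree [m - 1];
    unrolling this sums the bounds over all degrees up to [m]. *)
Lemma spanned_adjoin I (l : R) (c : nat -> nat) : hideal I -> l \is 1.-homog ->
  (forall m, spanned_mod (adjoin I l) m (c m)) ->
  forall m, spanned_mod I m (\sum_(j < m.+1) c j).
Proof.
move=> [iI hI] hl H; elim=> [|m [b' IH]].
  rewrite big_ord1; have [b bP] := H 0%N; exists (fun i => pihomog mdeg 0 (b i)) => p hp.
  have [a [q [r [Iq E]]]] := bP p hp; exists a.
  have := congr1 (pihomog mdeg 0) E; rewrite pihomogB pihomog_dE // pihomogD (pihomogMr _ _ hl) /= addr0.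
  by rewrite pihomog_comb => ->; exact: hI.
rewrite big_ord_recr /=; have [b bP] := H m.+1.
exists (fun i => match split i with inl j => b' j * l | inr j => pihomog mdeg m.+1 (b j) end).
move=> p hp; have [a [q [r [Iq E]]]] := bP p hp.
have [a' Ha'] := IH _ (pihomogP mdeg m r).
exists (fun i => match split i with inl j => a' j | inr j => a j end).
rewrite big_split_ord /=.
under eq_bigr => i _ do rewrite (unsplitK (inl i)).
under [X in _ - (_ + X)]eq_bigr => i _ do rewrite (unsplitK (inr i)).
have := congr1 (pihomog mdeg m.+1) E.
rewrite pihomogB pihomog_dE // pihomogD (pihomogMr _ _ hl) /= subn1 pihomog_comb.
move/eqP; rewrite subr_eq => /eqP ->.
rewrite opprD addrA [_ + - (\sum_i a' i *: _)]addrAC addrK -addrA.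
apply: idealD => //; first exact: hI.
under eq_bigr => i _ do rewrite scalerAl.
by rewrite -mulr_suml -mulrBl; exact: ideal_mulr.
Qed.

Lemma leq_exp2r_weak a b k : (a <= b)%N -> (a ^ k <= b ^ k)%N.
Proof. by move=> ab; elim: k => // k IH; rewrite !expnS leq_mul. Qed.

(** Bounding partial sums rather than values makes [k = 0] the case of finite total dimension, and
    each further form raises the exponent by one. *)
Definition growth_at_most I k : Prop := exists c : nat -> nat,
  (forall m, spanned_mod I m (c m)) /\
  exists C, forall m, (\sum_(j < m.+1) c j <= C * m.+1 ^ k)%N.

(** Each form peeled off by [gen_recl] costs one summation, hence one power of [m]. With no form
    left, [I] is full from degree [m0] on, and only finitely many degrees contribute. *)
Lemma growth_of_full k I (l : 'I_k -> R) m0 : hideal I -> (forall j, l j \is 1.-homog) ->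
  full m0 (gen I l) -> growth_at_most I k.
Proof.
elim: k I l => [|k IH] I l hI hl fl.
  have iI := hI.1.
  have fI m : (m0 <= m)%N -> full m I.
    move=> le; apply: full_leq le _ => // p /fl[q [r [Iq ->]]].
    by rewrite big_ord0 addr0.
  have /choice_fun[c0 c0P] m := spanned_zero_ideal m iI.
  exists (fun m => if (m < m0)%N then c0 m else 0%N); split.
    move=> m; case: ltnP => // le; exists (fun=> 0) => p /(fI m le) Ip.
    by exists (fun=> 0); rewrite big_ord0 subr0.
  exists (\sum_(j < m0) c0 j)%N => m; rewrite expn0 muln1.
  rewrite -big_mkcond /=; apply: leq_trans (_ : (\sum_(j < m.+1 + m0 | j < m0) c0 j <= _)%N).
    rewrite [leqRHS]big_mkcond big_split_ord /= big_mkcond /=; exact: leq_addr.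
  by rewrite (big_ord_narrow (leq_addl _ _)).
have hI' : hideal (adjoin I (l ord0)) by apply: adjoin_hideal.
have [||c [cP [C CP]]] := IH _ (fun j : 'I_k => l (lift ord0 j)) hI'.
- by move=> j; exact: hl.
- by move=> p /fl/gen_recl.
exists (fun m => \sum_(j < m.+1) c j)%N; split.
  exact: spanned_adjoin.
exists C => m; apply: leq_trans (_ : \sum_(j < m.+1) C * m.+1 ^ k <= _)%N.
  apply: leq_sum => j _; apply: leq_trans (CP j) _.
  by rewrite leq_mul2l leq_exp2r_weak ?orbT // ltn_ord.
by rewrite sum_nat_const card_ord expnS mulnCA.
Qed.

End UpperBound.

Lemma sum_subseq_leq (c : nat -> nat) e m : (0 < e)%N ->
  (\sum_(i < m.+1) c (e * i) <= \sum_(j < (e * m).+1) c j)%N.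
Proof.
move=> e0; elim: m => [|m IH]; first by rewrite muln0 !big_ord1 /= muln0.
rewrite [leqLHS]big_ord_recr [leqRHS]big_ord_recr /= leq_add2r; apply: leq_trans IH _.
rewrite -!(big_mkord xpredT) [leqRHS](@big_cat_nat _ _ _ (e * m).+1) ?leq_addr //=.
by rewrite mulnSr -addn1 leq_add2l.
Qed.

Lemma bin_ge_exp m k : (m.+1 ^ k <= k`! * 'C(m + k, k))%N.
Proof.
rewrite mulnC bin_ffact; elim: k => [|k IH]; first by rewrite ffactn0.
by rewrite addnS ffactSS expnS; apply: leq_mul => //; rewrite ltnS leq_addr.
Qed.

(** Summing the lower bounds over the multiples of [e] gives, by the hockey-stick identity, a
    binomial of degree [k.+1] in [m], which outgrows the upper bound. *)
Lemma polynomial_growth_contra (c : nat -> nat) e C k : (0 < e)%N ->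
  (forall m, 'C(m + k, k) <= c (e * m))%N ->
  (forall m, \sum_(j < m.+1) c j <= C * m.+1 ^ k)%N -> False.
Proof.
move=> e0 lo up.
have lo' m : ('C(m + k.+1, k.+1) <= \sum_(j < (e * m).+1) c j)%N.
  apply: leq_trans (sum_subseq_leq _ _ e0).
  elim: m => [|m IH]; first by rewrite big_ord1 binn; apply: leq_trans (lo 0%N); rewrite binn.
  by rewrite big_ord_recr /= addSn binS leq_add // -addSnnS.
(* At [m = B] the bounds combine to [B.+1 ^ k.+1 <= (k.+1)! * C * (e * B + 1) ^ k], and
   [e * B + 1 <= e * B.+1]; this [B] collects the constants. *)
pose B := ((k.+1)`! * C * e ^ k)%N.
suff : (B.+1 ^ k.+1 <= B * B.+1 ^ k)%N.
  by rewrite expnS leq_pmul2r ?expn_gt0 // ltnn.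
apply: leq_trans (bin_ge_exp B k.+1) _.
apply: leq_trans (leq_mul (leqnn _) (leq_trans (lo' B) (up _))) _.
rewrite /B -!mulnA !leq_mul //= -expnMn leq_exp2r_weak //.
by rewrite mulnS -addn1 addnC leq_add2r.
Qed.

Theorem no_chain_of_avoids (K : closedFieldType) N (X : pset K N) k (l : 'I_k -> {mpoly K[N]}) :
  zclosed X -> avoids X l -> ~ has_chain X k.
Proof.
move=> cX al ch; have [m0 fm] := avoids_full cX al.
have [c [cP [C CP]]] := growth_of_full (videal_hideal X) al.1 fm.
have [Z [cZ ZX [e [e0 He]]]] := chain_independent ch.
apply: (@polynomial_growth_contra c e C k) => // m.
apply: independent_leq_spanned (He m) _.
have [b bP] := cP (e * m)%N; exists b => p hp.
by have [a Ha] := bP p hp; exists a => d x /ZX; exact: Ha.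
Qed.

Lemma has_dim_exists (K : closedFieldType) N (X : pset K N) : zclosed X -> (exists x, X x) ->
  exists k, has_dim X k.
Proof.
move=> cX [x Xx].
have c0 : has_chain X 0.
  by apply: has_chain_of_meets => // l _; exists x; split=> // -[].
have nN : ~ has_chain X N.
  apply: (@no_chain_of_avoids K N X N (fun i => 'X_i)) => //; split.
    by move=> j; exact: homogXi.
  by move=> y Xy; have [i yi] := zclosed_nonzero cX Xy; exists i; rewrite mevalXU.
apply: NNPP => nd; suff H k : has_chain X k by exact: nN (H N).
elim: k => // k IH; apply: NNPP => nk.
by apply: nd; exists k.
Qed.

(** * Gauss's lemma *)


Section Factorial.
Implicit Types R S : idomainType.

Definition divides R (a b : R) : Prop := exists c, b = c * a.

Definition irreducible_elt R (a : R) : Prop := [/\ a != 0, a \isn't a GRing.unit &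
  forall b c, a = b * c -> b \is a GRing.unit \/ c \is a GRing.unit].

Definition prime_elt R (a : R) : Prop :=
  forall b c, divides a (b * c) -> divides a b \/ divides a c.

(** The additive [mu] bounds the number of irreducible factors and so gives existence of
    factorisations; irreducibles being prime gives uniqueness. *)
Definition factorial_ring R : Prop :=
  (exists mu : R -> nat,
     (forall a b, a != 0 -> b != 0 -> mu (a * b) = (mu a + mu b)%N) /\
     (forall a, a != 0 -> mu a = 0%N -> a \is a GRing.unit)) /\
  (forall a : R, irreducible_elt a -> prime_elt a).

Lemma factorial_ind R (P : R -> Prop) : factorial_ring R ->
  (forall c, c \is a GRing.unit -> P c) ->
  (forall p c, irreducible_elt p -> prime_elt p -> c != 0 -> P c -> P (p * c)) ->
  forall c, c != 0 -> P c.
Proof.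
move=> [[mu [muM mu0]] pr] Pu Pp.
have irr_div m : forall a, (mu a < m)%N -> a != 0 -> a \isn't a GRing.unit ->
    exists p c, [/\ irreducible_elt p, a = p * c & c != 0].
  elim: m => // m IH a am a0 au.
  case: (classic (irreducible_elt a)) => [ia|nia].
    by exists a, 1; rewrite mulr1 oner_eq0.
  have [b [c [E bu cu]]] : exists b c,
      [/\ a = b * c, b \isn't a GRing.unit & c \isn't a GRing.unit].
    apply: NNPP => H; apply: nia; split=> // b c E.
    case: (boolP (b \is a GRing.unit)) => [|bu]; first by left.
    case: (boolP (c \is a GRing.unit)) => [|cu]; first by right.
    by case: H; exists b, c.
  move: (a0); rewrite E mulf_eq0 negb_or => /andP[b0 c0].
  have [|p [c' [ip Eb c'0]]] := IH b _ b0 bu.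
    rewrite -ltnS; apply: leq_trans am; rewrite ltnS E muM // -[in ltnLHS](addn0 (mu b)) ltn_add2l lt0n.
    by apply/eqP => /(mu0 _ c0); apply/negP.
  by exists p, (c' * c); rewrite Eb mulrA mulf_neq0.
have H m : forall c, (mu c < m)%N -> c != 0 -> P c.
  elim: m => // m IH c cm c0.
  case: (boolP (c \is a GRing.unit)) => [|cu]; first exact: Pu.
  have [p [c' [ip E c'0]]] := irr_div _ c (ltnSn _) c0 cu.
  have [p0 pu _] := ip.
  rewrite E; apply: Pp => //; first exact: pr.
  apply: IH => //; rewrite -ltnS; apply: leq_trans cm; rewrite ltnS E muM // -[in ltnLHS](add0n (mu c')).
  rewrite ltn_add2r lt0n; apply/eqP => /(mu0 _ p0); exact/negP.
by move=> c; apply: (H (mu c).+1).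
Qed.

Lemma divides_polyC R (a : R) (p : {poly R}) :
  divides a%:P p <-> forall i, divides a p`_i.
Proof.
split=> [[c ->] i|H]; first by exists c`_i; rewrite coefMC.
have /choice_fun[c cP] i := H i; exists (\poly_(i < size p) c i).
apply/polyP => i; rewrite coefMC coef_poly; case: ltnP => [_|le]; first exact: cP.
by rewrite nth_default // mul0r.
Qed.

(** Take the first coefficients of [p] and [q], at [i] and [j], that [a] does not divide. In the
    coefficient of index [i + j] of the product, every term except their product is divisible by
    [a]. *)
Lemma prime_polyC R (a : R) : prime_elt a -> prime_elt a%:P.
Proof.
move=> pa p q /divides_polyC H.
apply: NNPP => npq.
have first_bad (r : {poly R}) : ~ divides a%:P r ->
    exists i, ~ divides a r`_i /\ forall j, (j < i)%N -> divides a r`_j.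
  move=> nr; have [|i [nri mini]] := @nat_argmin nat (fun i => ~ divides a r`_i) id.
    by apply: NNPP => nex; apply: nr; apply/divides_polyC => i; apply: NNPP => ni; apply: nex; exists i.
  exists i; split=> // j ji; apply: NNPP => nj.
  by have := mini j nj; rewrite leqNgt ji.
have [|i [npi mini]] := first_bad p; first by move=> ?; apply: npq; left.
have [|j [nqj minj]] := first_bad q; first by move=> ?; apply: npq; right.
have dsum (m : nat) (P : pred 'I_m) (F : 'I_m -> R) : (forall k, P k -> divides a (F k)) ->
    divides a (\sum_(k | P k) F k).
  move=> HF; apply: (big_ind (divides a)) => //; first by exists 0; rewrite mul0r.
  by move=> x y [c ->] [c' ->]; exists (c + c'); rewrite mulrDl.
have [c Ec] := H (i + j)%N.
have lti : (i < (i + j).+1)%N by rewrite ltnS leq_addr.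
rewrite coefM (bigD1 (Ordinal lti)) //= addKn in Ec.
have [|c' Ec'] := dsum _ (fun k => k != Ordinal lti) (fun k => p`_k * q`_(i + j - k)).
  move=> k; rewrite -val_eqE /= neq_ltn => /orP[/mini[c' ->]|ltik].
    by exists (c' * q`_(i + j - k)); rewrite mulrAC.
  have [|c' ->] := minj (i + j - k)%N; last by exists (p`_k * c'); rewrite mulrA.
  by rewrite ltn_subLR ?ltn_add2r // -ltnS.
have : divides a (p`_i * q`_j).
  by exists (c - c'); rewrite mulrBl -Ec -Ec' addrK.
by move/pa => [/npi|/nqj].
Qed.

Section GaussLemma.
Variable R : idomainType.
Hypothesis fR : factorial_ring R.
Implicit Types (p q g h s : {poly R}) (c : R).

(** Every prime factor of [c] stays prime as a constant polynomial, so it divides [q] or [h] and is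
    cancelled there; [a] and [b] collect what each factor has absorbed. *)
Lemma cancel_constant c g q h : c != 0 -> c%:P * g = q * h ->
  exists a b q1 h1, [/\ g = q1 * h1, q = a%:P * q1 & h = b%:P * h1].
Proof.
move=> c0; move: c c0 q h; apply: (factorial_ind fR) => [c cu|p c ip pp c0 IH] q h E.
  exists c, 1, (c^-1%:P * q), h; split.
  - by rewrite -mulrA -E mulrA -polyCM mulVr // mul1r.
  - by rewrite mulrA -polyCM divrr // mul1r.
  - by rewrite mul1r.
have [p0 _ _] := ip; have pP0 : p%:P != 0 by rewrite polyC_eq0.
have : divides p%:P (q * h) by exists (c%:P * g); rewrite -E polyCM; ring.
move/(prime_polyC pp) => [] [r Er].
- have [|a [b [q1 [h1 [E1 E2 E3]]]]] := IH r h.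
    by apply: (mulfI pP0); rewrite mulrA -polyCM E Er; ring.
  by exists (p * a), b, q1, h1; split=> //; rewrite Er E2 polyCM; ring.
- have [|a [b [q1 [h1 [E1 E2 E3]]]]] := IH q r.
    by apply: (mulfI pP0); rewrite mulrA -polyCM E Er; ring.
  by exists a, (p * b), q1, h1; split=> //; rewrite Er E3 polyCM; ring.
Qed.

(** Cancelling [c] splits [g] as a constant [b] times [h1]. Irreducibility makes one of them a unit,
    and it cannot be [h1], because [g] is not constant. *)
Lemma divides_cancel_constant c g s : irreducible_elt g -> (1 < size g)%N -> c != 0 ->
  divides g (c%:P * s) -> divides g s.
Proof.
move=> [g0 _ ig] sg c0 [t E].
have [a [b [q1 [h1 [E1 E2 E3]]]]] := cancel_constant c0 E.
have [bu|] := ig _ _ E3.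
  by exists (q1 * b%:P^-1); rewrite E1 E3 -mulrA mulKr.
rewrite poly_unitE => /andP[/eqP sh _]; move: sg; rewrite E3 mul_polyC.
by move/leq_trans/(_ (size_scale_leq _ _)); rewrite sh.
Qed.

(* An element of least degree in the ideal (g, p) divides constant multiples of g and p. *)
Lemma divides_or_bezout g p : irreducible_elt g -> (1 < size g)%N ->
  divides g p \/ exists u v r, r != 0 /\ u * g + v * p = r%:P.
Proof.
move=> ig sg; have [g0 _ irrg] := ig.
have [|h [[h0 [u [v Eh]]] minh]] := @nat_argmin _
    (fun h => h != 0 /\ exists u v, h = u * g + v * p) (fun h => size h).
  by exists g; split=> //; exists 1, 0; rewrite mul1r mul0r addr0.
have [sh|sh] := leqP (size h) 1.
  right; exists u, v, h`_0; rewrite -Eh -size1_polyC //; split=> //.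
  by move: h0; rewrite {1}(size1_polyC sh) polyC_eq0.
left.
have red s : (exists u v, s = u * g + v * p) ->
    exists c q, c != 0 /\ c%:P * s = q * h.
  move=> [us [vs Es]]; exists (lead_coef h ^+ scalp s h), (s %/ h).
  split; first by rewrite expf_neq0 // lead_coef_eq0.
  have E := Pdiv.Idomain.divp_eq s h.
  rewrite mul_polyC E; apply/eqP; rewrite -subr_eq0 addrAC subrr add0r; apply/negP => /negP r0.
  have := minh (s %% h); rewrite leqNgt ltn_modp h0 => /(_ _)/negP; apply=> //; split=> //.
  set k := scalp s h in E; set lc := lead_coef h in E.
  exists ((lc ^+ k)%:P * us - (s %/ h) * u), ((lc ^+ k)%:P * vs - (s %/ h) * v).
  have -> : s %% h = lc ^+ k *: s - s %/ h * h by rewrite E addrAC subrr add0r.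
  by rewrite -mul_polyC {1}Es {2}Eh; ring.
have [|c [q [c0 Eg]]] := red g; first by exists 1, 0; rewrite mul1r mul0r addr0.
have [|c' [q' [c'0 Ep]]] := red p; first by exists 0, 1; rewrite mul1r mul0r add0r.
(* After cancellation [h1] divides [g] and equals [h] up to the constant [b]. It is not constant, so
   [q1] is a unit and [g] is associate to [h1]. *)
have [a [b [q1 [h1 [E1 E2 E3]]]]] := cancel_constant c0 Eg.
have [q1u|] := irrg _ _ E1; last first.
  rewrite poly_unitE => /andP[/eqP s1 _]; move: sh; rewrite E3 mul_polyC.
  by move/leq_trans/(_ (size_scale_leq _ _)); rewrite s1.
apply: (divides_cancel_constant ig sg c'0).
exists (q' * b%:P * q1^-1); rewrite Ep E3 E1 -!mulrA; congr (_ * (_ * _)).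
by rewrite mulKr.
Qed.

(** The new length is the degree plus the length of the leading coefficient. A constant irreducible
    is prime by [prime_polyC]; for any other, if it does not divide [p], the Bezout identity
    multiplied by [q] shows that it divides [r * q], and the constant [r] cancels. *)
Lemma factorial_poly : factorial_ring {poly R}.
Proof.
have [[mu [muM mu0]] pr] := fR; split.
  exists (fun p => (size p).-1 + mu (lead_coef p))%N; split=> [p q p0 q0|p p0 /eqP].
    rewrite size_mul // lead_coefM muM ?lead_coef_eq0 //.
    rewrite -(prednK (ltac:(by rewrite size_poly_gt0) : (0 < size p)%N)).
    rewrite -(prednK (ltac:(by rewrite size_poly_gt0) : (0 < size q)%N)).
    by rewrite addSn addnS /=; lia.
  rewrite addn_eq0 => /andP[/eqP s1 /eqP lmu].
  have sp : size p = 1%N by rewrite -[size p]prednK ?s1 // size_poly_gt0.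
  have lu : lead_coef p \is a GRing.unit by apply: mu0; rewrite ?lead_coef_eq0.
  by rewrite poly_unitE sp eqxx; move: lu; rewrite lead_coefE sp.
move=> g ig; have [g0 gu irrg] := ig; have [sg|sg] := leqP (size g) 1.
  rewrite (size1_polyC sg); apply: prime_polyC; apply: pr; split.
  - by rewrite -polyC_eq0 -size1_polyC.
  - by apply: contra gu => H; rewrite (size1_polyC sg); exact: (rmorph_unit polyC H).
  - move=> b c E; have [||] := irrg b%:P c%:P; first by rewrite -polyCM -E -size1_polyC.
      by rewrite poly_unitE coefC => /andP[_]; left.
    by rewrite poly_unitE coefC => /andP[_]; right.
move=> p q [t E]; have [|[u [v [r [r0 Er]]]]] := divides_or_bezout p ig sg; first by left.
right; apply: (divides_cancel_constant ig sg r0); exists (u * q + v * t).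
by rewrite -Er [LHS]mulrDl -(mulrA v) E; ring.
Qed.
End GaussLemma.

Lemma factorial_transfer R S (phi : {rmorphism R -> S}) : bijective phi ->
  factorial_ring S -> factorial_ring R.
Proof.
move=> bphi [[mu [muM mu0]] pr]; have [psi phiK psiK] := bphi.
have iphi := can_inj phiK.
have phi0 a : (phi a == 0) = (a == 0) by rewrite -(inj_eq iphi) rmorph0.
have phiU a : (phi a \is a GRing.unit) = (a \is a GRing.unit).
  apply/idP/idP => [/unitrPr[b E]|]; last exact: rmorph_unit.
  apply/unitrPr; exists (psi b); apply: iphi.
  by rewrite rmorphM rmorph1 psiK.
have phid a b : divides (phi a) (phi b) <-> divides a b.
  split=> [[c E]|[c ->]]; last by exists (phi c); rewrite rmorphM.
  by exists (psi c); apply: iphi; rewrite rmorphM psiK.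
split.
  exists (fun a => mu (phi a)); split=> [a b a0 b0|a a0].
    by rewrite rmorphM muM ?phi0.
  by rewrite -phiU => H; apply: mu0; rewrite ?phi0.
move=> a [a0 au ia] b c /phid; rewrite rmorphM.
have iphia : irreducible_elt (phi a).
  split; rewrite ?phi0 ?phiU // => b' c' E.
  rewrite -(psiK b') -(psiK c') !phiU; apply: ia; apply: iphi.
  by rewrite rmorphM !psiK.
by move/(pr _ iphia) => [/phid|/phid]; [left|right].
Qed.
End Factorial.

(** * Singling out the last variable *)


Section LastVariable.
Variables (K : fieldType) (n : nat).
Implicit Types p q : {mpoly K[n.+1]}.

Definition init_var (i : 'I_n) : 'I_n.+1 := widen_ord (leqnSn n) i.

Definition init_mnm (m : 'X_{1..n.+1}) : 'X_{1..n} := [multinom m (init_var i) | i < n].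

Lemma init_mnm_inj (m m' : 'X_{1..n.+1}) :
  init_mnm m = init_mnm m' -> m ord_max = m' ord_max -> m = m'.
Proof.
move=> /mnmP E Em; apply/mnmP => i; case: (unliftP ord_max i) => [j ->|->] //.
have -> : lift ord_max j = init_var j by apply: val_inj; rewrite /= /bump leqNgt ltn_ord.
by have := E j; rewrite !mnmE.
Qed.

Lemma muniX (m : 'X_{1..n.+1}) :
  muni ('X_[m] : {mpoly K[n.+1]}) = 'X_[init_mnm m] *: 'X^(m ord_max).
Proof. by rewrite muniE msuppX big_seq1 mcoeffX eqxx scale1r. Qed.

Lemma coef_muni p (m : 'X_{1..n.+1}) : ((muni p)`_(m ord_max))@_(init_mnm m) = p@_m.
Proof.
elim/mpolyind: p => [|c u p _ _ IH]; first by rewrite muni0 coef0 !mcoeff0.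
rewrite muniD muniZ muniX coefD !mcoeffD IH; congr (_ + _).
rewrite !coefZ coefXn mul_mpolyC !mcoeffZ mcoeffX; congr (_ * _).
case: eqP => [Em|nEm]; last first.
  rewrite mulr0 mcoeff0; case: eqP => // Eum; case: nEm; by rewrite Eum.
rewrite mulr1 mcoeffX; congr (nat_of_bool _)%:R.
by apply/eqP/eqP => [E|->] //; apply: init_mnm_inj.
Qed.

Lemma muni_eq0 p : (muni p == 0) = (p == 0).
Proof.
apply/eqP/eqP => [E|->]; last exact: muni0.
by apply/mpolyP => m; rewrite -coef_muni E coef0 !mcoeff0.
Qed.

Lemma muni_mwiden (q : {mpoly K[n]}) : muni (mwiden q) = q%:P.
Proof.
elim/mpolyind: q => [|c m q _ _ IH]; first by rewrite mwiden0 muni0.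
rewrite mwidenD muniD IH mwidenZ muniZ mwidenX muniX mnmwiden_ordmax expr0 polyCD.
congr (_ + _); rewrite (_ : init_mnm (mnmwiden m) = m).
  by rewrite alg_polyC -mul_polyC -polyCM mul_mpolyC.
by apply/mnmP => i; rewrite mnmE mnmwiden_widen.
Qed.

Lemma muni_mmulti (q : {poly {mpoly K[n]}}) : muni (mmulti q) = q.
Proof.
have muniXmax : muni ('X_ord_max : {mpoly K[n.+1]}) = 'X.
  rewrite muniX mnm1E eqxx expr1 (_ : init_mnm _ = 0%MM) ?mpolyX0 ?scale1r //.
  by apply/mnmP => i; rewrite mnmE mnm1E mnm0E -val_eqE /= gtn_eqF.
rewrite /mmulti raddf_sum -[RHS]coefK poly_def; apply: eq_bigr => i _ /=.
by rewrite muniM rmorphXn /= muniXmax muni_mwiden mul_polyC.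
Qed.

Lemma muni_bij : bijective (@muni n K).
Proof.
exists (@mmulti n K); last exact: muni_mmulti.
by move=> p; apply/eqP; rewrite -subr_eq0 -muni_eq0 muniB muni_mmulti subrr.
Qed.

Lemma meval_muni p (x : 'I_n.+1 -> K) :
  p.@[x] = (map_poly (meval (x \o init_var)) (muni p)).[x ord_max].
Proof.
elim/mpolyind: p => [|c m p _ _ IH]; first by rewrite muni0 [map_poly _ 0]rmorph0 horner0 meval0.
rewrite mevalD IH muniD rmorphD hornerD muniZ muniX; congr (_ + _).
rewrite -!mul_polyC !rmorphM /= !map_polyC /= map_polyXn !hornerM !hornerC hornerXn.
rewrite mevalZ mevalC; congr (_ * _); rewrite !mevalX big_ord_recr; congr (_ * _).
by apply: eq_bigr => i _; rewrite mnmE.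
Qed.
End LastVariable.

Lemma factorial_mpoly (K : fieldType) n : factorial_ring {mpoly K[n]}.
Proof.
elim: n => [|n IH].
  have unit0 (a : {mpoly K[0]}) : a != 0 -> a \is a GRing.unit.
    rewrite (nvar0_mpolyC a) mpolyC_eq0 => a0; apply/unitrPr.
    by exists (a@_0)^-1%:MP; rewrite -mpolyCM divff.
  split; last by move=> a [/unit0 ->].
  by exists (fun=> 0%N); split=> // a /unit0.
exact: factorial_transfer (@muni_bij K n) (factorial_poly IH).
Qed.

(** The first variables are chosen to keep the leading coefficient in the last one non-zero; the
    last variable then has only finitely many bad values. *)
Lemma mpoly_nonvanishing (K : closedFieldType) n (p : {mpoly K[n]}) : p != 0 ->
  exists x, p.@[x] != 0.
Proof.
elim: n p => [|n IH] p p0.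
  exists (fun=> 0); move: p0; rewrite (nvar0_mpolyC p) mevalC.
  by apply: contra => /eqP ->; rewrite mpolyC0.
have [|x x0] := IH (lead_coef (muni p)); first by rewrite lead_coef_eq0 muni_eq0.
have : map_poly (meval x) (muni p) != 0.
  by rewrite -lead_coef_eq0 lead_coef_map_eq.
case/closed_nonrootP => t nt.
pose y (i : 'I_n.+1) := if unlift ord_max i is Some j then x j else t.
exists y; rewrite meval_muni /y unlift_none; move: nt; rewrite rootE.
congr (_.[_] != 0); congr map_poly; congr meval; apply: functional_extensionality => i /=.
have -> : init_var i = lift ord_max i by apply: val_inj; rewrite /= /bump leqNgt ltn_ord.
by rewrite liftK.
Qed.

(** * Smooth points of an irreducible hypersurface *)


Section HomogFacts.
Variables (K : fieldType) (n : nat).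
Implicit Types (p q g : {mpoly K[n]}) (x y : vec K n).

Lemma linear_formE p x : p \is 1.-homog -> p.@[x] = \sum_i p@_U_(i) * x i.
Proof.
move=> hp; have -> : p = \sum_i p@_U_(i) *: 'X_i.
  apply/mpolyP => m; rewrite raddf_sum /=.
  case: (boolP (mdeg m == 1%N)) => [/mdeg1P[j /eqP ->]|m1].
    rewrite (bigD1 j) //= mcoeffZ mcoeffXU eqxx mulr1 big1 ?addr0 // => i /negbTE ij.
    by rewrite mcoeffZ mcoeffXU ij mulr0.
  rewrite (dhomog_nemf_coeff hp) // big1 // => i _.
  rewrite mcoeffZ mcoeffX; case: eqP => [E|]; last by rewrite mulr0.
  by rewrite -E mdeg1 in m1.
rewrite raddf_sum; apply: eq_bigr => i _ /=; rewrite mevalZ mevalXU; congr (_ * _).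
rewrite raddf_sum (bigD1 i) //= mcoeffZ mcoeffXU eqxx mulr1 big1 ?addr0 // => j /negbTE ij.
by rewrite mcoeffZ mcoeffXU ij mulr0.
Qed.

Lemma mderiv_homog d i p : p \is d.+1.-homog -> p^`M(i) \is d.-homog.
Proof.
move=> /dhomogP hp; apply/dhomogP => m; rewrite mcoeff_msupp mcoeff_deriv => nz.
have /hp : (m + U_(i))%MM \in msupp p.
  by rewrite mcoeff_msupp; apply: contra nz => /eqP ->; rewrite mul0rn.
by rewrite /= mdegD mdeg1 addn1 => -[].
Qed.

Lemma euler_homog d p : p \is d.-homog -> \sum_i 'X_i * p^`M(i) = d%:R *: p.
Proof.
move=> hp; rewrite {2}(homog_mpolyE hp) scaler_sumr.
under eq_bigr => i _ do rewrite {1}(homog_mpolyE hp) linear_sum mulr_sumr /=.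
rewrite exchange_big /=; apply: eq_bigr => m /eqP md.
have E i : 'X_i * (p@_m *: 'X_[m])^`M(i) = (m i)%:R *: (p@_m *: 'X_[m]).
  rewrite mderivZ mderivX -!scalerAr -mpolyXD !scalerA mulrC.
  case: (posnP (m i)) => [->|mi]; first by rewrite !mul0r !scale0r.
  by rewrite addmC submK // lep1mP -lt0n.
by under eq_bigr => i _ do rewrite E; rewrite -scaler_suml -natr_sum -mdegE md.
Qed.

Lemma euler_eval d p x : p \is d.-homog -> \sum_i x i * (p^`M(i)).@[x] = d%:R * p.@[x].
Proof.
move=> hp; rewrite -mevalZ -(euler_homog hp) raddf_sum; apply: eq_bigr => i _ /=.
by rewrite mevalM mevalXU.
Qed.

Lemma homog_eval0 d p x : p \is d.+1.-homog -> (forall i, x i = 0) -> p.@[x] = 0.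
Proof.
move=> hp x0; rewrite -(_ : (fun i => 0 * x i) = x).
  by rewrite (meval_scale _ _ hp) expr0n mul0r.
by apply: functional_extensionality => i; rewrite x0 mulr0.
Qed.

(** In characteristic zero a vanishing derivative means that the variable does not occur, so the
    corresponding coordinate point is a vertex. *)
Lemma is_cone_of_mderiv0 d g i : [pchar K] =i pred0 -> g \is d.-homog -> g^`M(i) = 0 ->
  is_cone g.
Proof.
move=> char0 hg dg0.
exists (fun j => (j == i)%:R); split; first by exists i; rewrite eqxx oner_eq0.
move=> y [_ gy] a b nz; split=> //.
suff -> : g.@[fun j => a * (j == i)%:R + b * y j] = g.@[fun j => b * y j].
  by rewrite (meval_scale _ _ hg) gy mulr0.
rewrite !mevalE !big_seq; apply: eq_bigr => m mg; congr (_ * _).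
apply: eq_bigr => j _; case: (eqVneq j i) => [->|ji]; last by rewrite mulr0 add0r.
suff -> : m i = 0%N by rewrite !expr0.
apply: contraTeq mg => mi; rewrite mcoeff_msupp negbK.
have /eqP := mcoeff_deriv i (m - U_(i)) g; rewrite dg0 mcoeff0 submK ?lep1mP //.
rewrite eq_sym -mulr_natr mulf_eq0 => /orP[//|].
by rewrite ((pcharf0P K).1 char0).
Qed.

(** A hyperplane is a cone over each of its points, and [2 <= n] provides one. *)
Lemma is_cone_of_linear g : (2 <= n)%N -> g \is 1.-homog -> is_cone g.
Proof.
move=> n2 hg; pose i0 : 'I_n := Ordinal (ltnW n2); pose i1 : 'I_n := Ordinal n2.
have [p [np gp]] : exists p : vec K n, nonzero p /\ g.@[p] = 0.
  case: (eqVneq (g@_U_(i0)) 0) => [g0|g0].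
    exists (fun j => (j == i0)%:R); split; first by exists i0; rewrite eqxx oner_eq0.
    rewrite (linear_formE _ hg) (bigD1 i0) //= g0 mul0r add0r big1 // => i /negbTE ->.
    by rewrite mulr0.
  exists (fun j => if j == i0 then - g@_U_(i1) else if j == i1 then g@_U_(i0) else 0).
  split; first by exists i1.
  rewrite (linear_formE _ hg) (bigD1 i0) //= (bigD1 i1) //= big1; first by ring.
  by move=> i /andP[/negbTE -> /negbTE ->]; rewrite mulr0.
exists p; split=> // y [_ gy] a b nz; split=> //.
rewrite (linear_formE _ hg).
under eq_bigr => i _ do rewrite mulrDr !(mulrCA _ a) !(mulrCA _ b).
rewrite big_split -!mulr_sumr /= -!(linear_formE _ hg) gp gy; ring.
Qed.

End HomogFacts.

(** There is one more vector than there are linear conditions. Only the coefficients are claimed to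
    be non-trivial; that the combined vector is non-zero is checked where the lemma is applied. *)
Lemma kernel_combination (K : fieldType) k N (l : 'I_k -> {mpoly K[N]}) (v : 'I_k.+1 -> vec K N) :
  (forall j, l j \is 1.-homog) -> exists c : 'I_k.+1 -> K, (exists i, c i != 0) /\
    forall j, (l j).@[fun s => \sum_i c i * v i s] = 0.
Proof.
move=> hl; pose M := \matrix_(i, j) (l j).@[v i] : 'M[K]_(k.+1, k).
have : (\rank (kermx M) != 0)%N.
  by rewrite mxrank_ker -lt0n subn_gt0 ltnS rank_leq_col.
rewrite mxrank_eq0 => /rowV0Pn[c]; rewrite sub_kermx => /eqP cM0 c0.
exists (fun i => c 0 i); split; first by case/rV0Pn: c0 => i; exists i.
move=> j; have := congr1 (fun A : 'rV_k => A 0 j) cM0; rewrite !mxE => E; rewrite -[RHS]E.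
rewrite (linear_formE _ (hl j)).
under eq_bigr => s _ do rewrite /= mulr_sumr.
rewrite exchange_big; apply: eq_bigr => i _ /=.
rewrite mxE (linear_formE _ (hl j)) mulr_sumr; apply: eq_bigr => s _.
by rewrite mulrCA.
Qed.

Section SmoothZero.
Variables (K : closedFieldType).

Lemma irreducible_muni n (g : {mpoly K[n.+1]}) : mirreducible g -> irreducible_elt (muni g).
Proof.
move=> [sg ig]; have [psi muniK psiK] := @muni_bij K n.
have unitE (a : {mpoly K[n.+1]}) : a != 0 -> (msize a <= 1)%N -> muni a \is a GRing.unit.
  move=> a0 sa; have Ea := msize1_polyC sa; rewrite Ea; apply: rmorph_unit.
  apply/unitrPr; exists (a@_0)^-1%:MP; rewrite -mpolyCM divff //.
  by rewrite -(mpolyC_eq0 n.+1) -Ea.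
have g0 : g != 0 by rewrite -msize_poly_eq0 -lt0n ltnW.
split; first by rewrite muni_eq0.
  apply/negP => /unitrPr[b E].
  have Eg : g * psi b = 1 by apply: (can_inj muniK); rewrite muniM psiK E muni1.
  have b0 : psi b != 0 by apply: contraPneq Eg => ->; rewrite mulr0 => /esym/eqP; rewrite oner_eq0.
  have := msizeM g0 b0; rewrite Eg msize1; move: sg.
  have : (0 < msize (psi b))%N by rewrite lt0n msize_poly_eq0.
  by move: (msize g) (msize (psi b)) => [|[|a]] [|b'] //=; rewrite addnS.
move=> b c E; have Eg : g = psi b * psi c by apply: (can_inj muniK); rewrite muniM !psiK.
move: (g0); rewrite Eg mulf_eq0 negb_or => /andP[b0 c0].
rewrite -(psiK b) -(psiK c).
by have [s|s] := ig _ _ Eg; [left|right]; apply: unitE.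
Qed.

Lemma bezout_common_root n (u v p q : {poly {mpoly K[n]}}) r (x : vec K n) t :
  u * p + v * q = r%:P -> (map_poly (meval x) p).[t] = 0 -> (map_poly (meval x) q).[t] = 0 ->
  r.@[x] = 0.
Proof.
move=> E p0 q0; have := congr1 (fun s => (map_poly (meval x) s).[t]) E.
by rewrite /= map_polyC hornerC rmorphD !rmorphM hornerD !hornerM p0 q0 !mulr0 addr0 => <-.
Qed.

Lemma smooth_zero_last n d (g : {mpoly K[n.+1]}) : g \is d.+1.-homog -> mirreducible g ->
  g^`M(ord_max) != 0 -> exists z, g.@[z] = 0 /\ (g^`M(ord_max)).@[z] != 0.
Proof.
move=> hg ig dg0; have iG := irreducible_muni ig.
set h := g^`M(ord_max) in dg0 *.
have hh : h \is d.-homog by exact: mderiv_homog.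
have [psi muniK psiK] := @muni_bij K n.
(* A non-zero derivative in the last variable comes from a monomial containing that variable. *)
have sG : (1 < size (muni g))%N.
  have hm := mlead_supp dg0; rewrite mcoeff_msupp mcoeff_deriv in hm.
  set m := mlead h in hm.
  have gm : g@_(m + U_(ord_max)) != 0 by apply: contraNneq hm => ->; rewrite mul0rn.
  rewrite ltnNge; apply/negP => sG; case/eqP: gm.
  rewrite -coef_muni nth_default ?mcoeff0 // mnmDE mnm1E eqxx addn1.
  exact: leq_trans sG _.
(* Divisibility is excluded by degrees: [g] has degree one more than its derivative. *)
have [[c E]|[u [v [r [r0 E]]]]] := divides_or_bezout (@factorial_mpoly K n) (muni h) iG sG.
  have Eh : h = psi c * g by apply: (can_inj muniK); rewrite muniM psiK.
  have c0 : psi c != 0 by apply: contraNneq dg0 => c0; rewrite Eh c0 mul0r.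
  have g0 : g != 0 by apply: contraNneq dg0 => g0; rewrite Eh g0 mulr0.
  have := msizeM c0 g0; rewrite -Eh -(mlead_deg dg0) -(mlead_deg g0) -(mlead_deg c0).
  rewrite (dhomog_mf hh (mlead_supp dg0)) (dhomog_mf hg (mlead_supp g0)) /=.
  lia.
(* Keeping the leading coefficient non-zero at [x] preserves the positive degree of [g] in the last
   variable, hence a root [t]; keeping [r] non-zero prevents the derivative from vanishing at that
   root. *)
have [|x x0] := mpoly_nonvanishing (p := r * lead_coef (muni g)).
  by rewrite mulf_neq0 // lead_coef_eq0 muni_eq0; case: iG => + _ _; rewrite muni_eq0.
move: x0; rewrite mevalM mulf_eq0 negb_or => /andP[rx lx].
pose G' := map_poly (meval x) (muni g).
have /closed_rootP[t /eqP Gt] : size G' != 1%N.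
  by rewrite size_map_poly_id0 //; case: (size _) sG => [|[]].
pose y (i : 'I_n.+1) := if unlift ord_max i is Some j then x j else t.
have yx : y \o @init_var n = x.
  apply: functional_extensionality => i; rewrite /= /y.
  have -> : init_var i = lift ord_max i by apply: val_inj; rewrite /= /bump leqNgt ltn_ord.
  by rewrite liftK.
have yt : y ord_max = t by rewrite /y unlift_none.
exists y; rewrite !meval_muni yx yt; split=> //.
apply: contraNneq rx => ht.
by apply/eqP; exact: (bezout_common_root E Gt ht).
Qed.
End SmoothZero.

(** * Polynomial functions on cones *)


Section Composition.
Variables (K : fieldType) (n k : nat).
Implicit Types (p q : {mpoly K[n]}) (lq : n.-tuple {mpoly K[k]}).

Lemma mderiv_var (i j : 'I_n) : ('X_i)^`M(j) = (i == j)%:R :> {mpoly K[n]}.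
Proof.
rewrite mderivX mnm1E; case: eqP => [->|_]; last by rewrite scale0r.
by rewrite -{1}[U_(j)%MM]add0m addmK mpolyX0 scale1r.
Qed.

Lemma mpoly_gen_ind (P : {mpoly K[n]} -> Prop) : (forall c, P c%:MP) ->
  (forall i, P 'X_i) -> (forall p q, P p -> P q -> P (p + q)) ->
  (forall p q, P p -> P q -> P (p * q)) -> forall p, P p.
Proof.
move=> PC PX PD PM; elim/mpolyind => [|c m p _ _ Pp]; first by rewrite -mpolyC0.
apply: PD => //; rewrite -mul_mpolyC; apply: (PM) => //; rewrite mpolyXE_id.
apply: (big_ind P); [by rewrite -mpolyC1 | exact: PM |].
move=> i _; elim: (m i) => [|e IH]; first by rewrite expr0 -mpolyC1.
by rewrite exprS; apply: PM.
Qed.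

Lemma mderiv_comp p lq s :
  (p \mPo lq)^`M(s) = \sum_i (p^`M(i) \mPo lq) * (tnth lq i)^`M(s).
Proof.
move: p; apply: mpoly_gen_ind => [c|i|p q Ep Eq|p q Ep Eq].
- by rewrite comp_mpolyC mderivC big1 // => i _; rewrite mderivC comp_mpoly0 mul0r.
- rewrite comp_mpolyXU -tnth_nth (bigD1 i) //= big1 ?addr0.
    by rewrite mderiv_var eqxx rmorph1 mul1r.
  by move=> j; rewrite eq_sym mderiv_var => /negbTE ->; rewrite comp_mpoly0 mul0r.
- rewrite comp_mpolyD mderivD Ep Eq -big_split; apply: eq_bigr => i _ /=.
  by rewrite mderivD comp_mpolyD mulrDl.
- rewrite rmorphM mderivM Ep Eq mulr_suml mulr_sumr -big_split; apply: eq_bigr => i _ /=.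
  by rewrite mderivM comp_mpolyD !rmorphM /=; ring.
Qed.

Lemma comp_homog d e p lq : p \is d.-homog -> (forall i, tnth lq i \is e.-homog) ->
  p \mPo lq \is (e * d).-homog.
Proof.
move=> hp hq; rewrite comp_mpolyEX big_seq; apply: rpred_sum => m mp; apply: rpredZ.
rewrite comp_mpolyX -(dhomog_mf hp mp) /= mdegE big_distrr /=.
elim/big_rec2: _ => [|i a P _ IH]; first exact: dhomog1.
by apply: dhomogM => //; exact: dhomogMn.
Qed.
End Composition.

Section PolynomialFunctions.
Variables (K : closedFieldType).

(** Polynomiality as a property of functions is proved by closure rules, so that the substituted
    polynomials never have to be written down. *)
Definition polyfun r (F : vec K r -> K) : Prop :=
  exists P : {mpoly K[r]}, forall t, F t = P.@[t].

Lemma polyfun_const r c : @polyfun r (fun=> c).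
Proof. by exists c%:MP => t; rewrite mevalC. Qed.

Lemma polyfun_var r i : @polyfun r (fun t => t i).
Proof. by exists 'X_i => t; rewrite mevalXU. Qed.

Lemma polyfunD r (F G : vec K r -> K) : polyfun F -> polyfun G -> polyfun (fun t => F t + G t).
Proof. by move=> [P HP] [Q HQ]; exists (P + Q) => t; rewrite mevalD HP HQ. Qed.

Lemma polyfunM r (F G : vec K r -> K) : polyfun F -> polyfun G -> polyfun (fun t => F t * G t).
Proof. by move=> [P HP] [Q HQ]; exists (P * Q) => t; rewrite mevalM HP HQ. Qed.

Lemma polyfunN r (F : vec K r -> K) : polyfun F -> polyfun (fun t => - F t).
Proof. by move=> [P HP]; exists (- P) => t; rewrite mevalN HP. Qed.

Lemma polyfun_comp r N (p : {mpoly K[N]}) (F : vec K r -> vec K N) :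
  (forall s, polyfun (fun t => F t s)) -> polyfun (fun t => p.@[F t]).
Proof.
move=> /choice_fun[P HP]; exists (p \mPo [tuple P s | s < N]) => t.
by rewrite comp_mpoly_meval; apply: meval_eq => s; rewrite tnth_mktuple.
Qed.

(** Two non-empty open subsets of affine space meet, because the product of two non-zero polynomials
    is non-zero. *)
Lemma polyfun_generic r (F G : vec K r -> K) t1 t2 : polyfun F -> polyfun G ->
  F t1 != 0 -> G t2 != 0 -> exists t, F t != 0 /\ G t != 0.
Proof.
move=> [P HP] [Q HQ] F1 G2.
have P0 : P != 0 by apply: contraNneq F1 => E; rewrite HP E meval0.
have Q0 : Q != 0 by apply: contraNneq G2 => E; rewrite HQ E meval0.
have [t] := mpoly_nonvanishing (mulf_neq0 P0 Q0).
by rewrite mevalM mulf_eq0 negb_or -HP -HQ => /andP[? ?]; exists t.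
Qed.

(* Homogeneous components of P are the coefficients of the polynomial t |-> P(t s). *)
Lemma component_vanish N (P : {mpoly K[N]}) (s : vec K N) :
  (forall t, t != 0 -> P.@[fun i => t * s i] = 0) -> forall d, (pihomog mdeg d P).@[s] = 0.
Proof.
move=> H.
pose Q : {poly K} := \poly_(d < msize P) (pihomog mdeg d P).@[s].
have QE t : Q.[t] = P.@[fun i => t * s i].
  rewrite horner_poly [in RHS](sum_pihomog P) raddf_sum; apply: eq_bigr => d _ /=.
  by rewrite (meval_scale _ _ (pihomogP _ _ _)) mulrC.
have Q0 : Q = 0.
  apply/eqP/negP => /negP Q0.
  (* The extra factor ['X] forces the non-root to be different from 0, where [H] applies. *)
  have /closed_nonrootP[t] : Q * 'X != 0 by rewrite mulf_neq0 ?polyX_eq0.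
  rewrite rootE hornerM hornerX mulf_eq0 negb_or QE => /andP[+ t0].
  by rewrite H ?eqxx.
move=> d; case: (ltnP d (msize P)) => [lt|le].
  by have := coef0 K d; rewrite -Q0 coef_poly lt.
rewrite pihomogE big_seq_cond big1 ?meval0 // => m /andP[mP /eqP md].
by have := msize_mdeg_lt mP; rewrite md ltnNge le.
Qed.

(** [zclosure] tests only forms, whereas [P] will be a form with some arguments fixed. Vanishing on
    all multiples of points of [S] forces each component to vanish on [S]; the second clause
    concerns the constant term. *)
Lemma cone_vanish N (P : {mpoly K[N]}) (S : pset K N) :
  (forall s t, S s -> t != 0 -> P.@[fun i => t * s i] = 0) ->
  (forall x, zclosure S x -> P.@[x] = 0) /\
  ((exists s, S s) -> forall x, (forall i, x i = 0) -> P.@[x] = 0).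
Proof.
move=> H; split=> [x Sx|[s Ss] x x0].
  rewrite (sum_pihomog P) raddf_sum big1 // => d _ /=.
  apply: zclosure_vanish Sx; first by exists d; exact: pihomogP.
  by move=> s Ss; apply: component_vanish => t; exact: H.
have P0 := component_vanish (fun t => H s t Ss) 0%N.
rewrite (sum_pihomog P) raddf_sum big1 // => -[[|d] lt] _ /=; last first.
  exact: homog_eval0 (pihomogP _ _ _) x0.
have sz : (msize (pihomog mdeg 0 P) <= 1)%N := msize_homog (pihomogP _ _ _).
by move: P0; rewrite (msize1_polyC sz) !mevalC.
Qed.

(** Irreducibility of the affine cone over [Z], for inhomogeneous [P] and [Q]: some component of
    each is non-zero on [Z], so both are at a common point, and a suitable multiple of it serves [P]
    and [Q]. The scalars [c1], [c2] may be 0. *)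
Lemma irreducible_generic N (Z : pset K N) (P Q : {mpoly K[N]}) (z1 z2 : vec K N) c1 c2 :
  zclosed Z -> pirreducible Z -> Z z1 -> Z z2 ->
  P.@[fun i => c1 * z1 i] != 0 -> Q.@[fun i => c2 * z2 i] != 0 ->
  exists z, [/\ Z z, P.@[z] != 0 & Q.@[z] != 0].
Proof.
move=> cZ iZ Zz1 Zz2 P1 Q2.
have comp (R : {mpoly K[N]}) c z : R.@[fun i => c * z i] != 0 ->
    exists d, (pihomog mdeg d R).@[z] != 0.
  move=> Rz; apply: NNPP => H; case/eqP: Rz.
  rewrite (sum_pihomog R) raddf_sum big1 // => d _ /=.
  rewrite (meval_scale _ _ (pihomogP _ _ _)).
  case: (eqVneq (pihomog mdeg d R).@[z] 0) => [->|nz]; first by rewrite mulr0.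
  by case: H; exists d.
have [d Pd] := comp P _ _ P1; have [e Qe] := comp Q _ _ Q2.
have [z [Zz PQz]] : exists z, Z z /\ (pihomog mdeg d P * pihomog mdeg e Q).@[z] != 0.
  apply: NNPP => H.
  have [||z Zz|H1|H1] := irreducible_prime (p := pihomog mdeg d P) (q := pihomog mdeg e Q) cZ iZ.
  - by exists d; exact: pihomogP.
  - by exists e; exact: pihomogP.
  - by apply/eqP/negP => /negP nz; apply: H; exists z.
  - by rewrite H1 ?eqxx in Pd.
  - by rewrite H1 ?eqxx in Qe.
move: PQz; rewrite mevalM mulf_eq0 negb_or => /andP[Pz Qz].
have scale_nz (R : {mpoly K[N]}) f : (pihomog mdeg f R).@[z] != 0 ->
    exists t : vec K 1, R.@[fun i => t ord0 * z i] != 0.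
  move=> Rz; apply: NNPP => H; case/eqP: Rz; apply: component_vanish => t _.
  by apply/eqP/negP => /negP nz; apply: H; exists (fun=> t).
have pf (R : {mpoly K[N]}) : polyfun (fun t : vec K 1 => R.@[fun i => t ord0 * z i]).
  apply: polyfun_comp => s; apply: polyfunM; [exact: polyfun_var | exact: polyfun_const].
have [t1 Pt] := scale_nz _ _ Pz; have [t2 Qt] := scale_nz _ _ Qz.
have [t [Pt' Qt']] := polyfun_generic (pf P) (pf Q) Pt Qt.
have [u [PQu u0]] := polyfun_generic (t2 := fun=> 1) (polyfunM (pf P) (pf Q))
  (polyfun_var ord0) (mulf_neq0 Pt' Qt') (oner_neq0 _).
move: PQu; rewrite mulf_eq0 negb_or => /andP[Pu Qu].
by exists (fun i => u ord0 * z i); split=> //; exact: zclosed_scale.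
Qed.

(** Supplies the limit at [t = 0] of an identity known for the other parameters. *)
Lemma polyfun_divide (F : vec K 1 -> K) : polyfun F ->
  (forall t, t ord0 != 0 -> F t = 0) -> forall t, F t = 0.
Proof.
move=> pF H t; apply/eqP/negP => /negP Ft.
have [u [Fu u0]] := polyfun_generic (t2 := fun=> 1) pF (polyfun_var ord0) Ft (oner_neq0 _).
by rewrite H ?eqxx in Fu.
Qed.
End PolynomialFunctions.

(** * Coordinates on the ambient space *)


Section Coordinates.
Variables (K : fieldType) (n : nat).
Local Notation M := ((2 * n).+2).

Definition coords (u v : K) (x y : vec K n) : vec K M := fun s =>
  if s == 0%N :> nat then u else if s == 1%N :> nat then v else
  if insub (s - 2)%N is Some i then x i else
  if insub (s - 2 - n)%N is Some i then y i else 0.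

Lemma val_iu : iu n = 0%N :> nat. Proof. by rewrite inordK. Qed.
Lemma val_iv : iv n = 1%N :> nat. Proof. by rewrite inordK. Qed.
Lemma val_ix (i : 'I_n) : ix i = (2 + i)%N :> nat.
Proof. by rewrite inordK //; have := ltn_ord i; lia. Qed.
Lemma val_iy (i : 'I_n) : iy i = (2 + n + i)%N :> nat.
Proof. by rewrite inordK //; have := ltn_ord i; lia. Qed.

Lemma coords_u u v x y : coords u v x y (iu n) = u. Proof. by rewrite /coords val_iu. Qed.
Lemma coords_v u v x y : coords u v x y (iv n) = v. Proof. by rewrite /coords val_iv. Qed.
Lemma coords_x u v x y i : coords u v x y (ix i) = x i.
Proof. by rewrite /coords val_ix add2n /= !subSS subn0 valK. Qed.
Lemma coords_y u v x y i : coords u v x y (iy i) = y i.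
Proof.
rewrite /coords val_iy -addnA add2n /= !subSS subn0 insubN ?addKn ?valK //.
by rewrite -leqNgt leq_addr.
Qed.
Definition coordsE := (coords_u, coords_v, coords_x, coords_y).

Lemma coordP (P : 'I_M -> Prop) : P (iu n) -> P (iv n) -> (forall i, P (ix i)) ->
  (forall i, P (iy i)) -> forall s, P s.
Proof.
move=> Pu Pv Px Py s; have sM := ltn_ord s.
case: (ltnP s 2) => [s2|s2].
  have [s0|s1] : (s = 0 :> nat \/ s = 1 :> nat)%N by lia.
    by rewrite (_ : s = iu n) //; apply: val_inj; rewrite /= val_iu.
  by rewrite (_ : s = iv n) //; apply: val_inj; rewrite /= val_iv.
case: (ltnP (s - 2) n) => [sn|sn].
  rewrite (_ : s = ix (Ordinal sn)) //; apply: val_inj; rewrite /= val_ix /=; lia.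
have sn' : (s - 2 - n < n)%N by lia.
rewrite (_ : s = iy (Ordinal sn')) //; apply: val_inj; rewrite /= val_iy /=; lia.
Qed.

Lemma coords_eta (q : vec K M) :
  q = coords (q (iu n)) (q (iv n)) (fun i => q (ix i)) (fun i => q (iy i)).
Proof. by apply: functional_extensionality; apply: coordP => *; rewrite coordsE. Qed.

Lemma coords_eq u v x y (q : vec K M) : q (iu n) = u -> q (iv n) = v ->
  (forall i, q (ix i) = x i) -> (forall i, q (iy i) = y i) -> q = coords u v x y.
Proof. by move=> *; apply: functional_extensionality; apply: coordP => *; rewrite coordsE. Qed.

Lemma coords_scale c u v x y : (fun s => c * coords u v x y s) =
  coords (c * u) (c * v) (fun i => c * x i) (fun i => c * y i).
Proof. by apply: coords_eq => *; rewrite coordsE. Qed.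

Lemma coords_nonzeroP u v x y : nonzero (coords u v x y) <->
  [\/ u != 0, v != 0, nonzero x | nonzero y].
Proof.
split=> [[s]|]; last first.
  case=> [H|H|[i H]|[i H]]; [exists (iu n)|exists (iv n)|exists (ix i)|exists (iy i)];
  by rewrite coordsE.
by elim/coordP: s => [||i|i]; rewrite coordsE => H; [constructor 1|constructor 2|
  constructor 3; exists i|constructor 4; exists i].
Qed.

Definition segre_pt (a b w0 : K) (w : vec K n) : vec K M :=
  coords (b * w0) (a * w0) (fun i => a * w i) (fun i => b * w i).

Definition cone_pt (u v a b : K) (z : vec K n) : vec K M :=
  coords u v (fun i => a * z i) (fun i => b * z i).

(** The affine cone over [Y], origin included: a row [a * w] of a Segre point vanishes when [a]
    does. *)
Definition orzero (Y : pset K n) (w : vec K n) : Prop := Y w \/ forall i, w i = 0.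

Lemma segre_tildeP (Y : pset K n) q : segre_tilde Y q <->
  exists a b w0 w, [/\ a != 0 \/ b != 0, w0 != 0 \/ nonzero w, orzero Y w & q = segre_pt a b w0 w].
Proof.
split.
- move=> [a [b [w [ab [[[i wi] Yw] [Eu [Ev [Ex Ey]]]]]]]].
  exists a, b, (w ord0), (fun i => w (lift ord0 i)); split=> //; last exact: coords_eq.
  case: (unliftP ord0 i) wi => [j ->|->] wi; [right; exists j|left]; exact: wi.
- move=> [a [b [w0 [w [ab nz Yw ->]]]]].
  exists a, b, (fun s : 'I_n.+1 => if unlift ord0 s is Some i then w i else w0).
  have E : (fun i => if unlift ord0 (lift ord0 i) is Some i then w i else w0) = w.
    by apply: functional_extensionality => i; rewrite liftK.
  split=> //; split; last first.
    by rewrite /segre_pt !coordsE unlift_none; split=> //; split=> //; split=> i; rewrite coordsE liftK.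
  split.
    case: nz => [w00|[i wi]]; [exists ord0|exists (lift ord0 i)].
      by rewrite unlift_none.
    by rewrite liftK.
  rewrite E; case: Yw => [|H]; [by left|right=> i]; by rewrite liftK.
Qed.

Lemma rank_one m (r1 r2 : 'I_m -> K) : (forall i j, r1 i * r2 j = r1 j * r2 i) ->
  exists a b (w : 'I_m -> K), [/\ a != 0 \/ b != 0, forall i, r1 i = a * w i &
    forall i, r2 i = b * w i].
Proof.
move=> H; case: (classic (exists j, r1 j != 0)) => [[j rj]|nr].
  exists 1, (r2 j / r1 j), r1; split; first by left; rewrite oner_eq0.
    by move=> i; rewrite mul1r.
  by move=> i; apply: (mulfI rj); rewrite -H; field.
exists 0, 1, r2; split; first by right; rewrite oner_eq0.
  by move=> i; rewrite mul0r; apply/eqP/negP => /negP ri; apply: nr; exists i.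
by move=> i; rewrite mul1r.
Qed.

Lemma nonzeroPn (w : vec K n) : ~ nonzero w -> forall i, w i = 0.
Proof. by move=> nw i; apply/eqP/negP => /negP wi; apply: nw; exists i. Qed.

Lemma orzero_scale (Y : pset K n) c w : zclosed Y -> orzero Y w -> orzero Y (fun i => c * w i).
Proof.
move=> cY; case: (eqVneq c 0) => [-> _|c0]; first by right=> i; rewrite mul0r.
by case=> [Yw|w0]; [left; exact: zclosed_scale | right=> i; rewrite w0 mulr0].
Qed.

Lemma orzero_unscale (Y : pset K n) c w : zclosed Y -> c != 0 ->
  orzero Y (fun i => c * w i) -> orzero Y w.
Proof.
move=> cY c0 /(@orzero_scale _ c^-1 _ cY).
by rewrite (_ : (fun i => _) = w) //; apply: functional_extensionality => i; rewrite mulKf.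
Qed.

Lemma orzero_rows (Y : pset K n) a b w : zclosed Y -> a != 0 \/ b != 0 ->
  orzero Y (fun i => a * w i) -> orzero Y (fun i => b * w i) -> orzero Y w.
Proof. by move=> cY [] c0 Ha Hb; apply: orzero_unscale c0 _. Qed.

(** The test form is multiplied by a coordinate of the row, so that it also vanishes at points whose
    row is zero; [p] alone may be a non-zero constant there. *)
Lemma closure_rows (Y : pset K n) (S : pset K M) (rho : 'I_n -> 'I_M) : zclosed Y ->
  (forall s, S s -> orzero Y (fun i => s (rho i))) ->
  forall q, zclosure S q -> orzero Y (fun i => q (rho i)).
Proof.
move=> cY H q Sq.
case: (classic (nonzero (fun i => q (rho i)))) => [nz|/nonzeroPn]; last by right.
left; apply/cY; split=> // p [d hp] pY; have [i qi] := nz.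
pose P := (p * 'X_i) \mPo [tuple 'X_(rho j) | j < n].
have PE s : P.@[s] = p.@[fun j => s (rho j)] * s (rho i).
  rewrite comp_mpoly_meval mevalM mevalXU !tnth_mktuple mevalXU; congr (_ * _).
  by apply: meval_eq => j; rewrite tnth_mktuple mevalXU.
have hP : is_homog P.
  exists (1 * (d + 1))%N; apply: comp_homog; first by apply: dhomogM => //; exact: homogXi.
  by move=> j; rewrite tnth_mktuple; exact: homogXi.
have := zclosure_vanish hP _ Sq; rewrite PE => /(_ _)/eqP; rewrite mulf_eq0 (negbTE qi) orbF => E.
apply/eqP/E => s Ss; rewrite PE.
by case: (H s Ss) => [/pY ->|->]; rewrite ?mul0r ?mulr0.
Qed.

Lemma closure_minor (S : pset K M) (i1 i2 j1 j2 : 'I_M) :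
  (forall s, S s -> s i1 * s i2 = s j1 * s j2) ->
  forall q, zclosure S q -> q i1 * q i2 = q j1 * q j2.
Proof.
move=> H q Sq; pose P : {mpoly K[M]} := 'X_i1 * 'X_i2 - 'X_j1 * 'X_j2.
have PE s : P.@[s] = s i1 * s i2 - s j1 * s j2 by rewrite mevalB !mevalM !mevalXU.
apply/eqP; rewrite -subr_eq0 -PE; apply/eqP; apply: zclosure_vanish Sq.
  exists (1 + 1)%N; apply: rpredB; apply: dhomogM; exact: homogXi.
by move=> s Ss; rewrite PE H // subrr.
Qed.

Lemma closure_coord (S : pset K M) i : (forall s, S s -> s i = 0) ->
  forall q, zclosure S q -> q i = 0.
Proof.
move=> H q Sq; rewrite -(mevalXU q i); apply: zclosure_vanish Sq.
  by exists 1%N; exact: homogXi.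
by move=> s Ss; rewrite mevalXU H.
Qed.

(** The vanishing of the minors and the conditions on the two rows pass to the closure, and
    [rank_one] rebuilds the parameters from them. *)
Lemma segre_tilde_closed (Y : pset K n) : zclosed Y -> zclosed (segre_tilde Y).
Proof.
move=> cY q; split; last first.
  move=> Sq; apply: zclosure_sub => //; move/segre_tildeP: Sq => [a [b [w0 [w [ab nz _ ->]]]]].
  apply/coords_nonzeroP; case: nz => [w00|[i wi]].
    by case: ab => c0; [constructor 2 | constructor 1]; rewrite mulf_neq0.
  by case: ab => c0; [constructor 3 | constructor 4]; exists i; rewrite mulf_neq0.
move=> Sq; have [nq _] := Sq.
have par s : segre_tilde Y s -> exists a b w0 w, orzero Y w /\ s = segre_pt a b w0 w.
  by move/segre_tildeP => [a [b [w0 [w [_ _ Yw ->]]]]]; exists a, b, w0, w.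
have Hx : orzero Y (fun i => q (ix i)).
  apply: closure_rows Sq => // s /par[a [b [w0 [w [Yw ->]]]]].
  rewrite (_ : (fun i => _) = (fun i => a * w i)); first exact: orzero_scale.
  by apply: functional_extensionality => i; rewrite /segre_pt coordsE.
have Hy : orzero Y (fun i => q (iy i)).
  apply: closure_rows Sq => // s /par[a [b [w0 [w [Yw ->]]]]].
  rewrite (_ : (fun i => _) = (fun i => b * w i)); first exact: orzero_scale.
  by apply: functional_extensionality => i; rewrite /segre_pt coordsE.
pose top (s : 'I_n.+1) := if unlift ord0 s is Some i then ix i else iv n.
pose bot (s : 'I_n.+1) := if unlift ord0 s is Some i then iy i else iu n.
have [|a [b [w [ab Ea Eb]]]] := @rank_one n.+1 (q \o top) (q \o bot).
  move=> i j; apply: closure_minor Sq => s /par[a [b [w0 [w [Yw ->]]]]].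
  by rewrite /top /bot /segre_pt; case: unliftP => [i' _|_]; case: unliftP => [j' _|_];
    rewrite !coordsE; ring.
have Ex i : q (ix i) = a * w (lift ord0 i) by have := Ea (lift ord0 i); rewrite /= /top liftK.
have Ey i : q (iy i) = b * w (lift ord0 i) by have := Eb (lift ord0 i); rewrite /= /bot liftK.
have Ev : q (iv n) = a * w ord0 by have := Ea ord0; rewrite /= /top unlift_none.
have Eu : q (iu n) = b * w ord0 by have := Eb ord0; rewrite /= /bot unlift_none.
have Eq : q = segre_pt a b (w ord0) (fun i => w (lift ord0 i)) by exact: coords_eq.
apply/segre_tildeP; exists a, b, (w ord0), (fun i => w (lift ord0 i)); split=> //.
- apply: NNPP => nw; case: nq => s; rewrite Eq.
  case: (eqVneq (w ord0) 0) => [w0|w0]; last by case: nw; left.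
  have {}nw := nonzeroPn (fun H => nw (or_intror H)).
  by elim/coordP: s => [||i|i]; rewrite /segre_pt coordsE ?w0 ?nw mulr0 eqxx.
- apply: (orzero_rows cY ab).
    by move: Hx; congr orzero; apply: functional_extensionality => i; rewrite Ex.
  by move: Hy; congr orzero; apply: functional_extensionality => i; rewrite Ey.
Qed.
End Coordinates.

(** * Cones over Segre products *)


Section Varieties.
Variables (K : closedFieldType) (n : nat).
Local Notation M := ((2 * n).+2).
Implicit Types (Y Z : pset K n).

Lemma polyfun_coords r (u v : vec K r -> K) (x y : vec K r -> vec K n) :
  polyfun u -> polyfun v -> (forall i, polyfun (fun t => x t i)) ->
  (forall i, polyfun (fun t => y t i)) ->
  forall s, polyfun (fun t => coords (u t) (v t) (x t) (y t) s).
Proof.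
move=> pu pv px py; elim/coordP => [||i|i].
- by move: pu => [P HP]; exists P => t; rewrite coordsE.
- by move: pv => [P HP]; exists P => t; rewrite coordsE.
- by move: (px i) => [P HP]; exists P => t; rewrite coordsE.
- by move: (py i) => [P HP]; exists P => t; rewrite coordsE.
Qed.

Definition cone_raw Z : pset K M := fun q => exists u v a b z,
  [/\ a != 0 \/ b != 0, Z z & q = cone_pt u v a b z].

Lemma cone_segre_raw Z : cone_segre Z = zclosure (cone_raw Z).
Proof.
rewrite /cone_segre; congr zclosure; apply: functional_extensionality => q.
apply: propositional_extensionality; split.
  move=> [u [v [a [b [z [ab [Zz [Eu [Ev [Ex Ey]]]]]]]]]]; exists u, v, a, b, z.
  by split=> //; exact: coords_eq.
move=> [u [v [a [b [z [ab Zz ->]]]]]]; exists u, v, a, b, z.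
by rewrite /cone_pt !coordsE; do !split=> //; move=> i; rewrite coordsE.
Qed.

(** The equations of the rank one matrix survive closure, so the closure adds only the points of the
    vertex line, where [z] is zero. *)
Lemma cone_segreP Z q : zclosed Z -> (exists z, Z z) -> cone_segre Z q <->
  nonzero q /\ exists u v a b z, [/\ a != 0 \/ b != 0, orzero Z z & q = cone_pt u v a b z].
Proof.
move=> cZ [z0 Zz0]; rewrite cone_segre_raw; split=> [Sq|[nq [u [v [a [b [z [ab Zz Eq]]]]]]]].
  have [nq _] := Sq; split=> //.
  have Hx : orzero Z (fun i => q (ix i)).
    apply: closure_rows Sq => // s [u [v [a [b [z [ab Zz ->]]]]]].
    rewrite (_ : (fun i => _) = (fun i => a * z i)); first by apply: orzero_scale => //; left.
    by apply: functional_extensionality => i; rewrite /cone_pt coordsE.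
  have Hy : orzero Z (fun i => q (iy i)).
    apply: closure_rows Sq => // s [u [v [a [b [z [ab Zz ->]]]]]].
    rewrite (_ : (fun i => _) = (fun i => b * z i)); first by apply: orzero_scale => //; left.
    by apply: functional_extensionality => i; rewrite /cone_pt coordsE.
  have [|a [b [w [ab Ea Eb]]]] := @rank_one _ n (fun i => q (ix i)) (fun i => q (iy i)).
    move=> i j; apply: closure_minor Sq => s [u [v [a [b [z [ab Zz ->]]]]]].
    by rewrite /cone_pt !coordsE; ring.
  exists (q (iu n)), (q (iv n)), a, b, w; split=> //; last exact: coords_eq.
  apply: (orzero_rows cZ ab).
    by move: Hx; congr orzero; apply: functional_extensionality.
  by move: Hy; congr orzero; apply: functional_extensionality.
case: Zz => [Zz|z_0]; first by apply: zclosure_sub => //; exists u, v, a, b, z.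
split=> // p hp pS.
(* A point of the vertex line is the value at [t = 0] of a family that lies in the raw cone for all
   other [t]. *)
have -> : q = cone_pt u v 0 0 z0.
  rewrite Eq /cone_pt; congr coords; apply: functional_extensionality => i;
    by rewrite z_0 mulr0 mul0r.
pose F (t : vec K 1) := p.@[cone_pt u v (t ord0) 0 z0].
apply: (@polyfun_divide _ F _ _ (fun=> 0)).
  apply: polyfun_comp; apply: polyfun_coords => *; try exact: polyfun_const.
  by apply: polyfunM; [exact: polyfun_var | exact: polyfun_const].
by move=> t t0; apply: pS; exists u, v, (t ord0), 0, z0; split=> //; left.
Qed.

(** Irreducibility of an affine space times [Z]: with [t1] and [t2] fixed, a common [z] is found on
    [Z]; with that [z] fixed, [t] is varied. [kap] keeps the parameter admissible. *)
Lemma image_generic r N (phi : vec K r -> vec K n -> vec K N) (kap : vec K r -> K)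
    (A B : {mpoly K[N]}) Z t1 t2 t3 z1 z2 c1 c2 :
  zclosed Z -> pirreducible Z -> polyfun kap ->
  (forall z s, polyfun (fun t => phi t z s)) -> (forall t s, polyfun (fun z => phi t z s)) ->
  Z z1 -> Z z2 -> A.@[phi t1 (fun i => c1 * z1 i)] != 0 ->
  B.@[phi t2 (fun i => c2 * z2 i)] != 0 -> kap t3 != 0 ->
  exists t z, [/\ Z z, kap t != 0, A.@[phi t z] != 0 & B.@[phi t z] != 0].
Proof.
move=> cZ iZ pk pt pz Z1 Z2 A1 B2 k3.
have [PA HA] : polyfun (fun z => A.@[phi t1 z]) by apply: polyfun_comp => s; exact: pz.
have [PB HB] : polyfun (fun z => B.@[phi t2 z]) by apply: polyfun_comp => s; exact: pz.
rewrite HA in A1; rewrite HB in B2.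
have [z [Zz]] := irreducible_generic cZ iZ Z1 Z2 A1 B2; rewrite -HA -HB => Az Bz.
have pA : polyfun (fun t => A.@[phi t z]) by apply: polyfun_comp => s; exact: pt.
have pB : polyfun (fun t => B.@[phi t z]) by apply: polyfun_comp => s; exact: pt.
have [t [At Bt]] := polyfun_generic pA pB Az Bz.
have [t' [ABt kt]] := polyfun_generic (polyfunM pA pB) pk (mulf_neq0 At Bt) k3.
by move: ABt; rewrite mulf_eq0 negb_or => /andP[? ?]; exists t', z.
Qed.

(** Writing the origin as [0 * z] puts every parameter over a genuine point of [Z], which is why
    [image_generic] admits arbitrary scalars. *)
Lemma orzero_multiple Z w : (exists z, Z z) -> orzero Z w ->
  exists c z, Z z /\ w = (fun i => c * z i).
Proof.
move=> [z0 Zz0] [Zw|w0].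
  by exists 1, w; split=> //; apply: functional_extensionality => i; rewrite mul1r.
by exists 0, z0; split=> //; apply: functional_extensionality => i; rewrite w0 mul0r.
Qed.

Definition vec3 (a b c : K) : vec K 3 := fun i => nth 0 [:: a; b; c] i.
Definition vec4 (a b c d : K) : vec K 4 := fun i => nth 0 [:: a; b; c; d] i.
Definition o3 k (H : (k < 3)%N) : 'I_3 := Ordinal H.
Definition o4 k (H : (k < 4)%N) : 'I_4 := Ordinal H.

Definition segre_param (t : vec K 3) (z : vec K n) : vec K M :=
  segre_pt (t (@o3 0 isT)) (t (@o3 1 isT)) (t (@o3 2 isT)) z.
Definition cone_param (t : vec K 4) (z : vec K n) : vec K M :=
  cone_pt (t (@o4 0 isT)) (t (@o4 1 isT)) (t (@o4 2 isT)) (t (@o4 3 isT)) z.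

Ltac polyfun_tac := repeat first
  [ exact: polyfun_var | exact: polyfun_const | apply: polyfunM ].

Lemma segre_param_polyl z s : polyfun (fun t => segre_param t z s).
Proof. by apply: polyfun_coords => *; polyfun_tac. Qed.
Lemma segre_param_polyr t s : polyfun (fun z => segre_param t z s).
Proof. by apply: polyfun_coords => *; polyfun_tac. Qed.
Lemma cone_param_polyl z s : polyfun (fun t => cone_param t z s).
Proof. by apply: polyfun_coords => *; polyfun_tac. Qed.
Lemma cone_param_polyr t s : polyfun (fun z => cone_param t z s).
Proof. by apply: polyfun_coords => *; polyfun_tac. Qed.

Lemma segre_tilde_mem Y a b w0 w : zclosed Y -> a != 0 \/ b != 0 -> Y w ->
  segre_tilde Y (segre_pt a b w0 w).
Proof.
move=> cY ab Yw; apply/segre_tildeP; exists a, b, w0, w; split=> //.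
  by right; exact: zclosed_nonzero Yw.
by left.
Qed.

Lemma cone_raw_nonzero Z q : zclosed Z -> cone_raw Z q -> nonzero q.
Proof.
move=> cZ [u [v [a [b [z [ab Zz ->]]]]]]; apply/coords_nonzeroP.
have [i zi] := zclosed_nonzero cZ Zz.
by case: ab => c0; [constructor 3 | constructor 4]; exists i; rewrite mulf_neq0.
Qed.

Lemma segre_tilde_irreducible Z : zclosed Z -> pirreducible Z -> pirreducible (segre_tilde Z).
Proof.
move=> cZ iZ; have [neZ _] := iZ; have [z0 Zz0] := neZ.
split; first by exists (segre_pt 1 0 0 z0); apply: segre_tilde_mem => //; left; exact: oner_neq0.
move=> A B cA cB sAB; apply: NNPP => nAB.
have bad C : zclosed C -> ~ psubset (segre_tilde Z) C -> exists p t c z,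
    [/\ forall s, C s -> p.@[s] = 0, Z z & p.@[segre_param t (fun i => c * z i)] != 0].
  move=> cC nC; have [q [Sq nCq]] : exists q, segre_tilde Z q /\ ~ C q.
    by apply: NNPP => H; apply: nC => q Sq; apply: NNPP => nCq; apply: H; exists q.
  have nq := zclosed_nonzero (segre_tilde_closed cZ) Sq.
  have [p [_ pC pq]] := zclosed_separate cC nq nCq.
  move/segre_tildeP: Sq => [a [b [w0 [w [_ _ /(orzero_multiple neZ)[c [z [Zz Ew]]] Eq]]]]].
  by exists p, (vec3 a b w0), c, z; split=> //; rewrite -Ew -[segre_param _ _]Eq.
have [|pA [tA [cA' [zA [HA ZA nzA]]]]] := bad A cA; first by move=> ?; apply: nAB; left.
have [|pB [tB [cB' [zB [HB ZB nzB]]]]] := bad B cB; first by move=> ?; apply: nAB; right.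
(* [kap] is the coordinate [a]; keeping it non-zero makes (a : b) a point of P^1. *)
have [t [z [Zz kt At Bt]]] := image_generic (t3 := fun=> 1) cZ iZ (polyfun_var K (@o3 0 isT))
  segre_param_polyl segre_param_polyr ZA ZB nzA nzB (oner_neq0 _).
have [|HAB|HAB] := sAB (segre_param t z).
- by apply: segre_tilde_mem => //; left.
- by rewrite HA ?eqxx in At.
- by rewrite HB ?eqxx in Bt.
Qed.

Lemma cone_segre_irreducible Z : zclosed Z -> pirreducible Z -> pirreducible (cone_segre Z).
Proof.
move=> cZ iZ; have [neZ _] := iZ; have [z0 Zz0] := neZ; rewrite cone_segre_raw.
have raw_cl q : cone_raw Z q -> zclosure (cone_raw Z) q.
  by move=> Rq; apply: zclosure_sub => //; exact: cone_raw_nonzero Rq.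
split.
  by exists (cone_pt 0 0 1 0 z0); apply: raw_cl; exists 0, 0, 1, 0, z0; split=> //; left; exact: oner_neq0.
move=> A B cA cB sAB; apply: NNPP => nAB.
have bad C : zclosed C -> ~ psubset (zclosure (cone_raw Z)) C -> exists p t c z,
    [/\ forall s, C s -> p.@[s] = 0, Z z & p.@[cone_param t (fun i => c * z i)] != 0].
  move=> cC nC; have [q [Rq nCq]] : exists q, cone_raw Z q /\ ~ C q.
    apply: NNPP => H; apply: nC; apply: zclosure_min => // q Rq.
    by apply: NNPP => nCq; apply: H; exists q.
  have [p [_ pC pq]] := zclosed_separate cC (cone_raw_nonzero cZ Rq) nCq.
  move: Rq => [u [v [a [b [w [ab Zw Eq]]]]]].
  have [c [z [Zz Ew]]] := orzero_multiple neZ (or_introl Zw).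
  by exists p, (vec4 u v a b), c, z; split=> //; rewrite -Ew -[cone_param _ _]Eq.
have [|pA [tA [cA' [zA [HA ZA nzA]]]]] := bad A cA; first by move=> ?; apply: nAB; left.
have [|pB [tB [cB' [zB [HB ZB nzB]]]]] := bad B cB; first by move=> ?; apply: nAB; right.
have [t [z [Zz kt At Bt]]] := image_generic (t3 := fun=> 1) cZ iZ (polyfun_var K (@o4 2 isT))
  cone_param_polyl cone_param_polyr ZA ZB nzA nzB (oner_neq0 _).
have [|HAB|HAB] := sAB (cone_param t z).
- apply: raw_cl; exists (t (@o4 0 isT)), (t (@o4 1 isT)), (t (@o4 2 isT)), (t (@o4 3 isT)), z.
  by split=> //; left.
- by rewrite HA ?eqxx in At.
- by rewrite HB ?eqxx in Bt.
Qed.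

(** For [a] non-zero the system is triangular. For [a = 0] each equation isolates the preceding
    entry, and the equation [j = k], where [e k] is already zero, reaches the last one. *)
Lemma antidiagonal_zero (a b : K) (e : nat -> K) k : a != 0 \/ b != 0 ->
  (forall s, (k <= s)%N -> e s = 0) ->
  (forall j, (j <= k)%N -> a * e j + b * (if j is j'.+1 then e j' else 0) = 0) ->
  forall s, e s = 0.
Proof.
move=> ab ek H s; case: (leqP k s) => [|sk]; first exact: ek.
case: (eqVneq a 0) => [a0|a0].
  have b0 : b != 0 by case: ab => //; rewrite a0 eqxx.
  by have /eqP := H s.+1 sk; rewrite a0 mul0r add0r mulf_eq0 (negbTE b0) => /eqP.
elim: s sk => [|s IH] sk; have /eqP := H _ (ltnW sk).
  by rewrite mulr0 addr0 mulf_eq0 (negbTE a0) => /eqP.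
by rewrite IH ?(ltnW sk) // mulr0 addr0 mulf_eq0 (negbTE a0) => /eqP.
Qed.

(** The value 0 beyond the range lets the antidiagonal sums be written without an upper boundary
    case. *)
Definition nat_form k (l : 'I_k -> {mpoly K[n]}) (rho : 'I_n -> 'I_M) (s : nat) : {mpoly K[M]} :=
  if insub s is Some j then l j \mPo [tuple 'X_(rho i) | i < n] else 0.

Lemma nat_form_homog k (l : 'I_k -> {mpoly K[n]}) rho s : linear_forms l ->
  nat_form l rho s \is 1.-homog.
Proof.
move=> hl; rewrite /nat_form; case: insubP => [j _ _|_]; last exact: dhomog0.
by apply: (comp_homog (e := 1) (hl j)) => i; rewrite tnth_mktuple; exact: homogXi.
Qed.

Definition nat_val k (l : 'I_k -> {mpoly K[n]}) (w : vec K n) (s : nat) : K :=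
  if insub s is Some j then (l j).@[w] else 0.

Lemma nat_form_eval k (l : 'I_k -> {mpoly K[n]}) rho s q c w : linear_forms l ->
  (forall i, q (rho i) = c * w i) -> (nat_form l rho s).@[q] = c * nat_val l w s.
Proof.
move=> hl Hq; rewrite /nat_form /nat_val; case: insubP => [j _ _|_]; last by rewrite meval0 mulr0.
rewrite comp_mpoly_meval -[c in RHS]expr1 -(meval_scale _ _ (hl j)); apply: meval_eq => i.
by rewrite tnth_mktuple mevalXU.
Qed.

Lemma nat_val_big k (l : 'I_k -> {mpoly K[n]}) w s : (k <= s)%N -> nat_val l w s = 0.
Proof. by move=> ks; rewrite /nat_val insubN // -leqNgt. Qed.

Lemma orzero_forms Z k (l : 'I_k -> {mpoly K[n]}) w : avoids Z l -> orzero Z w ->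
  (forall s, nat_val l w s = 0) -> forall i, w i = 0.
Proof.
move=> [_ aZ] [Zw|//] H; have [j] := aZ w Zw.
by have := H j; rewrite /nat_val valK => ->; rewrite eqxx.
Qed.

(* For a rank one matrix (a,b)^T (e_0,...,e_k), the antidiagonal sums are the coefficients of
   (a + b T)(e_0 + ... + e_k T^k), so they vanish only if the matrix does. *)
Lemma segre_tilde_avoids Y k (l : 'I_k -> {mpoly K[n]}) : avoids Y l ->
  exists L : 'I_k.+2 -> {mpoly K[M]}, avoids (segre_tilde Y) L.
Proof.
move=> aY; have hl := aY.1.
pose A s := if s is s'.+1 then nat_form l (@ix n) s' else 'X_(iv n).
pose B s := if s is s'.+1 then nat_form l (@iy n) s' else 'X_(iu n).
have hA s : A s \is 1.-homog by case: s => [|s]; [exact: homogXi | exact: nat_form_homog].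
have hB s : B s \is 1.-homog by case: s => [|s]; [exact: homogXi | exact: nat_form_homog].
exists (fun j => A j + (if j is j'.+1 then B j' else 0) : {mpoly K[M]}); split.
  by case=> [[|j] lt]; apply: rpredD; first [exact: hA | exact: hB | exact: dhomog0].
move=> q /segre_tildeP[a [b [w0 [w [ab nz Yw Eq]]]]]; apply: NNPP => H.
pose e s := if s is s'.+1 then nat_val l w s' else w0.
have Ae s : (A s).@[q] = a * e s.
  case: s => [|s]; first by rewrite mevalXU Eq /segre_pt coordsE.
  by apply: nat_form_eval => // i; rewrite Eq /segre_pt coordsE.
have Be s : (B s).@[q] = b * e s.
  case: s => [|s]; first by rewrite mevalXU Eq /segre_pt coordsE.
  by apply: nat_form_eval => // i; rewrite Eq /segre_pt coordsE.
have e0 : forall s, e s = 0.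
  apply: (antidiagonal_zero (k := k.+1) ab).
    by case=> // s; rewrite ltnS => ks; exact: nat_val_big.
  move=> j jk; apply/eqP/negP => /negP nj; apply: H; exists (inord j).
  rewrite inordK // mevalD Ae; case: j jk nj => [|j] _ /=; first by rewrite meval0 mulr0.
  by rewrite Be.
case: nz => [|[i wi]]; first by rewrite -[w0]/(e 0%N) e0 eqxx.
by rewrite (orzero_forms aY Yw (fun s => e0 s.+1)) eqxx in wi.
Qed.

(** The coordinates [u] and [v] remove the vertex line; the [k.+1] antidiagonal sums of the
    remaining 2 x k matrix do the rest. *)
Lemma cone_segre_avoids Z k (l : 'I_k -> {mpoly K[n]}) : zclosed Z -> (exists z, Z z) ->
  avoids Z l -> exists L : 'I_k.+3 -> {mpoly K[M]}, avoids (cone_segre Z) L.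
Proof.
move=> cZ neZ aZ; have hl := aZ.1.
pose A s := nat_form l (@ix n) s; pose B s := nat_form l (@iy n) s.
have hA s : A s \is 1.-homog by exact: nat_form_homog.
have hB s : B s \is 1.-homog by exact: nat_form_homog.
pose L (j : nat) : {mpoly K[M]} := match j with
  | 0 => 'X_(iu n) | 1 => 'X_(iv n) | j.+2 => A j + (if j is j'.+1 then B j' else 0) end.
exists (fun j => L j); split.
  case=> [[|[|[|j]]] lt]; rewrite /L /=; try exact: homogXi; apply: rpredD;
    first [exact: hA | exact: hB | exact: dhomog0].
move=> q /(cone_segreP _ cZ neZ)[nq [u [v [a [b [w [ab Zw Eq]]]]]]]; apply: NNPP => H.
have L0 j : (j < k.+3)%N -> (L j).@[q] = 0.
  move=> jk; apply/eqP/negP => /negP nj; apply: H; exists (Ordinal jk); exact: nj.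
have u0 : u = 0 by have := L0 0%N isT; rewrite /= mevalXU Eq /cone_pt coordsE.
have v0 : v = 0 by have := L0 1%N isT; rewrite /= mevalXU Eq /cone_pt coordsE.
have Ae s : (A s).@[q] = a * nat_val l w s by apply: nat_form_eval => // i; rewrite Eq /cone_pt coordsE.
have Be s : (B s).@[q] = b * nat_val l w s by apply: nat_form_eval => // i; rewrite Eq /cone_pt coordsE.
have w0 : forall i, w i = 0.
  apply: (orzero_forms aZ Zw); apply: (antidiagonal_zero (k := k) ab).
    by move=> s; exact: nat_val_big.
  move=> j jk; have := L0 j.+2; rewrite !ltnS => /(_ jk); rewrite /L mevalD Ae.
  by case: j jk => [|j] _; rewrite ?meval0 ?mulr0 ?Be.
case: nq => s; rewrite Eq u0 v0.
by elim/coordP: s => [||i|i]; rewrite /cone_pt coordsE ?w0 ?mulr0 eqxx.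
Qed.
End Varieties.

(** * Dimensions of the cones *)


Section Dimensions.
Variables (K : closedFieldType) (n : nat).
Local Notation M := ((2 * n).+2).
Implicit Types (Y Z : pset K n).

(** The hypothesis says that [S] contains a projective space of dimension [k], on which any [k]
    linear forms have a common zero. *)
Lemma span_meets k N (v : 'I_k.+1 -> vec K N) (S : pset K N) :
  (forall c : 'I_k.+1 -> K, (exists i, c i != 0) -> nonzero (fun s => \sum_i c i * v i s) /\
     S (fun s => \sum_i c i * v i s)) ->
  meets_codim k (zclosure S).
Proof.
move=> H l hl; have [c [cn lc]] := kernel_combination v hl; have [nq Sq] := H c cn.
by exists (fun s => \sum_i c i * v i s); split=> //; exact: zclosure_sub.
Qed.

Lemma segre_tilde_sub Y Z : psubset Y Z -> psubset (segre_tilde Y) (segre_tilde Z).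
Proof.
move=> YZ q /segre_tildeP[a [b [w0 [w [ab nz Yw ->]]]]]; apply/segre_tildeP.
by exists a, b, w0, w; split=> //; case: Yw => [/YZ|]; [left|right].
Qed.

Lemma cone_segre_sub Y Z : psubset Y Z -> psubset (cone_segre Y) (cone_segre Z).
Proof.
move=> YZ q; rewrite !cone_segre_raw => -[nq H]; split=> // p hp pS; apply: H => // s.
by move=> [u [v [a [b [z [ab /YZ Zz ->]]]]]]; apply: pS; exists u, v, a, b, z.
Qed.

(** Recovers [Z] from a slice of its Segre cone; this keeps the inclusions in [segre_tilde_chain]
    strict. *)
Lemma segre_tilde_slice Z a z : zclosed Z -> a != 0 -> nonzero z ->
  segre_tilde Z (segre_pt a 0 0 z) -> Z z.
Proof.
move=> cZ a0 [i zi] /segre_tildeP[a' [b' [w0 [w [_ _ Zw E]]]]].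
have Ez : (fun i => a * z i) = (fun i => a' * w i).
  apply: functional_extensionality => j.
  by have := congr1 (fun q => q (ix j)) E; rewrite /segre_pt !coordsE.
have : orzero Z z.
  by apply: (orzero_unscale cZ a0); rewrite Ez; exact: orzero_scale.
by case=> // z0; rewrite z0 eqxx in zi.
Qed.

Lemma cone_segre_slice Z z : zclosed Z -> (exists z, Z z) -> nonzero z ->
  cone_segre Z (cone_pt 0 0 1 0 z) -> Z z.
Proof.
move=> cZ neZ [i zi] /(cone_segreP _ cZ neZ)[_ [u [v [a [b [w [_ Zw E]]]]]]].
have Ez : z = (fun i => a * w i).
  apply: functional_extensionality => j.
  by have := congr1 (fun q => q (ix j)) E; rewrite /cone_pt !coordsE mul1r.
have : orzero Z z by rewrite Ez; exact: orzero_scale.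
by case=> // z0; rewrite z0 eqxx in zi.
Qed.

Lemma cone_segre_mem Z u v a b z : zclosed Z -> a != 0 \/ b != 0 -> Z z ->
  cone_segre Z (cone_pt u v a b z).
Proof.
move=> cZ ab Zz; rewrite cone_segre_raw; have R : cone_raw Z (cone_pt u v a b z).
  by exists u, v, a, b, z.
by apply: zclosure_sub => //; exact: cone_raw_nonzero R.
Qed.

(** The vertex of the cone over [Z] sweeps out a line under the factor P^1. This line carries a
    chain of length 1 and lies strictly inside the irreducible Segre product. *)
Lemma segre_tilde_chain_base Z : zclosed Z -> pirreducible Z -> has_chain (segre_tilde Z) 2.
Proof.
move=> cZ iZ; have [[z Zz] _] := iZ; have cS := segre_tilde_closed cZ.
have [i zi] := zclosed_nonzero cZ Zz.
pose S : pset K M := fun q => exists u v, (u != 0 \/ v != 0) /\ q = coords u v (fun=> 0) (fun=> 0).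
apply: (@has_chain_extend K M _ (zclosure S) (segre_tilde Z) 1) => //.
- exact: segre_tilde_irreducible.
- apply: has_chain_of_meets; first exact: zclosure_closed.
  apply: (@span_meets 1 M (fun i => if i == ord0 then coords 1 0 (fun=> 0) (fun=> 0)
     else coords 0 1 (fun=> 0) (fun=> 0))) => c [j cj].
  have E : (fun s : 'I_M => \sum_(i0 < 2) c i0 * (if i0 == ord0 then coords 1 0 (fun=> 0) (fun=> 0)
     else coords 0 1 (fun=> 0) (fun=> 0)) s) = coords (c ord0) (c (lift ord0 ord0)) (fun=> 0) (fun=> 0).
    by apply: coords_eq => *; rewrite big_ord_recl big_ord1 /= !coordsE; ring.
  have cc : c ord0 != 0 \/ c (lift ord0 ord0) != 0.
    by case: (unliftP ord0 j) cj => [j' ->|->]; rewrite ?(ord1 j'); [right|left].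
  rewrite E; split; last by exists (c ord0), (c (lift ord0 ord0)).
  by apply/coords_nonzeroP; case: cc; [constructor 1 | constructor 2].
- apply: zclosure_min => // q [u [v [uv ->]]]; apply/segre_tildeP.
  exists v, u, 1, (fun=> 0); split.
  + by case: uv; [right|left].
  + by left; exact: oner_neq0.
  + by right.
  + by apply/esym/coords_eq => *; rewrite /segre_pt coordsE ?mulr1 ?mulr0.
- exists (segre_pt 1 0 0 z); split; first by apply: segre_tilde_mem => //; left; exact: oner_neq0.
  move/(closure_coord (i := ix i)) => H; case/eqP: zi.
  by have := H _; rewrite /segre_pt coordsE mul1r => -> // s [u [v [_ ->]]]; rewrite coordsE.
Qed.

Lemma segre_tilde_chain Y d : zclosed Y -> has_chain Y d -> has_chain (segre_tilde Y) d.+2.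
Proof.
move=> cY [Zs [H1 H2]].
have [_ [_ sub]] := H1 d (leqnn d).
apply: (has_chain_sub (segre_tilde_sub sub)).
have : (d <= d)%N by []; elim: {1 3 4}d => [|i IH] lt.
  by have [cZ [iZ _]] := H1 0%N lt; exact: segre_tilde_chain_base.
have [cA _] := H1 i (ltnW lt); have [cB [iB _]] := H1 _ lt.
have [AB [z [Bz nAz]]] := H2 _ lt; have nz := zclosed_nonzero cB Bz.
apply: (@has_chain_extend K M _ (segre_tilde (Zs i)) (segre_tilde (Zs i.+1))) => //.
- exact: segre_tilde_closed.
- exact: segre_tilde_irreducible.
- exact: IH (ltnW lt).
- exact: segre_tilde_sub.
exists (segre_pt 1 0 0 z); split; first by apply: segre_tilde_mem => //; left; exact: oner_neq0.
by move=> H; apply: nAz; apply: segre_tilde_slice H => //; exact: oner_neq0.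
Qed.

(** The vertex line and the point (z : 0) span a plane, which carries a chain of length 2 and misses
    (0 : z). *)
Lemma cone_segre_chain_base Z : zclosed Z -> pirreducible Z -> has_chain (cone_segre Z) 3.
Proof.
move=> cZ iZ; have [[z Zz] _] := iZ.
have cS : zclosed (cone_segre Z) by rewrite cone_segre_raw; exact: zclosure_closed.
have nz := zclosed_nonzero cZ Zz; have [i zi] := nz.
pose S : pset K M := fun q => nonzero q /\ exists u v a, q = coords u v (fun i => a * z i) (fun=> 0).
apply: (@has_chain_extend K M _ (zclosure S) (cone_segre Z) 2) => //.
- exact: cone_segre_irreducible.
- apply: has_chain_of_meets; first exact: zclosure_closed.
  pose w (i : 'I_3) : vec K M := nth (fun=> 0) [:: coords 1 0 (fun=> 0) (fun=> 0);
    coords 0 1 (fun=> 0) (fun=> 0); coords 0 0 z (fun=> 0)] i.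
  apply: (@span_meets 2 M w) => c [j cj].
  pose c0 := c ord0; pose c1 := c (lift ord0 ord0); pose c2 := c (lift ord0 (lift ord0 ord0)).
  have E : (fun s : 'I_M => \sum_i c i * w i s) = coords c0 c1 (fun i => c2 * z i) (fun=> 0).
    by apply: coords_eq => *; rewrite !big_ord_recl big_ord0 /w /= !coordsE /c0 /c1 /c2; ring.
  have cc : [\/ c0 != 0, c1 != 0 | c2 != 0].
    case: (unliftP ord0 j) cj => [j' ->|->]; last by constructor 1.
    by case: (unliftP ord0 j') => [j'' ->|->]; rewrite ?(ord1 j''); [constructor 3|constructor 2].
  have nq : nonzero (coords c0 c1 (fun i => c2 * z i) (fun=> 0)).
    apply/coords_nonzeroP; case: cc; [by constructor 1 | by constructor 2 | move=> c20].
    by constructor 3; exists i; rewrite mulf_neq0.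
  by rewrite E; split=> //; split=> //; exists c0, c1, c2.
- apply: zclosure_min => // q [nq [u [v [a Eq]]]]; apply/(cone_segreP _ cZ (ex_intro _ z Zz)).
  split=> //; case: (eqVneq a 0) => [a0|a0].
    exists u, v, 1, 0, (fun=> 0); split; [left; exact: oner_neq0|by right|].
    by rewrite Eq /cone_pt; congr coords; apply: functional_extensionality => j; rewrite ?a0 ?mul0r ?mulr0.
  exists u, v, a, 0, z; split; [by left|by left|].
  by rewrite Eq /cone_pt; congr coords; apply: functional_extensionality => j; rewrite mul0r.
- exists (cone_pt 0 0 0 1 z); split; first by apply: cone_segre_mem => //; right; exact: oner_neq0.
  move/(closure_coord (i := iy i)) => H; case/eqP: zi.
  by have := H _; rewrite /cone_pt coordsE mul1r => -> // s [_ [u [v [a ->]]]]; rewrite coordsE.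
Qed.

Lemma cone_segre_chain Z d : zclosed Z -> has_chain Z d -> has_chain (cone_segre Z) d.+3.
Proof.
move=> cZ [Zs [H1 H2]].
have [_ [_ sub]] := H1 d (leqnn d).
apply: (has_chain_sub (cone_segre_sub sub)).
have : (d <= d)%N by []; elim: {1 3 4}d => [|i IH] lt.
  by have [cZ0 [iZ _]] := H1 0%N lt; exact: cone_segre_chain_base.
have [cA [[neA _] _]] := H1 i (ltnW lt); have [cB [iB _]] := H1 _ lt.
have [AB [z [Bz nAz]]] := H2 _ lt; have nz := zclosed_nonzero cB Bz.
apply: (@has_chain_extend K M _ (cone_segre (Zs i)) (cone_segre (Zs i.+1))) => //.
- by rewrite cone_segre_raw; exact: zclosure_closed.
- exact: cone_segre_irreducible.
- exact: IH (ltnW lt).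
- exact: cone_segre_sub.
exists (cone_pt 0 0 1 0 z); split; first by apply: cone_segre_mem => //; left; exact: oner_neq0.
by move=> H; apply: nAz; apply: cone_segre_slice H.
Qed.

Lemma no_chain_avoids N (X : pset K N) k : zclosed X -> ~ has_chain X k ->
  exists l : 'I_k -> {mpoly K[N]}, avoids X l.
Proof. by move=> cX nX; apply: meets_codimPn => mX; apply: nX; exact: has_chain_of_meets. Qed.

Lemma has_chain_nonempty N (X : pset K N) k : has_chain X k -> exists x, X x.
Proof. by case=> Z [H _]; have [_ [[[x Zx] _] ZX]] := H 0%N (leq0n k); exists x; exact: ZX. Qed.

Theorem segre_tilde_dim Y d : zclosed Y -> has_dim Y d -> has_dim (segre_tilde Y) d.+2.
Proof.
move=> cY [chY nY]; split; first exact: segre_tilde_chain.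
have [l al] := no_chain_avoids cY nY; have [L aL] := segre_tilde_avoids al.
exact: no_chain_of_avoids (segre_tilde_closed cY) aL.
Qed.

Theorem cone_segre_dim Z d : zclosed Z -> has_dim Z d -> has_dim (cone_segre Z) d.+3.
Proof.
move=> cZ [chZ nZ]; split; first exact: cone_segre_chain.
have [l al] := no_chain_avoids cZ nZ.
have [L aL] := cone_segre_avoids cZ (has_chain_nonempty chZ) al.
apply: no_chain_of_avoids aL; rewrite cone_segre_raw; exact: zclosure_closed.
Qed.

End Dimensions.

Lemma whole_closed (K : fieldType) n : zclosed (@whole K n).
Proof. by move=> x; split=> [[]|nx] //; exact: zclosure_sub. Qed.

Lemma whole_dim (K : closedFieldType) n : has_dim (@whole K n.+1) n.
Proof.
have cW := @whole_closed K n.+1.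
have aX : avoids (@whole K n.+1) (fun i => 'X_i : {mpoly K[n.+1]}).
  split; first by move=> i; exact: homogXi.
  by move=> x [i xi]; exists i; rewrite mevalXU.
split; last exact: no_chain_of_avoids cW aX.
apply: has_chain_of_meets => // l hl.
have [c [[i ci] lc]] := kernel_combination (fun i s : 'I_n.+1 => (s == i)%:R) hl.
exists (fun s => \sum_i c i * (s == i)%:R); split=> //.
exists i; rewrite (bigD1 i) //= eqxx mulr1 big1 ?addr0 // => j.
by rewrite eq_sym => /negbTE ->; rewrite mulr0.
Qed.

(** * Polar maps *)


Section PolarMap.
Variables (K : closedFieldType) (n : nat) (g : {mpoly K[n]}).
Local Notation M := ((2 * n).+2).
Local Notation f := (fpoly g).

Definition dot (x y : vec K n) : K := \sum_i x i * y i.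

Lemma fpoly_eval u v (x y : vec K n) :
  f.@[coords u v x y] = g.@[fun i => u * x i - v * y i].
Proof.
rewrite comp_mpoly_meval; apply: meval_eq => i.
by rewrite tnth_mktuple mevalB !mevalM !mevalXU !coordsE.
Qed.

Lemma coord_eqE :
  [/\ (iu n == iv n) = false, forall i, (iu n == ix i) = false, forall i, (iu n == iy i) = false,
      forall i, (iv n == ix i) = false & forall i, (iv n == iy i) = false].
Proof.
split=> [|i|i|i|i]; rewrite -val_eqE /= ?val_iu ?val_iv ?val_ix ?val_iy //; lia.
Qed.

Lemma ix_iy_eqE (i j : 'I_n) :
  [/\ (ix i == ix j) = (i == j), (iy i == iy j) = (i == j) & (ix i == iy j) = false].
Proof.
split; rewrite -val_eqE /= ?val_ix ?val_iy ?eqn_add2l //.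
have lt := ltn_ord i; apply/eqP => E.
have : (2 + i < 2 + n + j)%N by rewrite -addnA ltn_add2l ltn_addr.
by rewrite E ltnn.
Qed.

Lemma grad_fpoly u v (x y : vec K n) : let w := grad g (fun i => u * x i - v * y i) in
  grad f (coords u v x y) = coords (dot x w) (- dot y w) (fun i => u * w i) (fun i => - v * w i).
Proof.
move=> w; set q := coords u v x y.
have gradE s : grad f q s = \sum_i w i *
    (((iu n == s)%:R * x i + u * (ix i == s)%:R) - ((iv n == s)%:R * y i + v * (iy i == s)%:R)).
  rewrite /grad mderiv_comp raddf_sum; apply: eq_bigr => i _ /=.
  rewrite mevalM comp_mpoly_meval; congr (_ * _).
    by apply: meval_eq => j; rewrite tnth_mktuple mevalB !mevalM !mevalXU /q !coordsE.
  rewrite tnth_mktuple mderivB !mderivM !mderiv_var mevalB !mevalD !mevalM !mevalXU !rmorph_nat.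
  by rewrite /q !coordsE.
have [uv ux uy vx vy] := coord_eqE.
have sumD (a : K) (i : 'I_n) : \sum_j w j * (a * (j == i)%:R) = a * w i.
  rewrite (bigD1 i) //= eqxx mulr1 big1 ?addr0 1?mulrC // => j /negbTE ->.
  by rewrite !mulr0.
apply: coords_eq => [||i|i]; rewrite gradE.
- apply: eq_bigr => i _; rewrite eqxx [ix i == _]eq_sym ux [iv n == _]eq_sym uv [iy i == _]eq_sym uy /=; ring.
- rewrite -sumrN; apply: eq_bigr => i _.
  rewrite eqxx uv [ix i == _]eq_sym vx [iy i == _]eq_sym vy /=; ring.
- rewrite -sumD; apply: eq_bigr => j _; have [E1 E2 E3] := ix_iy_eqE j i.
  have [_ _ E4] := ix_iy_eqE i j.
  rewrite ux vx E1 [iy j == _]eq_sym E4 /=; ring.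
- rewrite -sumD; apply: eq_bigr => j _; have [E1 E2 E3] := ix_iy_eqE j i.
  rewrite uy vy E2 E3 /=; ring.
Qed.

Lemma dot_surj (G : vec K n) c : nonzero G -> exists y, dot y G = c.
Proof.
move=> [j Gj]; exists (fun i => (i == j)%:R * (c / G j)); rewrite /dot (bigD1 j) //= eqxx.
by rewrite big1 => [|i /negbTE ->]; rewrite ?mul0r // addr0 mul1r divfK.
Qed.

Lemma dot_comb a b (x y G : vec K n) : dot (fun i => a * x i + b * y i) G = a * dot x G + b * dot y G.
Proof.
by rewrite /dot !mulr_sumr -big_split; apply: eq_bigr => i _; rewrite mulrDl !mulrA.
Qed.

(** If [b] is non-zero, choose [x] with the prescribed pairing and solve for [y]; the hypothesis
    makes the pairing of [y] come out right. If [a] is non-zero the roles are exchanged. *)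
Lemma solve_incidence a b (G z : vec K n) U V : a != 0 \/ b != 0 -> nonzero G ->
  a * U + b * V = dot z G -> exists x y,
  [/\ (fun i => a * x i + b * y i) = z, dot x G = U & dot y G = V].
Proof.
move=> ab nG E; case: (eqVneq a 0) => [a0|a0].
  have b0 : b != 0 by case: ab => //; rewrite a0 eqxx.
  have [x xG] := dot_surj U nG; exists x, (fun i => 0 * x i + b^-1 * z i); split=> //.
    by apply: functional_extensionality => i; rewrite a0 !mul0r !add0r mulVKf.
  by rewrite dot_comb -E a0 !mul0r !add0r mulKf.
have [y yG] := dot_surj V nG; exists (fun i => a^-1 * z i + (- (b / a)) * y i), y; split=> //.
  by apply: functional_extensionality => i; field.
by rewrite dot_comb -E yG; field.
Qed.

Section Homogeneous.
Variable d : nat.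
Hypothesis hg : g \is d.+2.-homog.

Lemma grad_scale c z : grad g (fun i => c * z i) = (fun i => c ^+ d.+1 * grad g z i).
Proof.
apply: functional_extensionality => i; rewrite /grad (@meval_scale _ _ d.+1) //.
exact: mderiv_homog.
Qed.

Lemma grad_nonzero z : nonzero (grad g z) -> nonzero z.
Proof.
move=> [i Gi]; apply: NNPP => /nonzeroPn z0; case/eqP: Gi.
exact: homog_eval0 (mderiv_homog i hg) z0.
Qed.

Lemma dot_grad z : dot z (grad g z) = d.+2%:R * g.@[z].
Proof. exact: euler_eval. Qed.

(** The preimage has [u = a] and [v = - b], as the last block of the gradient of [f] is [- v * w];
    the hypothesis is Euler's relation read at the target point. *)
Lemma grad_realize a b z U V : a != 0 \/ b != 0 -> nonzero (grad g z) ->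
  a * U - b * V = d.+2%:R * g.@[z] -> exists q,
  [/\ nonzero q, f.@[q] = g.@[z] & grad f q = cone_pt U V a b (grad g z)].
Proof.
move=> ab nG E; have [|x [y [Ez xG yG]]] := @solve_incidence a b (grad g z) z U (- V) ab nG.
  by rewrite dot_grad -E mulrN.
have Ez' : (fun i => a * x i - - b * y i) = z.
  by rewrite -Ez; apply: functional_extensionality => i; rewrite mulNr opprK.
exists (coords a (- b) x y); split.
- by apply/coords_nonzeroP; case: ab => [a0|b0]; [constructor 1 | constructor 2; rewrite oppr_eq0].
- by rewrite fpoly_eval Ez'.
- by rewrite grad_fpoly Ez' xG yG !opprK.
Qed.

(* If u = v = 0 then the gradient of f vanishes, because that of g does at the origin. *)
Lemma grad_fpoly_nonzero u v x y : nonzero (grad f (coords u v x y)) ->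
  (u != 0 \/ - v != 0) /\ nonzero (grad g (fun i => u * x i - v * y i)).
Proof.
rewrite grad_fpoly; set w := grad g _ => nz.
have nw : nonzero w.
  apply: NNPP => /nonzeroPn w0.
  have dw (t : vec K n) : dot t w = 0 by rewrite /dot big1 // => i _; rewrite w0 mulr0.
  move: nz => /coords_nonzeroP; rewrite !dw oppr0 eqxx.
  by case=> // -[i]; rewrite w0 mulr0 eqxx.
split=> //; have [i] := grad_nonzero nw => nz'.
case: (eqVneq u 0) => [u0|]; last by left.
case: (eqVneq v 0) => [v0|v0]; last by right; rewrite oppr_eq0.
by rewrite u0 v0 !mul0r subrr eqxx in nz'.
Qed.

Lemma polar_image_sub_cone : psubset (polar_image f) (cone_segre (polar_image g)).
Proof.
rewrite cone_segre_raw; apply: zclosure_min; first exact: zclosure_closed.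
move=> _ [q [nq [nG ->]]]; rewrite (coords_eta q) in nG *.
have [uv nw] := grad_fpoly_nonzero nG.
apply: zclosure_sub => //; rewrite grad_fpoly.
do 5 eexists; split; [exact: uv | | reflexivity].
by apply: zclosure_sub => //; eexists; split; [exact: grad_nonzero nw | split; [exact: nw|]].
Qed.

Lemma dual_sub_segre : psubset (dual_variety f) (segre_tilde (dual_variety g)).
Proof.
apply: zclosure_min; first exact/segre_tilde_closed/zclosure_closed.
move=> _ [q [[nq gz] [nG ->]]].
have [u [v [x [y Eq]]]] : exists u v x y, q = coords u v x y by do 4 eexists; exact: coords_eta.
rewrite Eq in gz nG *; have [uv nw] := grad_fpoly_nonzero nG; rewrite fpoly_eval in gz.
rewrite grad_fpoly; pose z i := u * x i - v * y i.
rewrite -/z in nw gz *; set w := grad g z in nw *.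
have E : u * dot x w + - v * dot y w = 0.
  rewrite -dot_comb (_ : (fun i => u * x i + - v * y i) = z); first by rewrite /w dot_grad gz mulr0.
  by apply: functional_extensionality => i; rewrite mulNr.
(* By [E], the pair (x.w, -y.w) is a multiple of (-v, u). The factor [w0], found by dividing by a
   non-zero one of the two, is the extra coordinate of the cone over [Y]. *)
have [w0 [Ew1 Ew2]] : exists w0, dot x w = - v * w0 /\ - dot y w = u * w0.
  case: (eqVneq u 0) => [u0|u0].
    have v0 : - v != 0 by case: uv => //; rewrite u0 eqxx.
    exists (dot x w / - v); split; first by rewrite mulrC divfK.
    move: E; rewrite u0 !mul0r add0r => /eqP; rewrite mulf_eq0 (negbTE v0) => /eqP ->.
    by rewrite oppr0.
  exists (- dot y w / u); split; last by rewrite mulrC divfK.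
  apply: (mulfI u0); apply/eqP; rewrite -subr_eq0; apply/eqP; rewrite -[RHS]E; field.
  exact: u0.
rewrite Ew1 Ew2; apply: segre_tilde_mem => //; first exact: zclosure_closed.
apply: zclosure_sub => //; exists z; split=> //; split=> //; exact: grad_nonzero nw.
Qed.

Hypothesis smooth : exists z, g.@[z] = 0 /\ nonzero (grad g z).

(** With [a], [b], [w0] fixed, a form vanishing on the gradients becomes an inhomogeneous polynomial
    in [w]. On multiples [t] of gradients at zeros of [g] it vanishes: dividing the point by [t]
    turns [w0] into [w0 / t], and the incidence relation still holds because both of its sides are
    0. *)
Lemma segre_sub_dual : psubset (segre_tilde (dual_variety g)) (dual_variety f).
Proof.
move=> q Sq; have nq := zclosed_nonzero (segre_tilde_closed (zclosure_closed _)) Sq.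
move/segre_tildeP: Sq => [a [b [w0 [w [ab nz Yw Eq]]]]].
split=> // p [e hp] pS.
have [P HP] : polyfun (fun w : vec K n => p.@[segre_pt a b w0 w]).
  apply: polyfun_comp => s; exact: (segre_param_polyr (vec3 a b w0) s).
rewrite Eq HP.
pose S : pset K n := fun y => exists x, V g x /\ nonzero (grad g x) /\ y = grad g x.
have [cl0 cl1] : (forall x, zclosure S x -> P.@[x] = 0) /\
    ((exists s, S s) -> forall x, (forall i, x i = 0) -> P.@[x] = 0).
  apply: cone_vanish => _ t [z [[_ gz] [nG ->]]] t0; rewrite -HP.
  have -> : segre_pt a b w0 (fun i => t * grad g z i) =
      (fun s => t * cone_pt (b * (w0 / t)) (a * (w0 / t)) a b (grad g z) s).
    have tE c : c * w0 = t * (c * (w0 / t)) by field.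
    rewrite coords_scale /segre_pt; congr (coords _ _ _ _); [exact: tE|exact: tE| |];
      by apply: functional_extensionality => i; exact: mulrCA.
  rewrite (meval_scale _ _ hp).
  have [|x [nx fx Gx]] := @grad_realize a b z (b * (w0 / t)) (a * (w0 / t)) ab nG.
    by rewrite gz mulr0; ring.
  rewrite pS ?mulr0 //; exists x; split; first by split=> //; rewrite fx.
  rewrite Gx; split=> //; apply/coords_nonzeroP; have [i Gi] := nG.
  by case: ab => c0; [constructor 3 | constructor 4]; exists i; rewrite mulf_neq0.
(* A point over the vertex is covered by the constant-term clause of [cone_vanish], which needs at
   least one gradient; the smooth point provides it. *)
case: Yw => [/cl0 //|w_0]; apply: cl1 w_0; have [z [gz nG]] := smooth.
by exists (grad g z), z; split=> //; split=> //; exact: grad_nonzero nG.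
Qed.

Hypothesis dg0 : d.+2%:R != 0 :> K.

(* Euler's relation makes a u - b v = d g(z) the only constraint; it is met after rescaling z. *)
Lemma polar_vanish_generic (p : {mpoly K[M]}) e u v a b z : p \is e.-homog ->
  (forall x, nonzero x -> nonzero (grad f x) -> p.@[grad f x] = 0) ->
  g.@[z] != 0 -> a * u - b * v != 0 -> p.@[cone_pt u v a b (grad g z)] = 0.
Proof.
move=> hp pS gz uv.
have ab : a != 0 \/ b != 0.
  case: (eqVneq a 0) => [a0|]; last by left.
  by right; apply: contraNneq uv => ->; rewrite a0 !mul0r subrr.
have nG : nonzero (grad g z).
  apply: NNPP => /nonzeroPn G0; have /eqP := dot_grad z.
  rewrite /dot big1 => [|i _]; last by rewrite G0 mulr0.
  by rewrite eq_sym mulf_eq0 (negbTE dg0) (negbTE gz).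
have nG' := nG; have [i Gi] := nG'.
(* Rescaling [z] by [t] multiplies the gradient by [t ^+ d.+1] and [g] by [t ^+ d.+2], so Euler's
   relation for the point scaled by [lam] determines this [t]. *)
pose t := (a * u - b * v) / (d.+2%:R * g.@[z]).
have t0 : t != 0 by rewrite mulf_neq0 // invr_neq0 // mulf_neq0.
pose lam := t ^+ d.+1; have lam0 : lam != 0 by rewrite expf_neq0.
have nG1 : nonzero (grad g (fun i => t * z i)).
  by rewrite grad_scale; exists i; rewrite mulf_neq0.
have [|x [nx fx Gx]] := @grad_realize a b _ (lam * u) (lam * v) ab nG1.
  have tE : t * (d.+2%:R * g.@[z]) = a * u - b * v by rewrite divfK // mulf_neq0.
  transitivity (lam * (a * u - b * v)); first by ring.
  rewrite -tE (meval_scale _ _ hg) [t ^+ d.+2]exprSr -/lam.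
  have aux (x1 x2 x3 x4 : K) : x1 * (x2 * (x3 * x4)) = x3 * (x1 * x2 * x4) by ring.
  exact: aux.
have E : grad f x = (fun s => lam * cone_pt u v a b (grad g z) s).
  rewrite Gx coords_scale grad_scale /cone_pt -/lam; congr coords;
    apply: functional_extensionality => j; exact: mulrCA.
have nx' : nonzero (grad f x).
  rewrite Gx; apply/coords_nonzeroP; move: nG1 => [j Gj].
  by case: ab => c0; [constructor 3 | constructor 4]; exists j; rewrite mulf_neq0.
have /eqP := pS x nx nx'; rewrite E (meval_scale _ _ hp) mulf_eq0 expf_eq0 (negbTE lam0) andbF.
by move/eqP.
Qed.

(** Both genericity assumptions are removed by density, first on the parameters for fixed [z], then
    on [z]. *)
Lemma polar_vanish (p : {mpoly K[M]}) e u v a b z : p \is e.-homog ->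
  (forall x, nonzero x -> nonzero (grad f x) -> p.@[grad f x] = 0) ->
  p.@[cone_pt u v a b (grad g z)] = 0.
Proof.
move=> hp pS.
have H1 z0 t : g.@[z0] != 0 -> p.@[cone_param t (grad g z0)] = 0.
  move=> gz; apply/eqP/negP => /negP nz.
  pose kap (t : vec K 4) := t (o4 (k:=2) isT) * t (o4 (k:=0) isT) - t (o4 (k:=3) isT) * t (o4 (k:=1) isT).
  have pk : polyfun kap.
    by apply: polyfunD; [|apply: polyfunN]; apply: polyfunM; exact: polyfun_var.
  have pp : polyfun (fun t => p.@[cone_param t (grad g z0)]).
    by apply: polyfun_comp => s; exact: cone_param_polyl.
  have k1 : kap (vec4 1 0 1 0) != 0 by rewrite /kap /vec4 /= mulr1 mul0r subr0 oner_neq0.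
  have [t' [pt kt]] := polyfun_generic pp pk nz k1.
  by rewrite /cone_param (polar_vanish_generic hp pS gz kt) eqxx in pt.
have g0 : g != 0.
  have [z0 [_ [i Gi]]] := smooth; apply: contraNneq Gi => ->.
  by rewrite /grad mderiv0 meval0.
have [z1 gz1] := mpoly_nonvanishing g0.
apply/eqP/negP => /negP nz.
have pg : polyfun (fun z => g.@[z]) by exists g.
have pp : polyfun (fun z => p.@[cone_param (vec4 u v a b) (grad g z)]).
  apply: polyfun_comp; apply: polyfun_coords => *; try exact: polyfun_const.
    by apply: polyfunM; [exact: polyfun_const | eexists].
  by apply: polyfunM; [exact: polyfun_const | eexists].
have [z2 [pz gz]] := polyfun_generic (t1 := z) pp pg nz gz1.
by rewrite H1 ?eqxx in pz.
Qed.

Lemma cone_sub_polar_image : psubset (cone_segre (polar_image g)) (polar_image f).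
Proof.
rewrite cone_segre_raw; apply: zclosure_min; first exact: zclosure_closed.
move=> q Rq; split; first exact: (cone_raw_nonzero (zclosure_closed _) Rq).
move: Rq => [u [v [a [b [w [ab Zw ->]]]]]] p [e hp] pS.
have pS' x : nonzero x -> nonzero (grad f x) -> p.@[grad f x] = 0.
  by move=> nx nG; apply: pS; exists x.
have [P HP] : polyfun (fun w : vec K n => p.@[cone_pt u v a b w]).
  apply: polyfun_comp => s; exact: (cone_param_polyr (vec4 u v a b) s).
pose S : pset K n := fun y => exists x, nonzero x /\ nonzero (grad g x) /\ y = grad g x.
have PS s t : S s -> t != 0 -> P.@[fun i => t * s i] = 0.
  move=> [z [_ [_ ->]]] t0; rewrite -HP.
  have -> : cone_pt u v a b (fun i => t * grad g z i) = cone_pt u v (a * t) (b * t) (grad g z).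
    by congr coords; apply: functional_extensionality => i; rewrite mulrA.
  exact: polar_vanish hp pS'.
by rewrite HP; exact: (cone_vanish PS).1.
Qed.
End Homogeneous.

(** * Polynomials with non-vanishing hessian *)

Section Hessian.
Hypothesis char0 : [pchar K] =i pred0.
Let T := [tuple g^`M(i) | i < n].

(** Differentiating a relation [p] between the partial derivatives gives a row vector killed by the
    hessian matrix. So the derivatives of [p] are relations of smaller size, hence zero by
    induction, and [p] is a constant equal to 0. *)
Lemma hessian_gradient_independent (p : {mpoly K[n]}) : hessian_det g != 0 ->
  p \mPo T = 0 -> p = 0.
Proof.
move=> H0; have [m] := ubnP (msize p); elim: m p => // m IH p pm pT.
have dp0 i : p^`M(i) = 0.
  case: (eqVneq p^`M(i) 0) => [//|nz]; apply: IH.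
    rewrite -(mlead_deg nz); have := mlead_supp nz.
    rewrite mcoeff_msupp mcoeff_deriv => c0.
    have /msize_mdeg_lt : (mlead p^`M(i) + U_(i))%MM \in msupp p.
      by rewrite mcoeff_msupp; apply: contraNneq c0 => ->; rewrite mul0rn.
    by rewrite mdegD mdeg1 addn1 => lt; apply: leq_trans lt _; rewrite -ltnS.
  pose r := \row_i (p^`M(i) \mPo T) : 'rV[{mpoly K[n]}]_n.
  pose H := \matrix_(i < n, j < n) mderiv j (mderiv i g).
  have rH : r *m H = 0.
    apply/rowP => j; rewrite !mxE; transitivity ((p \mPo T)^`M(j)); last by rewrite pT mderiv0.
    rewrite mderiv_comp; apply: eq_bigr => k _.
    by rewrite !mxE tnth_mktuple.
  have := congr1 (fun A : 'rV[{mpoly K[n]}]_n => (A *m \adj H) ord0 i) rH.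
  rewrite /= -mulmxA mul_mx_adj mul_mx_scalar mul0mx !mxE => /eqP.
  by rewrite mulf_eq0 (negbTE H0) => /eqP.
have pc : p = (p@_0)%:MP.
  apply/mpolyP => u; rewrite mcoeffC; case: (eqVneq u 0%MM) => [->|u0]; first by rewrite mulr1.
  rewrite mulr0; have [i ui] : exists i, u i != 0%N.
    apply: NNPP => nu; case/eqP: u0; apply/mnmP => i; rewrite mnm0E; apply/eqP/negP => /negP ui.
    by apply: nu; exists i.
  have /eqP := mcoeff_deriv i (u - U_(i)) p; rewrite dp0 mcoeff0 submK ?lep1mP //.
  rewrite eq_sym -mulr_natr mulf_eq0 ((pcharf0P K).1 char0) orbF => /eqP //.
by move: pT; rewrite pc comp_mpolyC => /eqP; rewrite mpolyC_eq0 => /eqP ->; rewrite mpolyC0.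
Qed.

Lemma polar_image_whole d : g \is d.+2.-homog -> (exists z, nonzero (grad g z)) ->
  hessian_det g != 0 -> forall z, polar_image g z <-> whole z.
Proof.
move=> hg [z0 [i0 G0]] H0 z; split=> [[]|nz] //; split=> // p _ pS.
suff -> : p = 0 by rewrite meval0.
apply: hessian_gradient_independent => //.
have gi : g^`M(i0) != 0 by apply: contraNneq G0 => E; rewrite /grad E meval0.
(* Multiplying by a non-zero partial derivative of [g] confines the test to points with non-zero
   gradient, the only ones whose image the polar image records. *)
apply/eqP; rewrite -(mulIr_eq0 _ (mulIf gi)); apply/negP => /negP nz'.
have [x] := mpoly_nonvanishing nz'; rewrite mevalM mulf_eq0 negb_or => /andP[px gx].
have nG : nonzero (grad g x) by exists i0.
case/eqP: px; rewrite comp_mpoly_meval -(pS (grad g x)).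
  by apply: meval_eq => i; rewrite tnth_mktuple.
by exists x; split=> //; exact: grad_nonzero hg _ nG.
Qed.
End Hessian.
End PolarMap.

Lemma degree_ge2 (K : closedFieldType) n d (g : {mpoly K[n]}) : (2 <= n)%N -> g \is d.-homog ->
  mirreducible g -> ~ is_cone g -> exists e, d = e.+2.
Proof.
move=> n2 hg [size_g _] nc; case: d hg => [|[|e]] hg; last by exists e.
  by have := msize_homog hg; rewrite leqNgt size_g.
by case: nc; exact: is_cone_of_linear.
Qed.

Theorem theorem2p1 (K : closedFieldType) (n d : nat) (g : {mpoly K[n]}) :
  [pchar K] =i pred0 ->
  (2 <= n)%N ->
  g \is d.-homog ->
  mirreducible g ->
  ~ is_cone g ->
  let f := fpoly g in
  let ZYs := polar_image g in
  let Y := dual_variety g in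
  let ZX := polar_image f in
  let Xs := dual_variety f in
  (* (i) *)
  (forall w, ZX w <-> cone_segre ZYs w) /\
  (* (ii) *)
  (forall q, Xs q <-> segre_tilde Y q) /\
  (* (iii) *)
  (exists dXs dZX dY dZYs : nat,
     has_dim Xs dXs /\ has_dim ZX dZX /\ has_dim Y dY /\ has_dim ZYs dZYs /\
     (dZX%:Z - dXs%:Z = (dZYs%:Z - dY%:Z) + 1)%R) /\
  (* in particular *)
  (hessian_det g != 0 ->
     (forall z, ZYs z <-> whole z) /\
     exists dXs dZX dY : nat,
       has_dim Xs dXs /\ has_dim ZX dZX /\ has_dim Y dY /\
       (dZX%:Z - dXs%:Z = ((n - 1)%N%:Z - dY%:Z) + 1)%R).
Proof.
move=> char0 n2 hg ig nc f ZYs Y ZX Xs.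
have [e de] := degree_ge2 n2 hg ig nc; rewrite {}de in hg.
have smooth : exists z, g.@[z] = 0 /\ nonzero (grad g z).
  (* Since [V g] is not a cone, the last variable occurs in [g] and the derivative in it is not the
     zero polynomial. *)
  case: n n2 g hg ig nc {f ZYs Y ZX Xs} => // m _ g hg ig nc.
  have [|z [gz dz]] := smooth_zero_last hg ig.
    by apply/eqP => dg0; apply: nc; exact: (is_cone_of_mderiv0 char0 hg dg0).
  exists z; split; first exact: gz.
  by exists ord_max; exact: dz.
have e0 : e.+2%:R != 0 :> K.
  by apply/eqP => E; have := (pcharf0P K).1 char0 e.+2; rewrite E eqxx.
have I1 w : ZX w <-> cone_segre ZYs w.
  by split; [apply: (polar_image_sub_cone hg) | apply: (cone_sub_polar_image hg)].
have I2 q : Xs q <-> segre_tilde Y q.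
  by split; [apply: (dual_sub_segre hg) | apply: (segre_sub_dual hg)].
have cY : zclosed Y := zclosure_closed _; have cZ : zclosed ZYs := zclosure_closed _.
have [z [gz nG]] := smooth; have nz := grad_nonzero hg nG.
have [|dY hY] := has_dim_exists cY.
  by exists (grad g z); apply: zclosure_sub => //; exists z.
have [|dZ hZ] := has_dim_exists cZ.
  by exists (grad g z); apply: zclosure_sub => //; exists z.
have hXs : has_dim Xs dY.+2.
  by apply: has_dim_ext (segre_tilde_dim cY hY) => q; split=> /I2.
have hZX : has_dim ZX dZ.+3.
  by apply: has_dim_ext (cone_segre_dim cZ hZ) => q; split=> /I1.
split=> //; split=> //; split.
  by exists dY.+2, dZ.+3, dY, dZ; do 4 split=> //; lia.
move=> H0; have W := polar_image_whole char0 hg (ex_intro _ z nG) H0; split=> //.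
have dZE : dZ = (n - 1)%N.
  apply: has_dim_uniq (has_dim_ext W hZ) _.
  move: n2; clear; case: n => // m _; rewrite subn1; exact: whole_dim.
by exists dY.+2, dZ.+3, dY; do 3 split=> //; rewrite -dZE; lia.
Qed.
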